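(* Assume that there is a non-negative measure $\nu_*^{[-1,1]}$ on $[-1,1]$ such that the level set sums have the representation $$\vartheta^{(N)}_v=\binom Nv\frac1{2^{N/2}}\Big\{g_\emptyset+\sum_{k=1}^N\mathbb E\big[Y_{\frac12}^k\big]\sqrt{\binom Nk}\,Q_k\big(v;N,\tfrac12\big)\cdot\zeta_k\Big\},\qquad v\in\mathbb N,$$ where $(\zeta_k)$ are i.i.d. $N(0,1)$ (with $\zeta_0=g_\emptyset$), and where $Y$ and $Y_{\frac12}$ are distributed respectively as the product of points in point processes with probability generating functionals $$G[f]=\frac1{1+\int_{[-1,1]}(1-f(\xi))\,\nu_*^{[-1,1]}(d\xi)}$$ and $G_{\frac12}[f]=G[f]^{\frac12}$. Define a Gaussian process $(\varkappa_t)_{t\in\mathbb R}$ by $$\varkappa_t=\frac1{\sqrt{2\pi}}e^{-\frac12t^2}\sum_{k=0}^\infty\mathbb E\big[Y_{\frac12}^k\big]\frac1{\sqrt{k!}}H_k(t)\cdot\zeta_k,$$ where $(\zeta_k)$ are i.i.d. $N(0,1)$ random variables. The covariance function of $(\varkappa_t)$ is $$\mathrm{Cov}(\varkappa_t,\varkappa_s)=\frac1{2\pi}e^{-\frac12(t^2+s^2)}\Big\{1+\sum_{k=1}^\infty\mathbb E\big[Y^k\big]\frac1{k!}H_k(t)H_k(s)\Big\}=\mathbb E\big[\mathfrak n(t,s;Y)\big],$$ where $\mathfrak n(t,s;\rho)$ is the standard bivariate normal density with correlation coefficient $\rho$. The scaled Gaussian field $$\frac12\sqrt{\frac N{2^N}}\Big(\vartheta^{(N)}_{\lfloor\frac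 N2+\frac{\sqrt N}2t\rfloor}\Big)_{|t|<\sqrt N}$$ converges weakly to $(\varkappa_t)$ as $N\to\infty$. Weak convergence is in the sense of finite-dimensional distributions converging.
   Context: The level set sums from the origin of a zero mean Gaussian field $(g^{(N)}_y)_{y\in\{0,1\}^N}$ are $\vartheta^{(N)}_v=\sum_{y:\|y\|=v}g^{(N)}_y$, where $\|y\|$ is the number of ones in $y$. The probability generating functional of a point process with points $(\xi_j)$ is $\mathbb E[\prod_jf(\xi_j)]$ for suitable functions $f$; in particular $\mathbb E[Y^k]=\mathbb E[Y_{\frac12}^k]^2$ for each $k$. The Krawtchouk polynomials $Q_k(\cdot;N,\frac12)$ are given by $\sum_{k=0}^N\binom NkQ_k(w;N,\frac12)\phi^k=(1-\phi)^w(1+\phi)^{N-w}$. The Hermite–Chebycheff polynomials $(H_k)_{k\ge0}$, orthogonal on the standard normal distribution, have generating function $\sum_{k=0}^\infty\frac{1}{k!}w^kH_k(t)=e^{wt-\frac12w^2}$. $\mathbb N=\{0,1,2,\dots\}$.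
   Formalization: The series defining ϰ_t is assumed to converge almost surely for every t, since the stated hypotheses do not ensure it: for ν_*=0 one has Y=1, the series diverges at t=0 and the variance of the scaled field tends to infinity. *)

(* Defs.v *)
From mathcomp Require Import all_boot all_order all_algebra.
From mathcomp Require Import all_classical all_reals all_analysis.

Set Implicit Arguments.
Unset Strict Implicit.
Unset Printing Implicit Defensive.

Import Order.TTheory GRing.Theory Num.Theory.
Import numFieldNormedType.Exports.

Local Open Scope classical_set_scope.
Local Open Scope ring_scope.

(* ['C(N, k) * krawtchouk N k w] is the coefficient of phi^k in
   (1 - phi)^w (1 + phi)^(N - w), for w <= N.  For w > N the truncated
   subtraction makes the value meaningless; there it is only ever multiplied
   by ['C(N, w) = 0]. *)
Definition krawtchouk (R : realType) (N k w : nat) : R :=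
  ((1 - 'X) ^+ w * (1 + 'X) ^+ (N - w) : {poly R})`_k / 'C(N, k)%:R.

(* H_k(t) is k! times the k-th Taylor coefficient at w = 0 of the generating
   function exp (w t - w^2 / 2). *)
Definition hermite (R : realType) (k : nat) (t : R) : R :=
  derive1n k (fun w : R => expR (w * t - 2^-1 * w ^+ 2)) 0.

(* For [`|rho| = 1] the value is 0, because [0^-1 = 0]. *)
Definition binormal_pdf (R : realType) (t s rho : R) : R :=
  (2 * pi * Num.sqrt (1 - rho ^+ 2))^-1 *
  expR (- ((t ^+ 2 - 2 * rho * t * s + s ^+ 2) / (2 * (1 - rho ^+ 2)))).

(* [normal_prob 0 sigma] is the normal law only for [sigma != 0]. *)
Definition centered_gaussian_law (R : realType) (mu : set R -> \bar R) : Prop :=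
  (forall A : set R, measurable A -> mu A = \d_(0 : R) A) \/
  exists2 sigma : R, sigma != 0 &
    forall A : set R, measurable A -> mu A = normal_prob 0 sigma A.

Definition centered_gaussian_process (d : measure_display)
    (T : measurableType d) (R : realType) (P : probability T R) (I : eqType)
    (X : I -> {RV P >-> R}) : Prop :=
  forall (s : seq I) (c : I -> R), uniq s ->
    centered_gaussian_law
      (pushforward P (fun x : T => \sum_(i <- s) c i * X i x)).

Definition mutually_independent (d : measure_display) (T : measurableType d)
    (R : realType) (P : probability T R) (zeta : nat -> {RV P >-> R}) : Prop :=
  forall (s : seq nat) (A : nat -> set R),
    uniq s -> (forall k, measurable (A k)) ->
    P (\big[setI/setT]_(k <- s) (zeta k @^-1` A k)) =
    (\prod_(k <- s) P (zeta k @^-1` A k))%E.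

Definition iid_std_normal (d : measure_display) (T : measurableType d)
    (R : realType) (P : probability T R) (zeta : nat -> {RV P >-> R}) : Prop :=
  mutually_independent zeta /\
  forall k (A : set R), measurable A ->
    distribution P (zeta k) A = normal_prob 0 1 A.

(* A random finite or countable family of points: in the state [x] the points
   are the [location j x] with [active j x]; multiplicities are allowed. *)
Record point_process (d : measure_display) (T : measurableType d)
    (R : realType) := PointProcess {
  active : nat -> T -> bool;
  location : nat -> T -> R;
  measurable_active : forall j, measurable_fun setT (active j);
  measurable_location : forall j, measurable_fun setT (location j);
  location_bound : forall j x, active j x -> -1 <= location j x <= 1
}.

(* Z is almost surely the (possibly infinite) product of the f(xi_j).  When
   |f| <= 1, neither convergence nor the limit depends on the enumeration of
   the points. *)
Definition is_point_product (d : measure_display) (T : measurableType d)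
    (R : realType) (P : probability T R) (Xi : point_process T R)
    (f : R -> R) (Z : T -> R) : Prop :=
  {ae P, forall x,
    (\prod_(j < n | active Xi j x) f (location Xi j x)) @[n --> \oo] --> Z x}.

(* The suitable test functions are the measurable f : [-1, 1] -> [-1, 1] for
   which the product of the f(xi_j) converges almost surely; this includes
   every measurable f : [-1, 1] -> [0, 1]. *)
Definition has_pgfl (d : measure_display) (T : measurableType d)
    (R : realType) (P : probability T R) (Xi : point_process T R)
    (G : (R -> R) -> R) : Prop :=
  forall (f : R -> R) (Z : {RV P >-> R}),
    measurable_fun setT f ->
    (forall u : R, -1 <= u <= 1 -> -1 <= f u <= 1) ->
    is_point_product P Xi f Z ->
    ('E_P[Z] = (G f)%:E)%E.

Definition distributed_as_product_of_points (d : measure_display)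
    (T : measurableType d) (R : realType) (P : probability T R)
    (Y : {RV P >-> R}) (G : (R -> R) -> R) : Prop :=
  exists (d' : measure_display) (T' : measurableType d')
         (P' : probability T' R) (Xi : point_process T' R)
         (Z : {RV P' >-> R}),
    [/\ has_pgfl P' Xi G,
        is_point_product P' Xi id Z &
        forall A : set R, measurable A ->
          distribution P Y A = distribution P' Z A].

(* 1 / (1 + int_[-1,1] (1 - f) dnu), with 1 / (1 + oo) = 0. *)
Definition pgfl (R : realType) (nu : {measure set R -> \bar R})
    (f : R -> R) : R :=
  let I := (\int[nu]_(xi in `[(-1)%R, 1%R]) (1 - f xi)%:E)%E in
  if I is r%:E%E then (1 + r)^-1 else 0.

Definition pgfl_half (R : realType) (nu : {measure set R -> \bar R})
    (f : R -> R) : R := pgfl nu f `^ 2^-1.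

Definition moment (d : measure_display) (T : measurableType d)
    (R : realType) (P : probability T R) (Y : {RV P >-> R}) (k : nat) : R :=
  fine ('E_P[fun x => (Y x ^+ k)%R])%E.

Definition level_set_sum (T : Type) (R : realType) (N : nat)
    (g : N.-tuple bool -> T -> R) (v : nat) (x : T) : R :=
  \sum_(y : N.-tuple bool | count id y == v) g y x.

(* The level index is the floor of N/2 + sqrt N t / 2 for every t in the index
   range |t| < sqrt N; outside of it (finitely many N for each t) the value is
   irrelevant to limits as N -> oo. *)
Definition scaled_level_sum (T : Type) (R : realType) (N : nat)
    (g : N.-tuple bool -> T -> R) (t : R) (x : T) : R :=
  2^-1 * Num.sqrt (N%:R / 2 ^+ N) *
  level_set_sum g (Num.truncn (N%:R / 2 + Num.sqrt N%:R / 2 * t)) x.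

Definition fdd_cvg (R : realType) (I : Type)
    (dN : nat -> measure_display) (TN : forall N, measurableType (dN N))
    (PN : forall N, probability (TN N) R) (XN : forall N, I -> TN N -> R)
    (d : measure_display) (T : measurableType d) (P : probability T R)
    (X : I -> T -> R) : Prop :=
  forall (m : nat) (t : 'I_m -> I) (phi : 'rV[R]_m -> R),
    continuous phi -> (exists M : R, forall u, `|phi u| <= M) ->
    'E_(PN N)[fun x => phi (\row_i XN N (t i) x)%R]%E @[N --> \oo] -->
    'E_P[fun x => phi (\row_i X (t i) x)%R]%E.

(* Main.v *)
Require Import Defs.
From mathcomp Require Import all_boot all_order all_algebra.
From mathcomp Require Import all_classical all_reals all_analysis.
From mathcomp Require Import measurable_realfun.
From mathcomp Require Import ring lra zify.

(** With v = level_index t N and centred level close to t, the representation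
    gives the scaled sum over level v the form
      sum over k <= N of  m_k * level_coef R N v k * zeta_k,
    where m_k = E[Yhalf^k], and kappa_t is the series of
    m_k * hermite_coef t k * zeta_k.  Replacing zeta_k by (-1)^k zeta_k, both
    are combinations of one i.i.d. standard normal sequence, so that everything
    reduces to the convergence of coefficients in the l2 norm:
      sum over k of  mu_k * ((-1)^k level_coef R N v k - hermite_coef t k)^2 -> 0
    with mu_k = m_k^2 = E[Y^k] (sqr_moment_half).

    Each coefficient converges (cvg_level_coef): the central factor by the local
    limit theorem for binomial coefficients, the Krawtchouk factor because its
    three-term recurrence tends to that of the Hermite polynomials.  The tails
    are uniformly small thanks to a bound on the Krawtchouk coefficients which
    does not depend on N (level_coef_bound): for 0 <= r < 1,
      sum over k of  r^k * level_coef R N v k ^ 2 <= 1 / (2 sqrt (1 - r^2)).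
    It comes from computing in two ways the probability that a random point of
    the cube and a noisy copy of it both lie on the level v (kraw_noise_bound).
    Letting N tend to infinity gives the same bound for hermite_coef.

    To integrate this bound over r = Y, one needs |Y| < 1 almost surely and
    E[1 / sqrt (1 - Y^2)] finite.  Both follow from the convergence of the
    series that defines kappa_0, together with Mehler's formula at t = s = 0
    (moment_summable_weight).  Mehler's formula itself, that is
      sum over k of  r^k * hermite_coef t k * hermite_coef s k = binormal_pdf t s r,
    holds because both sides solve the same linear differential equation in r
    (mehler_formula); integrated over r = Y, it gives the covariance.

    On the probabilistic side, a linear combination of independent standard
    normal variables is normal, by rotation invariance of the Gaussian plane
    (std_normal_sum), and an almost sure limit of such combinations is normal
    with the limit variance (gaussian_limit).  This gives the Gaussian process,
    its covariance by polarisation, and turns convergence of coefficients into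
    convergence of finite-dimensional distributions (gaussian_fdd_cvg). *)

Set Implicit Arguments.
Unset Strict Implicit.
Unset Printing Implicit Defensive.

Import Order.TTheory GRing.Theory Num.Theory.
Import numFieldNormedType.Exports.

Local Open Scope classical_set_scope.
Local Open Scope ring_scope.

(** * Krawtchouk coefficients and their duality *)

(** The Krawtchouk polynomial before division by 'C(N, k), a value that makes
    sense in any ring. *)
Definition kraw_coef (R : comNzRingType) (N k v : nat) : R :=
  ((1 - 'X) ^+ v * (1 + 'X) ^+ (N - v) : {poly R})`_k.

Lemma coef_bivariate (R : comNzRingType) (f g : {poly R}) (v u : nat) :
  (map_poly polyC f * g%:P)`_v`_u = f`_v * g`_u.
Proof. by rewrite coefMC coef_map coefCM. Qed.

(** The two sides are the coefficients of x^v y^k in the two forms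
    ((1 + y) + x (1 - y))^N and ((1 + x) + y (1 - x))^N of the same polynomial. *)
Lemma kraw_coef_duality (R : comNzRingType) (N k v : nat) :
  (k <= N)%N -> (v <= N)%N ->
  'C(N, v)%:R * kraw_coef R N k v = 'C(N, k)%:R * kraw_coef R N v k.
Proof.
move=> kN vN.
pose x : {poly {poly R}} := 'X; pose y : {poly {poly R}} := ('X)%:P.
have E : ((1 + y) + x * (1 - y)) ^+ N = ((1 + x) + y * (1 - x)) ^+ N.
  by congr (_ ^+ _); ring.
have yE (i j : nat) : (1 + y) ^+ j * (1 - y) ^+ i =
    ((1 + 'X) ^+ j * (1 - 'X) ^+ i : {poly R})%:P.
  by rewrite /y -polyCB -polyCD -!rmorphXn /= -polyCM.
have xE (i j : nat) : (1 + x) ^+ j * (1 - x) ^+ i =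
    map_poly polyC ((1 + 'X) ^+ j * (1 - 'X) ^+ i : {poly R}).
  by rewrite rmorphM !rmorphXn rmorphB rmorphD /= map_polyX map_polyC /=.
have cX (p : {poly {poly R}}) i j :
    (x ^+ i * p)`_j = if (j < i)%N then 0 else p`_(j - i) by exact: coefXnM.
have := congr1 (fun p : {poly {poly R}} => p`_v`_k) E.
rewrite /= !exprDn !coef_sum.
rewrite (bigD1 (Ordinal (vN : (v < N.+1)%N))) //= big1 ?addr0; last first.
  move=> i /negP iv; rewrite exprMn mulrCA yE coefMn cX.
  case: ltnP => [vi|iv']; first by rewrite mul0rn coef0.
  rewrite coefC subn_eq0; case: leqP => vi; last by rewrite mul0rn coef0.
  by case: iv; apply/eqP/val_inj => /=; lia.
rewrite exprMn mulrCA yE coefMn cX ltnn subnn coefC eqxx coefMn.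
rewrite (bigD1 (Ordinal (kN : (k < N.+1)%N))) //= big1 ?addr0; last first.
  move=> i /negP ik; rewrite exprMn mulrCA [_ * (_ * _)]mulrC xE /y -rmorphXn.
  rewrite !coefMn coef_bivariate coefXn; case: eqP => [ki|]; last first.
    by rewrite mulr0 mul0rn.
  by case: ik; apply/eqP/val_inj.
rewrite exprMn mulrCA [_ * (_ * _)]mulrC xE /y -rmorphXn !coefMn coef_bivariate.
rewrite coefXn eqxx mulr1 /kraw_coef -[_ *+ 'C(N, v)]mulr_natl -[_ *+ 'C(N, k)]mulr_natl => H.
by rewrite [(1 - 'X) ^+ v * _]mulrC H [(1 - 'X) ^+ k * _]mulrC.
Qed.

(** * A dimension-free bound on Krawtchouk coefficients *)

Lemma leq_bin_central n i : ('C(n, i) <= 'C(n, n./2))%N.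
Proof.
have step j : (j.*2 < n)%N -> ('C(n, j) <= 'C(n, j.+1))%N.
  move=> jn; rewrite -(@leq_pmul2l j.+1)// mul_bin_left leq_mul2r.
  by apply/orP; right; lia.
have low d : forall j, (j + d = n./2)%N -> ('C(n, j) <= 'C(n, n./2))%N.
  elim: d => [|d IH] j jd; first by rewrite -jd addn0.
  apply: leq_trans (step j _) (IH j.+1 _); lia.
have [ni|ni] := ltnP n i; first by rewrite bin_small.
have [i2|i2] := leqP i n./2; first by apply: (low (n./2 - i)%N); lia.
by rewrite -bin_sub//; apply: (low (n./2 - (n - i))%N); lia.
Qed.

Lemma bin_double_succ m :
  (m.+1 * 'C(m.+1.*2, m.+1) = 2 * m.*2.+1 * 'C(m.*2, m))%N.
Proof.
have /= H1 := mul_bin_diag m.*2.+2 m; have /= H2 := mul_bin_diag m.*2.+1 m.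
have H3 : 'C(m.*2.+1, m.+1) = 'C(m.*2.+1, m).
  by rewrite -bin_sub; [congr 'C(_, _); lia|lia].
rewrite H3 in H2; rewrite doubleS; apply/eqP; rewrite -(eqn_pmul2l (ltn0Sn m)).
have E : m.*2.+2 = (2 * m.+1)%N by lia.
by rewrite -H1 -[(2 * _ * _)%N]mulnA H2 E -!mulnA.
Qed.

(** By induction, since the ratio of consecutive central coefficients is
    2 (2 m + 1) / (m + 1), and (2 m + 1) (2 m + 3) <= (2 m + 2)^2. *)
Lemma sqr_bin_double m : (m.*2.+1 * 'C(m.*2, m) ^ 2 <= 16 ^ m)%N.
Proof.
elim: m => [|m IH]; first by rewrite bin0.
rewrite -(@leq_pmul2l (m.+1 ^ 2))// mulnCA -expnMn bin_double_succ.
rewrite [(16 ^ m.+1)%N]expnS.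
have H : (m.+1.*2.+1 * m.*2.+1 <= 4 * m.+1 ^ 2)%N by rewrite expnS expn1; lia.
have := leq_mul (leqnn 4) (leq_mul H IH).
move: 'C(_, _) (16 ^ m)%N m.+1.*2.+1 (m.*2.+1)%N (m.+1 ^ 2)%N => c e A B C.
have -> : (4 * (A * B * (B * c ^ 2)) = A * (2 * B * c) ^ 2)%N by ring.
by have -> : (4 * (4 * C * e) = C * (16 * e))%N by ring.
Qed.

Lemma sqr_bin_le n i : (n.+1 * 'C(n, i) ^ 2 <= 4 ^ n)%N.
Proof.
apply: (@leq_trans (n.+1 * 'C(n, n./2) ^ 2)).
  by rewrite leq_mul2l/= leq_exp2r// leq_bin_central.
rewrite -(odd_double_half n); case: (odd n); set m := n./2; last first.
  by rewrite add0n half_double -mul2n expnM mul2n sqr_bin_double.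
rewrite add1n /= uphalf_double -(@leq_pmul2l 4)// -expnS.
have -> : (4 ^ m.*2.+2 = 16 ^ m.+1)%N by rewrite -doubleS -mul2n expnM.
have -> : (4 * (m.*2.+2 * 'C(m.*2.+1, m) ^ 2) = m.*2.+2 * 'C(m.+1.*2, m.+1) ^ 2)%N.
  rewrite doubleS binS.
  have -> : 'C(m.*2.+1, m.+1) = 'C(m.*2.+1, m).
    by rewrite -bin_sub; [congr 'C(_, _); lia|lia].
  by ring.
apply: leq_trans (sqr_bin_double m.+1).
by rewrite leq_mul2r; apply/orP; right; lia.
Qed.

Lemma bin_le_sqrt (R : rcfType) n i :
  'C(n, i)%:R <= 2 ^+ n / Num.sqrt n.+1%:R :> R.
Proof.
rewrite ler_pdivlMr ?sqrtr_gt0 ?ltr0n//.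
have -> : 'C(n, i)%:R = Num.sqrt ('C(n, i)%:R ^+ 2) :> R by rewrite sqrtr_sqr ger0_norm.
have -> : 2 ^+ n = Num.sqrt ((2 ^+ n) ^+ 2) :> R by rewrite sqrtr_sqr ger0_norm// exprn_ge0.
rewrite -sqrtrM ?sqr_ge0// ler_sqrt ?exprn_ge0//.
have -> : 2 ^+ n ^+ 2 = (4 ^ n)%:R :> R.
  by rewrite exprAC natrX; congr (_ ^+ n); rewrite expr2 -natrM.
rewrite -natrX -natrM mulnC ler_nat.
exact: sqr_bin_le.
Qed.

(** Expanding both powers: the monomial x^(l + j - i) y^(l + i) contributes only
    when it is x^v y^v. *)
Lemma coef_diag (R : comNzRingType) (M j v : nat) :
  (((1 + 'X * ('X)%:P) ^+ M * ('X + ('X)%:P) ^+ j : {poly {poly R}})`_v)`_v =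
  \sum_(l < M.+1) \sum_(i < j.+1)
    'C(M, l)%:R * 'C(j, i)%:R * ((l + (j - i) == v) && (l + i == v))%N%:R.
Proof.
rewrite !exprDn mulr_suml !coef_sum; apply: eq_bigr => l _.
rewrite mulr_sumr !coef_sum; apply: eq_bigr => i _.
have mulrnM (a b : {poly {poly R}}) (m n : nat) :
    (a *+ m) * (b *+ n) = (a * b) *+ m *+ n by rewrite mulrnAr mulrnAl.
rewrite expr1n mul1r exprMn mulrnM !coefMn.
have -> : 'X^l * ('X)%:P ^+ l * ('X^(j - i) * ('X)%:P ^+ i) =
    map_poly polyC 'X^(l + (j - i)) * ('X^(l + i))%:P :> {poly {poly R}}.
  by rewrite map_polyXn rmorphXn /= !exprD; ring.
rewrite coef_bivariate !coefXn -mulnb natrM ![v == _]eq_sym.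
by rewrite -[_ *+ 'C(M, l)]mulr_natl -[_ *+ 'C(j, i)]mulr_natl; ring.
Qed.

Lemma sum_bin_pick (R : rcfType) (n c : nat) :
  \sum_(i < n.+1) (i == c :> nat)%:R * 'C(n, i)%:R <= 2 ^+ n / Num.sqrt n.+1%:R :> R.
Proof.
have [cn|cn] := ltnP c n.+1.
  rewrite (bigD1 (Ordinal cn)) //= eqxx mul1r big1 ?addr0 ?bin_le_sqrt// => i ic.
  by rewrite (_ : (i == c :> nat) = false) ?mul0r//; exact: negbTE.
rewrite big1 ?divr_ge0 ?exprn_ge0 ?sqrtr_ge0// => i _.
by rewrite (_ : (i == c :> nat) = false) ?mul0r//; apply/eqP; have := ltn_ord i; lia.
Qed.

(** The conditions l + j - i = v and l + i = v leave at most one pair (l, i), so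
    that the coefficient is at most a product of two binomial coefficients, each
    bounded by bin_le_sqrt. *)
Lemma coef_diag_bound (R : rcfType) (M j v : nat) :
  0 <= (((1 + 'X * ('X)%:P) ^+ M * ('X + ('X)%:P) ^+ j : {poly {poly R}})`_v)`_v
    <= 2 ^+ (M + j) / Num.sqrt (M.+1%:R * j.+1%:R).
Proof.
rewrite coef_diag; apply/andP; split.
  by apply: sumr_ge0 => l _; apply: sumr_ge0 => i _; rewrite !mulr_ge0.
apply: (@le_trans _ _ (\sum_(l < M.+1) \sum_(i < j.+1)
  ((l == v - j./2 :> nat)%N%:R * 'C(M, l)%:R) * ((i == j./2 :> nat)%N%:R * 'C(j, i)%:R))).
  apply: ler_sum => l _; apply: ler_sum => i _.
  rewrite [leRHS](_ : _ = 'C(M, l)%:R * 'C(j, i)%:R * ((l == v - j./2 :> nat) && (i == j./2 :> nat))%N%:R).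
    apply: ler_wpM2l; first by rewrite mulr_ge0.
    rewrite ler_nat; case: andP => //= -[/eqP h1 /eqP h2].
    by rewrite [X in X && _](_ : _ = true) 1?[X in _ && X](_ : _ = true)//; apply/eqP;
      have := ltn_ord i; lia.
  by rewrite -mulnb natrM; ring.
rewrite exprD sqrtrM ?ler0n// invfM mulrACA.
under eq_bigr do rewrite -mulr_sumr.
rewrite -mulr_suml; apply: ler_pM; try exact: sum_bin_pick;
  by apply: sumr_ge0 => i _; rewrite mulr_ge0.
Qed.

(** The left-hand side is the coefficient of x^v y^v in
    ((1 + x) (1 + y) + r (1 - x) (1 - y))^N, and the base is also
    (1 + r) (1 + x y) + (1 - r) (x + y).  Up to a power of 2, this computes the
    probability that two points of the cube, whose coordinates agree
    independently with probability (1 + r) / 2, both lie on the level v; on the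
    right, j is the number of coordinates where they differ. *)
Lemma kraw_noise_identity (R : comNzRingType) (N v : nat) (r : R) :
  \sum_(k < N.+1) r ^+ k * 'C(N, k)%:R * kraw_coef R N v k ^+ 2 =
  \sum_(j < N.+1) 'C(N, j)%:R * (1 + r) ^+ (N - j) * (1 - r) ^+ j *
    (((1 + 'X * ('X)%:P) ^+ (N - j) * ('X + ('X)%:P) ^+ j : {poly {poly R}})`_v)`_v.
Proof.
pose x : {poly {poly R}} := 'X; pose y : {poly {poly R}} := ('X)%:P.
pose c : {poly {poly R}} := (r%:P)%:P.
have E : ((1 + x) * (1 + y) + c * ((1 - x) * (1 - y))) ^+ N =
         ((1 + c) * (1 + x * y) + (1 - c) * (x + y)) ^+ N.
  by congr (_ ^+ _); ring.
have := congr1 (fun p : {poly {poly R}} => p`_v`_v) E.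
rewrite /= !exprDn !coef_sum.
have xyE i : ((1 + x) * (1 + y)) ^+ (N - i) * (c * ((1 - x) * (1 - y))) ^+ i =
    ((r ^+ i)%:P)%:P * (map_poly polyC ((1 - 'X) ^+ i * (1 + 'X) ^+ (N - i)) *
    ((1 - 'X) ^+ i * (1 + 'X) ^+ (N - i) : {poly R})%:P).
  rewrite !rmorphM !rmorphXn !rmorphB !rmorphD !rmorph1 /= map_polyX -/x -/y -/c.
  by rewrite !exprMn; ring.
have xyE' i : ((1 + c) * (1 + x * y)) ^+ (N - i) * ((1 - c) * (x + y)) ^+ i =
    (((1 + r) ^+ (N - i) * (1 - r) ^+ i)%:P)%:P * ((1 + x * y) ^+ (N - i) * (x + y) ^+ i).
  rewrite !rmorphM !rmorphXn !rmorphB !rmorphD !rmorph1 /= -/c.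
  by rewrite !exprMn; ring.
move=> H; transitivity (\sum_(i < N.+1) (((1 + x) * (1 + y)) ^+ (N - i) *
    (c * ((1 - x) * (1 - y))) ^+ i *+ 'C(N, i))`_v`_v).
  apply: eq_bigr => i _; rewrite xyE !coefMn !coefCM coef_bivariate.
  by rewrite -/(kraw_coef _ _ _ _) -[RHS]mulr_natl; ring.
rewrite H; apply: eq_bigr => i _; rewrite xyE' !coefMn !coefCM.
by rewrite -[LHS]mulr_natl !mulrA.
Qed.

Lemma mul_bin_add2 N j : (j <= N)%N ->
  (N.+1 * N.+2 * 'C(N, j) = j.+1 * (N - j).+1 * 'C(N.+2, j.+1))%N.
Proof.
move=> jN; have /= H1 := mul_bin_diag N.+2 j; have /= H2 := mul_bin_down N.+1 j.
rewrite mulnAC H2 subSn// -mulnA [('C(_, _) * N.+2)%N]mulnC H1; ring.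
Qed.

(** By coef_diag_bound the mean of 1 / sqrt (S j) under the binomial weights w j
    remains to be bounded, with S j = (N - j + 1) (j + 1).  The mean of 1 / S j
    is explicit, because 'C(N, j) / S j is a multiple of 'C(N + 2, j + 1), and
    the inequality u <= (L / 2) u^2 + 1 / (2 L) reduces the first mean to it. *)
Lemma kraw_noise_bound (R : rcfType) (N v : nat) (r : R) :
  0 <= r -> r < 1 -> (0 < N)%N ->
  \sum_(k < N.+1) r ^+ k * 'C(N, k)%:R * kraw_coef R N v k ^+ 2 <=
  4 ^+ N * (2 / (N%:R * Num.sqrt (1 - r ^+ 2))).
Proof.
move=> r0 r1 N0; rewrite kraw_noise_identity.
have Nr : 0 < N%:R :> R by rewrite ltr0n.
have r2 : 0 < 1 - r ^+ 2 by rewrite subr_gt0 exprn_ilt1.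
set s := Num.sqrt _; have s0 : 0 < s by rewrite sqrtr_gt0.
have s2 : s ^+ 2 = 1 - r ^+ 2 by rewrite sqr_sqrtr// ltW.
pose w j : R := 'C(N, j)%:R * (1 + r) ^+ (N - j) * (1 - r) ^+ j.
have r1' : 0 <= 1 - r by rewrite subr_ge0 ltW.
have r1'' : 0 <= 1 + r by rewrite addr_ge0.
have w0 j : 0 <= w j by rewrite /w !mulr_ge0// exprn_ge0.
have sumw : \sum_(j < N.+1) w j = 2 ^+ N.
  have -> : 2 = (1 + r) + (1 - r) by ring.
  by rewrite exprDn; apply: eq_bigr => i _; rewrite -mulr_natl mulrA.
pose S j : R := (N - j).+1%:R * j.+1%:R.
have S0 j : 0 < S j by rewrite mulr_gt0.
have sumwS : \sum_(j < N.+1) w j / S j <= 2 ^+ N * 4 / (N%:R ^+ 2 * s ^+ 2).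
  apply: (@le_trans _ _ (2 ^+ N.+2 / (N.+1%:R * N.+2%:R) / s ^+ 2)); last first.
    rewrite -[leLHS]mulrA -invfM (_ : 2 ^+ N.+2 = 2 ^+ N * 4); last first.
      by rewrite !exprS; ring.
    apply: ler_wpM2l; first by rewrite mulr_ge0// exprn_ge0.
    rewrite lef_pV2 ?posrE ?mulr_gt0 ?exprn_gt0//.
    by rewrite ler_pM2r ?exprn_gt0// expr2 -!natrM ler_nat; lia.
  rewrite ler_pdivlMr ?exprn_gt0// mulr_suml.
  pose T i : R := (1 + r) ^+ (N.+2 - i) * (1 - r) ^+ i *+ 'C(N.+2, i).
  have T0 i : 0 <= T i by rewrite mulrn_wge0// mulr_ge0// exprn_ge0.
  have sumT : \sum_(j < N.+1) T j.+1 <= 2 ^+ N.+2.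
    have -> : 2 ^+ N.+2 = \sum_(i < N.+3) T i.
      by rewrite -exprDn; congr (_ ^+ _); ring.
    rewrite [leRHS]big_ord_recl [X in _ <= _ + X]big_ord_recr /= addrCA.
    by rewrite lerDl addr_ge0.
  apply: (@le_trans _ _ ((\sum_(j < N.+1) T j.+1) / (N.+1%:R * N.+2%:R))); last first.
    by apply: ler_wpM2r => //; rewrite invr_ge0 mulr_ge0.
  rewrite mulr_suml; apply: ler_sum => j _.
  have jN : (j <= N)%N by rewrite -ltnS.
  rewrite /T subSS subSn// s2.
  have := congr1 (fun n => n%:R : R) (mul_bin_add2 jN); rewrite !natrM => H.
  have -> : w j = (j.+1%:R * (N - j).+1%:R * 'C(N.+2, j.+1)%:R / (N.+1%:R * N.+2%:R))
      * ((1 + r) ^+ (N - j) * (1 - r) ^+ j).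
    rewrite /w -mulrA; congr (_ * _); apply: (canRL (mulfK _)).
      by rewrite mulf_neq0// pnatr_eq0.
    by rewrite mulrC.
  rewrite /S [(1 + r) ^+ (N - j).+1]exprS [(1 - r) ^+ j.+1]exprS -[X in _ <= X / _]mulr_natl.
  rewrite le_eqVlt; apply/orP; left; apply/eqP; field.
  by rewrite -!(natrD _ 1) -(natrD _ 2) !pnatr_eq0.
apply: (@le_trans _ _ (\sum_(j < N.+1) 2 ^+ N * (w j / Num.sqrt (S j)))).
  apply: ler_sum => j _; rewrite -/(w j) [leRHS]mulrCA; apply: ler_wpM2l => //.
  have jN : (j <= N)%N by rewrite -ltnS.
  have /andP[_] := coef_diag_bound R (N - j) j v.
  by rewrite subnK.
rewrite -mulr_sumr (_ : 4 = 2 * 2) ?exprMn -?natrM// -mulrA.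
rewrite ler_pM2l ?exprn_gt0//.
(* This value of L balances the two terms of the inequality. *)
pose L := N%:R * s / 2.
have L0 : 0 < L by rewrite !mulr_gt0.
apply: (@le_trans _ _ (\sum_(j < N.+1) ((L / 2) * (w j / S j) + (2 * L)^-1 * w j))).
  apply: ler_sum => j _.
  rewrite [leRHS](_ : _ = w j * ((L / 2) / S j + (2 * L)^-1)); last by ring.
  apply: ler_wpM2l => //.
  have -> : (S j)^-1 = (Num.sqrt (S j))^-1 ^+ 2 by rewrite exprVn sqr_sqrtr// ltW.
  set u := _^-1.
  rewrite -subr_ge0 [leRHS](_ : _ = (L * u - 1) ^+ 2 / (2 * L)); last first.
    by field; rewrite gt_eqF.
  by rewrite divr_ge0 ?sqr_ge0// mulr_ge0// ltW.
rewrite big_split /= -!mulr_sumr sumw.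
apply: (@le_trans _ _ (L / 2 * (2 ^+ N * 4 / (N%:R ^+ 2 * s ^+ 2)) + (2 * L)^-1 * 2 ^+ N)).
  by rewrite lerD2r; apply: ler_wpM2l => //; rewrite divr_ge0// ltW.
rewrite /L le_eqVlt; apply/orP; left; apply/eqP; field.
by rewrite !gt_eqF.
Qed.

(** * Recurrences of the Hermite and Krawtchouk polynomials *)

Fixpoint hermite_poly (R : nzRingType) (k : nat) : {poly R} :=
  if k is k'.+1 then 'X * hermite_poly R k' - (hermite_poly R k')^`() else 1.

Lemma deriv_hermite_poly (R : comNzRingType) k :
  (hermite_poly R k.+1)^`() = k.+1%:R *: hermite_poly R k.
Proof.
elim: k => [|k IH].
  rewrite /= derivB derivM derivX derivC deriv0 mulr0 addr0 subr0 mul1r scale1r //.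
rewrite [hermite_poly R k.+2]/= -/(hermite_poly R k.+1) derivB derivM derivX mul1r.
rewrite IH derivZ -[in LHS]scalerAr -addrA -scalerBr.
by rewrite -/(hermite_poly R k.+1) -[k.+2%:R]natr1 scalerDl scale1r addrC.
Qed.

(** The generating function g satisfies g' = (t - w) g, so that each derivative is
    g times a polynomial in t - w, and these polynomials obey the recursion of
    hermite_poly. *)
Lemma hermite_derive1n (R : realType) (k : nat) (t : R) :
  derive1n k (fun w : R => expR (w * t - 2^-1 * w ^+ 2)) =
  (fun w => (hermite_poly R k).[t - w] * expR (w * t - 2^-1 * w ^+ 2)).
Proof.
elim: k => [|k IH]; first by apply/funext => w; rewrite derive1n0 /= -polyC1 hornerC mul1r.
rewrite derive1nS IH; apply/funext => w; rewrite derive1E.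
set p := hermite_poly R k.
have D : is_derive w 1 (fun w : R => p.[t - w] * expR (w * t - 2^-1 * w ^+ 2))
    ((p.[t - w] * (t - w) - p^`().[t - w]) * expR (w * t - 2^-1 * w ^+ 2)).
  have D1 : is_derive w 1 (fun w : R => p.[t - w]) (- p^`().[t - w]).
    have -> : (fun w : R => p.[t - w]) = horner p \o (fun w => t - w) by [].
    by apply: trigger_derive; rewrite add0r mul1r mulrN1.
  have D2 : is_derive w 1 (fun w : R => expR (w * t - 2^-1 * w ^+ 2))
     (expR (w * t - 2^-1 * w ^+ 2) * (t - w)).
    have -> : (fun w : R => expR (w * t - 2^-1 * w ^+ 2)) =
       expR \o (fun w => w * t - 2^-1 * w ^+ 2) by [].
    apply: trigger_derive; congr (_ * _).
    by rewrite /GRing.scale /=; field.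
  by apply: trigger_derive; rewrite /GRing.scale /=; ring.
rewrite derive_val; congr (_ * _).
by rewrite !hornerE; ring.
Qed.

Lemma hermiteE (R : realType) k (t : R) : hermite k t = (hermite_poly R k).[t].
Proof.
by rewrite /hermite hermite_derive1n mul0r expr0n /= mulr0 !subr0 expR0 mulr1.
Qed.

Lemma hermite0 (R : realType) (t : R) : hermite 0 t = 1.
Proof. by rewrite hermiteE hornerC. Qed.

Lemma hermite1 (R : realType) (t : R) : hermite 1 t = t.
Proof. by rewrite hermiteE /= derivC subr0 mulr1 hornerX. Qed.

Lemma hermiteSS (R : realType) k (t : R) :
  hermite k.+2 t = t * hermite k.+1 t - k.+1%:R * hermite k t.
Proof.
rewrite !hermiteE [hermite_poly R k.+2]/= -/(hermite_poly R k.+1).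
by rewrite deriv_hermite_poly !hornerE.
Qed.

Lemma hermite_odd0 (R : realType) k : odd k -> hermite k (0 : R) = 0.
Proof.
have : hermite 1 (0 : R) = 0 by rewrite hermite1.
elim/ltn_ind: k => -[//|[//|k]] IH h1 /=; rewrite negbK => ok.
by rewrite hermiteSS mul0r sub0r IH ?mulr0 ?oppr0// ltnW.
Qed.

(** The generating function f = (1 - x)^v (1 + x)^(N - v) satisfies
    (1 - x^2) f' = (N - 2 v - N x) f; compare the coefficients of x^(k + 1). *)
Lemma kraw_coefSS (R : comNzRingType) N v k : (v <= N)%N ->
  k.+2%:R * kraw_coef R N k.+2 v =
  (N%:R - 2 * v%:R) * kraw_coef R N k.+1 v - (N%:R - k%:R) * kraw_coef R N k v.
Proof.
move=> vN; rewrite /kraw_coef; set f : {poly R} := (_ * _)%R.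
have E : (1 - 'X^2) * f^`() = ((N%:R - 2 * v%:R)%:P - N%:R%:P * 'X) * f.
  have dM n : ((1 - 'X : {poly R}) ^+ n)^`() * (1 - 'X) = - (n%:R * (1 - 'X) ^+ n).
    rewrite deriv_exp derivB derivC derivX sub0r.
    case: n => [|n]; first by rewrite mulr0n !mul0r oppr0.
    by rewrite -mulr_natl exprS /=; ring.
  have dP n : ((1 + 'X : {poly R}) ^+ n)^`() * (1 + 'X) = (n%:R * (1 + 'X) ^+ n).
    rewrite deriv_exp derivD derivC derivX add0r.
    case: n => [|n]; first by rewrite mulr0n !mul0r.
    by rewrite -mulr_natl exprS /=; ring.
  transitivity ((((1 - 'X : {poly R}) ^+ v)^`() * (1 - 'X)) * (1 + 'X) ^+ (N - v) * (1 + 'X) +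
     (1 - 'X) ^+ v * (((1 + 'X : {poly R}) ^+ (N - v))^`() * (1 + 'X)) * (1 - 'X)).
    by rewrite derivM; ring.
  rewrite dM dP natrB// /f polyCB !polyCM !polyC_natr; ring.
have := congr1 (fun p : {poly R} => p`_k.+1) E.
rewrite mulrBl mul1r coefB coefXnM coef_deriv [in RHS]mulrBl [in RHS]coefB.
rewrite -[X in _ = _ - X]/((N%:R%:P * 'X * f)`_k.+1) -mulrA !coefCM coefXM /=.
have -> : (if (k.+1 < 2)%N then 0 else f^`()`_(k.+1 - 2)) = k%:R * f`_k.
  case: k => [|k] /=; first by rewrite mul0r.
  by rewrite subSS subSS subn0 coef_deriv mulr_natl.
by move=> /eqP; rewrite subr_eq => /eqP H; rewrite mulr_natl H; ring.
Qed.

Lemma kraw_coef0 (R : comNzRingType) N v : kraw_coef R N 0 v = 1.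
Proof.
rewrite /kraw_coef coef0M -!horner_coef0 !horner_exp !hornerE.
by rewrite subr0 !expr1n mulr1.
Qed.

Lemma kraw_coef1 (R : comNzRingType) N v : (v <= N)%N ->
  kraw_coef R N 1 v = N%:R - 2 * v%:R.
Proof.
move=> vN; rewrite /kraw_coef; set f : {poly R} := (_ * _)%R.
have -> : f`_1 = f^`().[0] by rewrite horner_coef0 coef_deriv.
rewrite /f derivM !deriv_exp derivB derivD derivC derivX sub0r add0r.
rewrite !(hornerD, hornerM, hornerMn, horner_exp, hornerN, hornerX, hornerC).
rewrite !(subr0, addr0, expr1n, mulr1, mul1r) natrB//.
by rewrite mulNrn; ring.
Qed.

(** * The central binomial coefficient *)

(** The reduction formula for the integral of cos ^ n, read as a recursive
    definition of an antiderivative. *)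
Fixpoint cos_primitive (R : realType) (n : nat) (x : R) : R :=
  match n with
  | 0 => x
  | 1 => sin x
  | (n'.+1 as m).+1 =>
    (m.+1%:R)^-1 * (sin x * cos x ^+ m + m%:R * cos_primitive n' x)
  end.

Lemma is_derive_cos_primitive (R : realType) n (x : R) :
  is_derive x 1 (@cos_primitive R n) (cos x ^+ n).
Proof.
have [//] : is_derive x 1 (@cos_primitive R n) (cos x ^+ n) /\
  is_derive x 1 (@cos_primitive R n.+1) (cos x ^+ n.+1).
elim: n => [|n [IH1 IH2]].
  by split; [exact: is_derive_id|exact: is_derive_sin].
split => //.
have D := is_deriveZ (n.+2%:R)^-1 (is_deriveD
  (is_deriveM (is_derive_sin x) (is_deriveX n.+1 (is_derive_cos x)))
  (is_deriveZ n.+1%:R IH1)).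
have -> : @cos_primitive R n.+2 = (n.+2%:R^-1 : R) \*:
    (sin * cos ^+ n.+1 + (n.+1%:R : R) \*: @cos_primitive R n).
  by apply/funext => y; rewrite fctE /= exprfctE.
apply: is_derive_eq D _.
rewrite exprfctE /GRing.scale /=.
have := sin2cos2 x; rewrite !exprS expr0 !mulr1 => s2.
rewrite (_ : sin x * (n.+1%:R * cos x ^+ n * - sin x) = - (n.+1%:R * cos x ^+ n * (sin x * sin x))); last by ring.
rewrite s2; field.
by rewrite -(natrD _ 2) pnatr_eq0.
Qed.

Lemma cos_primitive0 (R : realType) n : cos_primitive n (0 : R) = 0.
Proof.
have [//] : cos_primitive n (0 : R) = 0 /\ cos_primitive n.+1 (0 : R) = 0.
elim: n => [|n [IH1 IH2]]; first by rewrite /= sin0.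
by split => //=; rewrite IH1 sin0 mul0r mulr0 addr0 mulr0.
Qed.

(** The integral of cos ^ n from 0 to pi / 2. *)
Definition wallis (R : realType) n : R := cos_primitive n (pi / 2).

Lemma wallisSS (R : realType) n : wallis R n.+2 = n.+1%:R / n.+2%:R * wallis R n.
Proof. by rewrite /wallis /= cos_pihalf expr0n mulr0 add0r mulrA mulrC; ring. Qed.

(** The difference of the antiderivatives has the derivative
    cos ^ n * (1 - cos), which is non-negative between 0 and pi / 2. *)
Lemma wallis_noninc (R : realType) n : wallis R n.+1 <= wallis R n.
Proof.
rewrite -subr_ge0.
pose f x : R := cos_primitive n x - cos_primitive n.+1 x.
have df x : is_derive x (1:R) f (cos x ^+ n - cos x ^+ n.+1).
  have := is_derive_cos_primitive n x; have := is_derive_cos_primitive n.+1 x.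
  by move=> ? ?; apply: is_deriveB.
have p0 : 0 <= pi / 2 :> R by rewrite divr_ge0// pi_ge0.
have [|c cI] := @MVT_segment R f _ 0 (pi / 2) p0 (fun x _ => df x).
  apply/continuous_subspaceT => x.
  exact/differentiable_continuous/derivable1_diffP.
rewrite /f !cos_primitive0 !subr0 -/(wallis R n) -/(wallis R n.+1) => ->.
apply: mulr_ge0 => //.
have c0 : 0 <= cos c.
  by apply: cos_ge0_pihalf; move: cI; rewrite in_itv /= => /andP[c0 ->]; rewrite andbT; lra.
by rewrite exprS -[X in X - _]mul1r -mulrBl mulr_ge0 ?exprn_ge0// subr_ge0 cos_le1.
Qed.

Definition central_ratio (R : realType) m : R := 'C(m.*2, m)%:R / 4 ^+ m.

Lemma central_ratio_gt0 (R : realType) m : 0 < central_ratio R m.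
Proof. by rewrite divr_gt0 ?exprn_gt0// ltr0n bin_gt0 -addnn leq_addr. Qed.

Lemma central_ratioS (R : realType) m :
  central_ratio R m.+1 = m.*2.+1%:R / m.*2.+2%:R * central_ratio R m.
Proof.
rewrite /central_ratio exprS.
have := congr1 (fun n => n%:R : R) (bin_double_succ m); rewrite !natrM => H.
have -> : 'C(m.+1.*2, m.+1)%:R = 2 * m.*2.+1%:R * 'C(m.*2, m)%:R / m.+1%:R :> R.
  by apply: (canRL (mulfK _)); rewrite ?pnatr_eq0// mulrC.
have -> : m.*2.+2%:R = 2 * m.+1%:R :> R by rewrite -natrM; congr _%:R; lia.
have h : 4 ^+ m != 0 :> R by rewrite expf_neq0.
by field; rewrite h -(natrD _ 1) pnatr_eq0.
Qed.

Lemma wallis_even (R : realType) m : wallis R m.*2 = central_ratio R m * (pi / 2).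
Proof.
elim: m => [|m IH]; first by rewrite /wallis /central_ratio /= bin0 expr0 divr1 mul1r.
by rewrite doubleS wallisSS IH central_ratioS [RHS]mulrAC mulrC [RHS]mulrC; ring.
Qed.

Lemma wallis_odd (R : realType) m :
  wallis R m.*2.+1 = (m.*2.+1%:R * central_ratio R m)^-1.
Proof.
elim: m => [|m IH].
  by rewrite /wallis /central_ratio /= bin0 expr0 divr1 mul1r sin_pihalf invr1.
rewrite doubleS wallisSS IH central_ratioS.
have : central_ratio R m != 0 by rewrite gt_eqF// central_ratio_gt0.
have : m.*2.+1%:R != 0 :> R by rewrite pnatr_eq0.
have : m.*2.+2%:R != 0 :> R by rewrite pnatr_eq0.
have : m.*2.+3%:R != 0 :> R by rewrite pnatr_eq0.
move: (central_ratio R m) (m.*2.+1%:R : R) (m.*2.+2%:R : R) (m.*2.+3%:R : R).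
by move=> b A B C C0 B0 A0 b0; field; rewrite C0 B0 A0 b0.
Qed.

(** The Wallis integrals with even and odd indices are central_ratio m * (pi / 2)
    and 1 / ((2 m + 1) * central_ratio m); their monotonicity sandwiches the
    square of central_ratio m. *)
Lemma central_ratio_bounds (R : realType) m :
  2 / (pi * m.*2.+1%:R) <= central_ratio R m ^+ 2 <=
  2 / (pi * m.*2.+1%:R) * (m.*2.+2%:R / m.*2.+1%:R).
Proof.
have h := central_ratio_gt0 R m; have p0 := pi_gt0 R.
have m0 : 0 < m.*2.+1%:R :> R by rewrite ltr0n.
have m1 : 0 < m.*2.+2%:R :> R by rewrite ltr0n.
have := wallis_noninc R m.*2; have := wallis_noninc R m.*2.+1.
rewrite -doubleS !wallis_even wallis_odd central_ratioS.
set b := central_ratio R m in h *; set A := m.*2.+1%:R in m0 *; set B := m.*2.+2%:R in m1 *.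
clearbody b A B; move: (pi : R) p0 => p p0; have -> : (A * b)^-1 = 1 / (A * b) by rewrite div1r.
rewrite ler_pdivlMr ?ler_pdivrMr ?mulr_gt0// => H1 H2; apply/andP; split.
  by lra.
have -> : 2 / (p * A) * (B / A) = (2 * B) / (p * A * A).
  by field; rewrite (gt_eqF p0) (gt_eqF m0).
rewrite ler_pdivlMr ?mulr_gt0//.
have -> : b ^+ 2 * (p * A * A) = 2 * B * (A / B * b * (p / 2) * (A * b)).
  by field; rewrite (gt_eqF m1).
by rewrite -[leRHS]mulr1; apply: ler_wpM2l => //; rewrite mulr_ge0// ltW.
Qed.

(** For odd N, the central coefficient of N is half that of N + 1. *)
Lemma bin_uphalf (R : realType) N :
  'C(N, uphalf N)%:R / 2 ^+ N = central_ratio R (uphalf N).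
Proof.
have [m [->|->]] : exists m, N = m.*2 \/ N = m.*2.+1.
    by exists N./2; have := odd_double_half N; case: (odd N); [right|left].
  by rewrite uphalf_double /central_ratio -mul2n exprM mul2n -natrX.
rewrite /= doubleK /central_ratio.
have -> : 4 ^+ m.+1 = 2 ^+ m.*2.+1 * 2 :> R.
  by rewrite -exprSr -doubleS -mul2n exprM; congr (_ ^+ _); rewrite -natrX.
have -> : 'C(m.+1.*2, m.+1) = (2 * 'C(m.*2.+1, m.+1))%N.
  rewrite doubleS binS mul2n -[RHS]addnn; congr addn.
  by rewrite -bin_sub; [congr 'C(_, _); lia|lia].
rewrite natrM; field; rewrite expf_neq0//.
Qed.

Lemma cvg_bin_uphalf (R : realType) :
  (Num.sqrt N%:R / 2 * ('C(N, uphalf N)%:R / 2 ^+ N)) @[N --> \oo] -->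
  ((Num.sqrt (2 * pi))^-1 : R).
Proof.
move: (pi_gt0 R) (@central_ratio_bounds R); move: (pi : R) => p p0 bnd.
have H : (N%:R * central_ratio R (uphalf N) ^+ 2) @[N --> \oo] --> 2 / p.
  apply: (@squeeze_cvgr _ _ _ _ (fun N => 2 / p - 4 / p * N.+1%:R^-1) (cst (2 / p))).
  - near=> N; set m := uphalf N.
    have /andP[h1 h2] := bnd m.
    have [N1 N2] : (N <= m.*2)%N /\ (m.*2 <= N.+1)%N by rewrite /m; lia.
    have N1' : N%:R <= m.*2%:R :> R by rewrite ler_nat.
    have N2' : m.*2%:R <= 1 + N%:R :> R by rewrite nat1r ler_nat.
    have N0 : 0 <= N%:R :> R by [].
    apply/andP; split.
      apply: le_trans (_ : N%:R * (2 / (p * m.*2.+1%:R)) <= _); last by rewrite ler_wpM2l.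
      have -> : 2 / p - 4 / p / N.+1%:R = (2 / p) * (1 - 2 / N.+1%:R) by ring.
      have -> : N%:R * (2 / (p * m.*2.+1%:R)) = (2 / p) * (N%:R / m.*2.+1%:R).
        by rewrite invfM; ring.
      rewrite ler_pM2l ?divr_gt0// -[N.+1%:R]nat1r -[m.*2.+1%:R]nat1r.
      have -> : 1 - 2 / (1 + N%:R) = (N%:R - 1) / (1 + N%:R) :> R.
        by field; rewrite nat1r pnatr_eq0.
      rewrite ler_pdivrMr ?ltr_pwDl// mulrAC ler_pdivlMr ?ltr_pwDl//; nra.
    apply: (@le_trans _ _ (N%:R * (2 / (p * m.*2.+1%:R) * (m.*2.+2%:R / m.*2.+1%:R)))).
      by rewrite ler_wpM2l.
    have -> : N%:R * (2 / (p * m.*2.+1%:R) * (m.*2.+2%:R / m.*2.+1%:R)) =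
      (2 / p) * ((N%:R * m.*2.+2%:R) / (m.*2.+1%:R * m.*2.+1%:R)) by rewrite !invfM; ring.
    rewrite /cst /= -[leRHS]mulr1 ler_pM2l ?divr_gt0// ler_pdivrMr ?mulr_gt0// mul1r.
    by rewrite -!natrM ler_nat; nia.
  - rewrite -[X in _ --> X]subr0 -[X in _ - X](mulr0 (4 / p)).
    apply: cvgB; first exact: cvg_cst.
    by apply: cvgMl_tmp; exact: cvg_harmonic.
  - exact: cvg_cst.
have -> : (fun N => Num.sqrt N%:R / 2 * ('C(N, uphalf N)%:R / 2 ^+ N)) =
    (fun N => Num.sqrt (N%:R * central_ratio R (uphalf N) ^+ 2) / 2).
  apply/funext => N; rewrite bin_uphalf sqrtrM// sqrtr_sqr ger0_norm ?ltW ?central_ratio_gt0//.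
  by rewrite mulrAC.
have -> : (Num.sqrt (2 * p))^-1 = Num.sqrt (2 / p) / 2 :> R.
  rewrite -sqrtrV ?mulr_ge0 ?ltW//.
  have -> : 2 / p = (2 * p)^-1 * 2 ^+ 2 by field; rewrite gt_eqF.
  rewrite sqrtrM ?invr_ge0 ?mulr_ge0 ?ltW// sqrtr_sqr ger0_norm// mulfK//.
apply: cvgMr_tmp.
by apply: continuous_cvg; [exact: sqrt_continuous|].
Unshelve. all: by end_near. Qed.

(** * Gaussian bounds on binomial coefficients *)

Lemma bin_step (R : realType) N i : (i < N)%N ->
  'C(N, i.+1)%:R = (N - i)%:R / i.+1%:R * 'C(N, i)%:R :> R.
Proof.
move=> iN; have := congr1 (fun n => n%:R : R) (mul_bin_left N i).
rewrite !natrM => H; rewrite mulrAC; apply: (canRL (mulfK _)).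
  by rewrite pnatr_eq0.
by rewrite mulrC.
Qed.

(** A step from the centre to i multiplies the coefficient by q with q = 1 - a and
    1 / q = 1 + b, and 1 + u <= expR u, applied to - a and to b, bounds q on both
    sides.  The exponents add up to J (J + e) once their denominators are replaced
    by the extreme ones; e is the parity of N. *)
Lemma bin_ratio_bounds (R : realType) N J : (J <= N./2)%N ->
  let c := uphalf N in let e := (c - N./2)%N in
  @expR R (- ((J * (J + e))%:R / (N./2 - J).+1%:R)) * 'C(N, c)%:R <= 'C(N, c + J)%:R
    <= @expR R (- ((J * (J + e))%:R / (c + J)%:R)) * 'C(N, c)%:R.
Proof.
move=> JN; cbv zeta; set c := uphalf N; set e := (c - N./2)%N.
suff H j : (j <= J)%N ->
  @expR R (- ((j * (j + e))%:R / (N./2 - J).+1%:R)) * 'C(N, c)%:R <= 'C(N, c + j)%:R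
    <= @expR R (- ((j * (j + e))%:R / (c + J)%:R)) * 'C(N, c)%:R by exact: H.
elim: j => [|j IH] jJ.
  by rewrite mul0n !mul0r oppr0 expR0 mul1r addn0 lexx.
have /andP[IH1 IH2] := IH (ltnW jJ).
have E : (j.+1 * (j.+1 + e) = j * (j + e) + (j.*2.+1 + e))%N.
  by rewrite -muln2; ring.
have Nc : (N = c + N./2)%N by rewrite /c; lia.
rewrite addnS bin_step; last by lia.
have N1 : (0 < N - (c + j))%N by lia.
set q := (N - (c + j))%:R / _.
have q0 : 0 < q by rewrite divr_gt0// ltr0n.
have Eq : q = 1 - (j.*2.+1 + e)%:R / (c + j).+1%:R.
  rewrite /q -[X in X - _](@divff _ ((c + j).+1%:R)) ?pnatr_eq0// -mulrBl.
  by congr (_ / _); rewrite -natrB; [congr _%:R; lia|lia].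
have Eq' : q^-1 = 1 + (j.*2.+1 + e)%:R / (N - (c + j))%:R.
  rewrite /q invf_div -[X in X + _](@divff _ ((N - (c + j))%:R)) ?pnatr_eq0; last by lia.
  rewrite -mulrDl; congr (_ / _); rewrite -natrD; congr _%:R; lia.
rewrite E natrD !mulrDl !opprD !expRD; apply/andP; split.
  rewrite [leLHS]mulrAC [leLHS]mulrC; apply: ler_pM; rewrite ?mulr_ge0 ?expR_ge0//.
  rewrite expRN -[leRHS]invrK lef_pV2 ?posrE ?expR_gt0 ?invr_gt0// Eq'.
  apply: le_trans (expR_ge1Dx _) _; rewrite ler_expR; apply: ler_wpM2l => //.
  by rewrite lef_pV2 ?posrE ?ltr0n// ler_nat; lia.
rewrite [leRHS]mulrAC [leRHS]mulrC; apply: ler_pM; rewrite ?(ltW q0)//.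
rewrite Eq; apply: le_trans (expR_ge1Dx _) _; rewrite ler_expR lerN2.
by apply: ler_wpM2l => //; rewrite lef_pV2 ?posrE ?ltr0n// ?ler_nat; lia.
Qed.

(** By symmetry v may be taken above the centre; then D = 2 J + e in the notation of
    bin_ratio_bounds, and J (J + e) = (D^2 - e) / 4. *)
Lemma bin_gauss_bounds (R : realType) N v : (v <= N)%N -> (0 < N)%N ->
  let D : R := `|2 * v%:R - N%:R| in
  expR (- (D ^+ 2 / (2 * (N%:R - D) + 4))) * 'C(N, uphalf N)%:R <= 'C(N, v)%:R
    <= expR (- ((D ^+ 2 - 1) / (2 * (N%:R + D)))) * 'C(N, uphalf N)%:R.
Proof.
move=> vN N0; cbv zeta; wlog vc : v vN / (uphalf N <= v)%N.
  move=> H; have [?|vc] := leqP (uphalf N) v; first exact: H.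
  have := H (N - v)%N (leq_subr _ _); rewrite bin_sub// natrB//.
  rewrite (_ : 2 * (N%:R - v%:R) - N%:R = - (2 * v%:R - N%:R)); last by ring.
  by rewrite normrN; apply; lia.
set D : R := `|2 * v%:R - N%:R|; pose J := (v - uphalf N)%N; pose e := (uphalf N - N./2)%N.
have DE : D = (J.*2 + e)%:R.
  rewrite /D -natrM ger0_norm; last by rewrite subr_ge0 ler_nat; lia.
  by rewrite -natrB; [congr _%:R; rewrite /J /e; lia|lia].
have JN : (J <= N./2)%N by rewrite /J; lia.
have /andP[H1 H2] := bin_ratio_bounds R JN; rewrite -/e in H1 H2.
have vE : (uphalf N + J = v)%N by rewrite /J; lia.
rewrite vE in H1 H2.
have e1 : (e <= 1)%N by rewrite /e; lia.
have DJ : (J * (J + e))%:R = (D ^+ 2 - e%:R) / 4 :> R.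
  apply: (canRL (mulfK _)); first by rewrite pnatr_eq0.
  rewrite DE -muln2; case: (e) e1 => [|[|//]] _; rewrite !(natrD, natrM); ring.
have D1 : 2 * (N%:R - D) + 4 = 4 * (N./2 - J).+1%:R.
  have DN : (J.*2 + e <= N)%N by rewrite /J /e; lia.
  by rewrite DE -natrB// -!natrM -natrD; congr _%:R; rewrite /J /e; lia.
have D2 : 2 * (N%:R + D) = 4 * v%:R.
  by rewrite DE -natrD -!natrM; congr _%:R; rewrite /J /e; lia.
have v0 : 0 < v%:R :> R by rewrite ltr0n; lia.
apply/andP; split.
  apply: le_trans H1; apply: ler_wpM2r => //; rewrite ler_expR lerN2 DJ D1 invfM mulrA.
  by apply: ler_wpM2r => //; apply: ler_wpM2r; rewrite ?invr_ge0// gerBl.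
apply: le_trans H2 _; apply: ler_wpM2r => //; rewrite ler_expR lerN2 DJ D2 invfM mulrA.
apply: ler_wpM2r; rewrite ?invr_ge0//; apply: ler_wpM2r; rewrite ?invr_ge0//.
by rewrite lerD2l lerN2 lern1.
Qed.

(** * Limits of the level coefficients *)

Lemma cvg_inv_nat (R : realType) : (N%:R^-1 : R) @[N --> \oo] --> (0 : R).
Proof. by rewrite -(@cvg_shiftS _ (fun N : nat => N%:R^-1 : R)); exact: cvg_harmonic. Qed.

Lemma cvg_inv_sqrt_nat (R : realType) :
  ((Num.sqrt N%:R)^-1 : R) @[N --> \oo] --> (0 : R).
Proof.
have -> : (fun N : nat => (Num.sqrt N%:R)^-1 : R) = (fun N => Num.sqrt N%:R^-1).
  by apply/funext => N; rewrite sqrtrV.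
rewrite -[X in _ --> X]sqrtr0.
by apply: continuous_cvg; [exact: sqrt_continuous|exact: cvg_inv_nat].
Qed.

Lemma near_sqrt_nat_ge (R : realType) (M : R) :
  \forall N \near \oo, M <= Num.sqrt N%:R.
Proof.
near=> N; rewrite (le_trans (ler_norm M))// -sqrtr_sqr ler_sqrt//.
by near: N; exact: nbhs_infty_ger.
Unshelve. all: by end_near. Qed.

Definition centered_level (R : realType) (N v : nat) : R :=
  (2 * v%:R - N%:R) / Num.sqrt N%:R.

Lemma near_level_le (R : realType) (v : nat -> nat) (t : R) :
  centered_level R N (v N) @[N --> \oo] --> t ->
  \forall N \near \oo, (v N <= N)%N.
Proof.
move=> vt; near=> N.
have N0 : (0 < N)%N by near: N; exact: nbhs_infty_gt.
have s0 : 0 < Num.sqrt N%:R :> R by rewrite sqrtr_gt0 ltr0n.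
have x1 : `|centered_level R N (v N)| <= `|t| + 1.
  near: N; apply: cvgr_norm_le vt _ _; by rewrite ltrDl.
have s1 : `|t| + 1 <= Num.sqrt N%:R by near: N; exact: near_sqrt_nat_ge.
have := le_trans x1 s1; rewrite /centered_level normrM (gtr0_norm (_ : 0 < _^-1)) ?invr_gt0//.
rewrite ler_pdivrMr// -expr2 sqr_sqrtr// ler_norml => /andP[_].
by rewrite -(ler_nat R); lra.
Unshelve. all: by end_near. Qed.

Definition gauss_density (R : realType) (t : R) : R :=
  (Num.sqrt (2 * pi))^-1 * expR (- (2^-1 * t ^+ 2)).

(** The two bounds of bin_gauss_bounds, expressed through the centred level and
    (sqrt N)^-1, tend to the same limit. *)
Lemma local_clt (R : realType) (v : nat -> nat) (t : R) :
  centered_level R N (v N) @[N --> \oo] --> t ->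
  Num.sqrt N%:R / 2 * ('C(N, v N)%:R / 2 ^+ N) @[N --> \oo] --> gauss_density t.
Proof.
move=> vt.
pose x N := centered_level R N (v N).
pose s N : R := (Num.sqrt N%:R)^-1.
pose b N : R := Num.sqrt N%:R / 2 * ('C(N, uphalf N)%:R / 2 ^+ N).
pose lo N := expR (- (x N ^+ 2 / (2 * (1 - `|x N| * s N) + 4 * s N ^+ 2))).
pose hi N := expR (- ((x N ^+ 2 - s N ^+ 2) / (2 * (1 + `|x N| * s N)))).
have s0 : s N @[N --> \oo] --> (0 : R) by exact: cvg_inv_sqrt_nat.
have ex : x N ^+ 2 @[N --> \oo] --> t ^+ 2 by under eq_cvg do rewrite expr2; exact: cvgM.
have es : s N ^+ 2 @[N --> \oo] --> (0 : R).
  by rewrite -[X in _ --> X](mulr0 0); under eq_cvg do rewrite expr2; exact: cvgM.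
have xs : `|x N| * s N @[N --> \oo] --> (0 : R).
  by rewrite -[X in _ --> X](mulr0 `|t|); apply: cvgM => //; exact: cvg_norm.
have cexp (f : nat -> R) (l : R) : f N @[N --> \oo] --> l -> expR (- f N) @[N --> \oo] --> expR (- l).
  move=> fl; apply: continuous_cvg; first exact: continuous_expR.
  exact: cvgN.
have lo_cvg : lo N @[N --> \oo] --> expR (- (2^-1 * t ^+ 2)).
  apply: cexp; rewrite mulrC; apply: cvgM => //; apply: cvgV => //.
  rewrite [X in _ --> X](_ : _ = 2 * (1 - 0) + 4 * 0); last by ring.
  by apply: cvgD; apply: cvgM; try exact: cvg_cst; try exact: es; apply: cvgB => //; exact: cvg_cst.
have hi_cvg : hi N @[N --> \oo] --> expR (- (2^-1 * t ^+ 2)).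
  apply: cexp; rewrite mulrC; apply: cvgM.
    by rewrite -[X in _ --> X]subr0; apply: cvgB.
  apply: cvgV => //.
  rewrite [X in _ --> X](_ : _ = 2 * (1 + 0)); last by ring.
  by apply: cvgM; first exact: cvg_cst; apply: cvgD => //; exact: cvg_cst.
have b_cvg := @cvg_bin_uphalf R.
apply: (@squeeze_cvgr _ _ _ _ (fun N => b N * lo N) (fun N => b N * hi N)); last 2 first.
- exact: cvgM b_cvg lo_cvg.
- exact: cvgM b_cvg hi_cvg.
near=> N.
have vN : (v N <= N)%N by near: N; exact: near_level_le vt.
have N0 : (0 < N)%N by near: N; exact: nbhs_infty_gt.
have r0 : 0 < Num.sqrt N%:R :> R by rewrite sqrtr_gt0 ltr0n.
have /andP[] := bin_gauss_bounds R vN N0.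
set D := `|_|.
have NE : N%:R = Num.sqrt N%:R ^+ 2 :> R by rewrite sqr_sqrtr.
have DE : D = `|x N| * Num.sqrt N%:R.
  by rewrite /x /centered_level normrM normfV (gtr0_norm r0) divfK// gt_eqF.
have sE : Num.sqrt N%:R = (s N)^-1 by rewrite /s invrK.
have sN0 : s N != 0 by rewrite invr_neq0// gt_eqF.
rewrite sE in NE DE.
have cancel (a d c : R) : d != 0 -> (a / d) / (c / d) = a / c.
  by move=> b0; rewrite invf_div mulrA divfK.
have D2 : D ^+ 2 = x N ^+ 2 / s N ^+ 2.
  by rewrite DE exprMn real_normK ?num_real// exprVn.
have -> : D ^+ 2 / (2 * (N%:R - D) + 4) = x N ^+ 2 / (2 * (1 - `|x N| * s N) + 4 * s N ^+ 2).
  rewrite D2 DE NE (_ : 2 * _ + 4 = (2 * (1 - `|x N| * s N) + 4 * s N ^+ 2) / s N ^+ 2).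
    by rewrite cancel// expf_neq0.
  by field.
have -> : (D ^+ 2 - 1) / (2 * (N%:R + D)) = (x N ^+ 2 - s N ^+ 2) / (2 * (1 + `|x N| * s N)).
  rewrite D2 DE NE (_ : 2 * (_ + `|x N| / s N) = (2 * (1 + `|x N| * s N)) / s N ^+ 2); last by field.
  rewrite (_ : x N ^+ 2 / s N ^+ 2 - 1 = (x N ^+ 2 - s N ^+ 2) / s N ^+ 2); last by field.
  by rewrite cancel// expf_neq0.
rewrite -/(lo N) -/(hi N) => h1 h2.
have c0 : 0 <= Num.sqrt N%:R / 2 / 2 ^+ N :> R by rewrite !divr_ge0 ?exprn_ge0// ltW.
have rw (c y : R) : Num.sqrt N%:R / 2 * (c / 2 ^+ N) * y = Num.sqrt N%:R / 2 / 2 ^+ N * (y * c) by ring.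
by rewrite /b !rw -[X in _ <= X <= _]mulr1 rw mul1r !ler_wpM2l.
Unshelve. all: by end_near. Qed.

Lemma cvg_bin_over_pow (R : realType) k :
  'C(N, k)%:R / N%:R ^+ k @[N --> \oo] --> (k`!%:R^-1 : R).
Proof.
elim: k => [|k IH].
  under eq_cvg do rewrite bin0 expr0 divr1.
  by rewrite fact0 invr1; exact: cvg_cst.
have E : ('C(N, k)%:R / N%:R ^+ k) * ((1 - k%:R * N%:R^-1) / k.+1%:R) @[N --> \oo] -->
    ((k.+1)`!%:R^-1 : R).
  rewrite factS natrM invfM mulrC.
  rewrite [X in _ --> X](_ : _ = k`!%:R^-1 * ((1 - k%:R * 0) / k.+1%:R)); last first.
    by rewrite mulr0 subr0 mul1r.
  apply: cvgM => //; apply: cvgM; last exact: cvg_cst.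
  by apply: cvgB; [exact: cvg_cst|apply: cvgM; [exact: cvg_cst|exact: cvg_inv_nat]].
apply: cvg_trans E; apply: near_eq_cvg; near=> N.
have kN : (k < N)%N by near: N; exact: nbhs_infty_gt.
rewrite bin_step// natrB ?(ltnW kN)// exprS.
have N0 : N%:R != 0 :> R by rewrite pnatr_eq0; lia.
field; rewrite N0 expf_neq0//= nat1r pnatr_eq0//.
Unshelve. all: by end_near. Qed.

(** Divided by sqrt N ^ k, the recurrence kraw_coefSS tends to hermiteSS, up to the
    sign: at phi = w / sqrt N the generating function
    (1 - phi)^v (1 + phi)^(N - v) is close to expR (- t w - w^2 / 2). *)
Lemma cvg_kraw_coef (R : realType) (v : nat -> nat) (t : R) k :
  centered_level R N (v N) @[N --> \oo] --> t ->
  kraw_coef R N k (v N) * (Num.sqrt N%:R)^-1 ^+ k @[N --> \oo] -->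
  (-1) ^+ k * hermite k t / k`!%:R.
Proof.
move=> vt.
pose s N : R := (Num.sqrt N%:R)^-1.
pose u k N := kraw_coef R N k (v N) * s N ^+ k.
pose l k := (-1) ^+ k * hermite k t / k`!%:R.
suff [//] : u k N @[N --> \oo] --> l k /\ u k.+1 N @[N --> \oo] --> l k.+1.
elim: k => [|k [IH1 IH2]].
  split.
    rewrite /l hermite0 fact0 expr0 divr1 mulr1.
    under eq_cvg do rewrite /u kraw_coef0 expr0 mulr1.
    exact: cvg_cst.
  rewrite /l hermite1 expr1 divr1 mulN1r.
  apply: cvg_trans (cvgN vt); apply: near_eq_cvg; near=> N.
  have vN : (v N <= N)%N by near: N; exact: near_level_le vt.
  by rewrite /u kraw_coef1// expr1 fctE /centered_level -mulNr opprB.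
split => //.
have E : ((- centered_level R N (v N)) * u k.+1 N - (1 - k%:R / N%:R) * u k N) / k.+2%:R
    @[N --> \oo] --> l k.+2.
  have -> : l k.+2 = (- t * l k.+1 - (1 - k%:R * 0) * l k) / k.+2%:R.
    rewrite /l hermiteSS !factS !natrM !exprS.
    have k0 : k`!%:R != 0 :> R by rewrite pnatr_eq0 -lt0n fact_gt0.
    by field; rewrite k0 nat1r -(natrD _ 2) !pnatr_eq0.
  apply: cvgM; last exact: cvg_cst.
  apply: cvgB; first by apply: cvgM => //; exact: cvgN.
  apply: cvgM => //; apply: cvgB; first exact: cvg_cst.
  by apply: cvgM; [exact: cvg_cst|exact: cvg_inv_nat].
apply: cvg_trans E; apply: near_eq_cvg; near=> N.
have vN : (v N <= N)%N by near: N; exact: near_level_le vt.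
have N0 : (0 < N)%N by near: N; exact: nbhs_infty_gt.
have r0 : Num.sqrt N%:R != 0 :> R by rewrite gt_eqF// sqrtr_gt0 ltr0n.
have NE : N%:R = Num.sqrt N%:R ^+ 2 :> R by rewrite sqr_sqrtr.
rewrite /u /centered_level.
have -> : kraw_coef R N k.+2 (v N) = ((N%:R - 2 * (v N)%:R) * kraw_coef R N k.+1 (v N)
    - (N%:R - k%:R) * kraw_coef R N k (v N)) / k.+2%:R.
  by apply: (canRL (mulfK _)); rewrite ?pnatr_eq0// mulrC kraw_coefSS.
rewrite mulrAC; congr (_ / _); rewrite !exprS -/(s N).
have s2 : N%:R * s N ^+ 2 = 1.
  by rewrite /s exprVn -NE divff// pnatr_eq0 -lt0n.
have NV : N%:R^-1 = s N ^+ 2 by rewrite /s exprVn -NE.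
rewrite NV [in RHS]mulrBl; congr (_ - _); first by rewrite /s; ring.
transitivity ((N%:R * s N ^+ 2 - k%:R * s N ^+ 2) * (kraw_coef R N k (v N) * s N ^+ k)).
  by rewrite s2.
by ring.
Unshelve. all: by end_near. Qed.

(** The coefficient of zeta_k in the scaled sum over level v, apart from the
    moment of order k. *)
Definition level_coef (R : realType) (N v k : nat) : R :=
  Num.sqrt N%:R / 2 * ('C(N, v)%:R / 2 ^+ N) * (Num.sqrt 'C(N, k)%:R * krawtchouk R N k v).

(** The coefficient of zeta_k in kappa_t, apart from the moment of order k. *)
Definition hermite_coef (R : realType) (t : R) (k : nat) : R :=
  gauss_density t * ((Num.sqrt k`!%:R)^-1 * hermite k t).

Lemma cvg_level_coef (R : realType) (v : nat -> nat) (t : R) k :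
  centered_level R N (v N) @[N --> \oo] --> t ->
  level_coef R N (v N) k @[N --> \oo] --> (-1) ^+ k * hermite_coef t k.
Proof.
move=> vt; rewrite /hermite_coef mulrCA; apply: cvgM; first exact: local_clt.
pose s N : R := (Num.sqrt N%:R)^-1.
have f0 : 0 < k`!%:R :> R by rewrite ltr0n fact_gt0.
have sqrtX (a : R) n : 0 <= a -> Num.sqrt (a ^+ n) = Num.sqrt a ^+ n.
  by move=> a0; elim: n => [|n IH]; rewrite ?sqrtr1// !exprS sqrtrM// IH.
have E : (kraw_coef R N k (v N) * s N ^+ k) / Num.sqrt ('C(N, k)%:R / N%:R ^+ k) @[N --> \oo] -->
   (-1) ^+ k * hermite k t / k`!%:R / Num.sqrt (k`!%:R^-1).
  apply: cvgM; first exact: cvg_kraw_coef.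
  apply: cvgV; first by rewrite gt_eqF// sqrtr_gt0 invr_gt0.
  by apply: continuous_cvg; [exact: sqrt_continuous|exact: cvg_bin_over_pow].
have -> : (-1) ^+ k * ((Num.sqrt k`!%:R)^-1 * hermite k t) =
    (-1) ^+ k * hermite k t / k`!%:R / Num.sqrt (k`!%:R^-1).
  rewrite sqrtrV ?ltW// invrK; set q := Num.sqrt _.
  have -> : k`!%:R = q ^+ 2 by rewrite sqr_sqrtr// ltW.
  by field; rewrite gt_eqF// sqrtr_gt0.
apply: cvg_trans E; apply: near_eq_cvg; near=> N.
have kN : (k < N)%N by near: N; exact: nbhs_infty_gt.
have N0 : 0 < N%:R :> R by rewrite ltr0n; lia.
have C0 : 0 < 'C(N, k)%:R :> R by rewrite ltr0n bin_gt0 ltnW.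
have r0 : 0 < Num.sqrt N%:R :> R by rewrite sqrtr_gt0.
rewrite sqrtrM ?ltW// sqrtrV ?exprn_ge0 ?ltW//.
rewrite sqrtX ?ltW//.
rewrite /krawtchouk -/(kraw_coef R N k (v N)) /s.
set q := Num.sqrt 'C(N, k)%:R; have q0 : 0 < q by rewrite sqrtr_gt0.
have -> : 'C(N, k)%:R = q ^+ 2 by rewrite sqr_sqrtr// ltW.
by rewrite exprVn; field; rewrite !expf_neq0 ?gt_eqF.
Unshelve. all: by end_near. Qed.

(** By duality, 'C(N, v) times the Krawtchouk polynomial of degree k at v is the
    coefficient kraw_coef R N v k that occurs in kraw_noise_bound.  It is
    essential that the bound depends neither on N nor on v. *)
Lemma level_coef_bound (R : realType) (N v : nat) (r : R) :
  0 <= r -> r < 1 -> (v <= N)%N ->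
  \sum_(k < N.+1) r ^+ k * level_coef R N v k ^+ 2 <= (2 * Num.sqrt (1 - r ^+ 2))^-1.
Proof.
move=> r0 r1 vN.
have s0 : 0 < Num.sqrt (1 - r ^+ 2) by rewrite sqrtr_gt0 subr_gt0 exprn_ilt1.
case: N vN => [|N] vN.
  rewrite big_ord1 /level_coef sqrtr0 !mul0r expr0n /= mulr0.
  by rewrite invr_ge0 mulr_ge0// ltW.
have H := kraw_noise_bound v r0 r1 (ltn0Sn N).
have N0 : 0 < N.+1%:R :> R by rewrite ltr0n.
have p4 : 0 < 4 ^+ N.+1 :> R by rewrite exprn_gt0.
rewrite (_ : \sum_(k < N.+2) _ = N.+1%:R / 4 / 4 ^+ N.+1 *
    \sum_(k < N.+2) r ^+ k * 'C(N.+1, k)%:R * kraw_coef R N.+1 v k ^+ 2).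
  apply: le_trans (ler_wpM2l _ H) _; first by rewrite !divr_ge0// ltW.
  by rewrite le_eqVlt; apply/orP; left; apply/eqP; field; rewrite !gt_eqF.
rewrite mulr_sumr; apply: eq_bigr => k _.
have kN : (k <= N.+1)%N by rewrite -ltnS.
have C0 : 'C(N.+1, k)%:R != 0 :> R by rewrite pnatr_eq0 -lt0n bin_gt0.
have D := kraw_coef_duality R kN vN.
have -> : kraw_coef R N.+1 v k = 'C(N.+1, v)%:R * krawtchouk R N.+1 k v.
  rewrite /krawtchouk -/(kraw_coef R N.+1 k v) mulrA D mulrAC mulfV ?mul1r//.
have E4 : 4 ^+ N.+1 = (2 ^+ N.+1) ^+ 2 :> R.
  by rewrite exprAC; congr (_ ^+ _); rewrite -natrX.
rewrite E4 /level_coef !exprMn !exprVn !sqr_sqrtr//.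
have p2 : (2 ^+ N.+1 : R) != 0 by rewrite expf_neq0.
move: (2 ^+ N.+1 : R) p2 => p p0; field.
by rewrite C0 p0.
Qed.

Definition level_index (R : realType) (t : R) (N : nat) : nat :=
  Num.truncn (N%:R / 2 + Num.sqrt N%:R / 2 * t).

Lemma cvg_level_index (R : realType) (t : R) :
  centered_level R N (level_index t N) @[N --> \oo] --> t.
Proof.
apply/cvgrPdist_le => e e0; near=> N.
have N0 : (0 < N)%N by near: N; exact: nbhs_infty_gt.
have r0 : 0 < Num.sqrt N%:R :> R by rewrite sqrtr_gt0 ltr0n.
have r1 : `|t| <= Num.sqrt N%:R by near: N; exact: near_sqrt_nat_ge.
have r2 : 2 / e <= Num.sqrt N%:R by near: N; exact: near_sqrt_nat_ge.
rewrite /centered_level /level_index.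
set r := Num.sqrt N%:R in r0 r1 r2 *.
have NE : N%:R = r ^+ 2 :> R by rewrite sqr_sqrtr.
set y := _ + _ * t; have y0 : 0 <= y.
  by move: r1; rewrite ler_norml => /andP[h _]; rewrite /y NE; nra.
have /andP[h1 h2] := truncn_itv y0.
move: h1 h2; set v := Num.truncn y; rewrite -natr1 => h1 h2.
have -> : t - (2 * v%:R - N%:R) / r = 2 * (y - v%:R) / r.
  by rewrite /y NE; field; rewrite gt_eqF.
rewrite normrM normfV (gtr0_norm r0) ler_pdivrMr// ger0_norm; last by lra.
by move: r2; rewrite ler_pdivrMr//; lra.
Unshelve. all: by end_near. Qed.

(** The inequality level_coef_bound passes to the limit term by term. *)
Lemma hermite_coef_bound (R : realType) (t r : R) n :
  0 <= r -> r < 1 ->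
  \sum_(k < n) r ^+ k * hermite_coef t k ^+ 2 <= (2 * Num.sqrt (1 - r ^+ 2))^-1.
Proof.
move=> r0 r1; set v := level_index t.
have vt : centered_level R N (v N) @[N --> \oo] --> t by exact: cvg_level_index.
have C : \sum_(k < n) r ^+ k * level_coef R N (v N) k ^+ 2 @[N --> \oo] -->
    \sum_(k < n) r ^+ k * hermite_coef t k ^+ 2.
  elim: n => [|n IH].
    by under eq_cvg do rewrite big_ord0; rewrite big_ord0; exact: cvg_cst.
  rewrite big_ord_recr /=; under eq_cvg do rewrite big_ord_recr /=.
  apply: cvgD => //; apply: cvgM; first exact: cvg_cst.
  have -> : hermite_coef t n ^+ 2 = ((-1) ^+ n * hermite_coef t n) ^+ 2.
    by rewrite [RHS]exprMn sqrr_sign mul1r.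
  by rewrite expr2; under eq_cvg do rewrite expr2; apply: cvgM; exact: cvg_level_coef.
apply: (cvgr_to_le C).
near=> N.
have vN : (v N <= N)%N by near: N; exact: near_level_le vt.
have nN : (n <= N.+1)%N by near: N; exists n => // m /= /leqW.
apply: le_trans (level_coef_bound r0 r1 vN).
rewrite -(big_mkord xpredT (fun k => r ^+ k * level_coef R N (v N) k ^+ 2)).
rewrite -(big_mkord xpredT (fun k => r ^+ k * level_coef R N (v N) k ^+ 2)).
rewrite [leRHS](big_cat_nat (leq0n n) nN)/= lerDl; apply: sumr_ge0 => k _.
by apply: mulr_ge0; [exact: exprn_ge0|exact: sqr_ge0].
Unshelve. all: by end_near. Qed.

(** * Mehler's formula *)

(** Absolute convergence of the power series of c on the open unit disc. *)
Definition disc_summable (R : realType) (c : nat -> R) : Prop :=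
  forall K : R, 0 <= K -> K < 1 ->
    exists M, forall n, \sum_(0 <= k < n) `|c k| * K ^+ k <= M.

Lemma disc_summable_cvg (R : realType) (c : nat -> R) (r : R) :
  disc_summable c -> `|r| < 1 -> cvgn (pseries c r).
Proof.
move=> cs r1; apply: normed_cvg; apply: nondecreasing_is_cvgn.
  by apply/nondecreasing_seqP => n; rewrite /= /series /= big_nat_recr//= lerDl.
have [M HM] := cs `|r| (normr_ge0 r) r1.
exists M => _ [n _ <-]; apply: le_trans (HM n).
by rewrite /= /series /=; apply: ler_sum => k _; rewrite normrM normrX.
Qed.

(** Enlarging the radius K to K' costs the factor (K / K')^k, against which k + 1
    is bounded. *)
Lemma disc_summable_diffs (R : realType) (c : nat -> R) :
  disc_summable c -> disc_summable (pseries_diffs c).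
Proof.
move=> cs K K0 K1.
pose K' := (K + 1) / 2; pose q := K / K'.
have K'0 : 0 < K' by rewrite /K'; lra.
have K'1 : K' < 1 by rewrite /K'; lra.
have q0 : 0 <= q by rewrite divr_ge0// ltW.
have q1 : q < 1 by rewrite /q ltr_pdivrMr// /K'; lra.
have [M HM] := cs K' (ltW K'0) K'1.
have Mge0 : 0 <= M by have := HM 0%N; rewrite big_nil.
exists ((1 - q)^-1 * (M / K')) => n.
have kq k : k.+1%:R * q ^+ k <= (1 - q)^-1.
  apply: (@le_trans _ _ (\sum_(i < k.+1) q ^+ i)).
    rewrite -[k.+1 in leLHS]card_ord -sumr_const mulr_suml; apply: ler_sum => i _.
    by rewrite mul1r; apply: ler_wiXn2l => //; [exact: ltW|rewrite -ltnS].
  have q1' : 0 < 1 - q by rewrite subr_gt0.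
  rewrite -(ler_pM2l q1') mulfV ?gt_eqF//.
  by rewrite -opprB mulNr -subrX1 opprB gerBl exprn_ge0.
apply: (@le_trans _ _ (\sum_(0 <= k < n) (1 - q)^-1 / K' * (`|c k.+1| * K' ^+ k.+1))).
  apply: ler_sum => k _.
  rewrite /pseries_diffs normrM ger0_norm//.
  have -> : K = q * K' by rewrite /q divfK// gt_eqF.
  rewrite exprMn (_ : _ * _ * _ = (k.+1%:R * q ^+ k) * (`|c k.+1| * K' ^+ k)); last by ring.
  have -> : (1 - q)^-1 / K' * (`|c k.+1| * K' ^+ k.+1) = (1 - q)^-1 * (`|c k.+1| * K' ^+ k).
    by rewrite exprS; field; rewrite subr_eq0 !gt_eqF.
  by apply: ler_wpM2r => //; rewrite mulr_ge0// exprn_ge0// ltW.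
rewrite -mulr_sumr [M / K']mulrC mulrA; apply: ler_wpM2l.
  by rewrite divr_ge0// ?invr_ge0 ?subr_ge0 ltW.
apply: le_trans (HM n.+1); rewrite big_nat_recl// lerDr.
by rewrite mulr_ge0// exprn_ge0// ltW.
Qed.

Lemma disc_summable_derive (R : realType) (c : nat -> R) (r : R) :
  disc_summable c -> `|r| < 1 ->
  is_derive r (1 : R) (fun x => limn (pseries c x)) (limn (pseries (pseries_diffs c) r)).
Proof.
move=> cs r1; have K1 : `|(`|r| + 1) / 2| < 1 by rewrite ger0_norm; have := normr_ge0 r; lra.
apply: (@pseries_snd_diffs _ _ ((`|r| + 1) / 2)).
- exact: disc_summable_cvg.
- by apply: disc_summable_cvg => //; exact: disc_summable_diffs.
- by apply: disc_summable_cvg => //; do 2 apply: disc_summable_diffs.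
- by rewrite [ltRHS]ger0_norm; have := normr_ge0 r; lra.
Qed.

(** Multiplication of a power series by its variable. *)
Definition shift_coef (R : realType) (f : nat -> R) (k : nat) : R :=
  if k is k'.+1 then f k' else 0.

Lemma cvg_pseries_shift (R : realType) (f : nat -> R) (r l : R) :
  pseries f r @ \oo --> l -> pseries (shift_coef f) r @ \oo --> r * l.
Proof.
move=> fl; rewrite -cvg_shiftS /=.
have -> : (fun n => pseries (shift_coef f) r n.+1) = (fun n => r * pseries f r n).
  apply/funext => n; rewrite /pseries /series /= big_nat_recl// mul0r add0r mulr_sumr.
  by apply: eq_bigr => i _; rewrite exprS mulrCA.
by apply: cvgM => //; exact: cvg_cst.
Qed.

Definition mehler_coef (R : realType) (t s : R) (k : nat) : R :=
  hermite_coef t k * hermite_coef s k.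

Lemma mehler_coefE (R : realType) (t s : R) k :
  mehler_coef t s k =
  gauss_density t * gauss_density s * (hermite k t * hermite k s / k`!%:R).
Proof.
rewrite /mehler_coef /hermite_coef.
have f0 : 0 < k`!%:R :> R by rewrite ltr0n fact_gt0.
have -> : k`!%:R^-1 = (Num.sqrt k`!%:R)^-1 ^+ 2 :> R by rewrite exprVn sqr_sqrtr// ltW.
by ring.
Qed.

(** From 2 |a b| <= a^2 + b^2 and hermite_coef_bound. *)
Lemma mehler_coef_bound (R : realType) (t s K : R) n : 0 <= K -> K < 1 ->
  \sum_(0 <= k < n) `|mehler_coef t s k| * K ^+ k <= (2 * Num.sqrt (1 - K ^+ 2))^-1.
Proof.
move=> K0 K1.
have := lerD (hermite_coef_bound t n K0 K1) (hermite_coef_bound s n K0 K1).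
rewrite -big_split /= => H.
rewrite -(@ler_pM2l _ 2)// [leRHS]mulrDl mul1r; apply: le_trans H.
rewrite big_mkord mulr_sumr; apply: ler_sum => k _.
rewrite -mulrDr mulrA mulrC; apply: ler_wpM2l; first exact: exprn_ge0.
rewrite /mehler_coef normrM -(real_normK (num_real (hermite_coef t k))).
rewrite -(real_normK (num_real (hermite_coef s k))).
by have := sqr_ge0 (`|hermite_coef t k| - `|hermite_coef s k|); nra.
Qed.

Lemma mehler_disc_summable (R : realType) (t s : R) : disc_summable (mehler_coef t s).
Proof.
move=> K K0 K1; exists ((2 * Num.sqrt (1 - K ^+ 2))^-1) => n.
exact: mehler_coef_bound.
Qed.

(** This is the differential equation of mehler_ode read on the coefficients of
    r^k; it follows from the recurrence hermiteSS at t and at s. *)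
Lemma mehler_recurrence (R : realType) (t s : R) k :
  let c := mehler_coef t s in let d := pseries_diffs c in
  d k - 2 * shift_coef (shift_coef d) k
    + shift_coef (shift_coef (shift_coef (shift_coef d))) k =
  t * s * c k + (1 - t ^+ 2 - s ^+ 2) * shift_coef c k
    + t * s * shift_coef (shift_coef c) k - shift_coef (shift_coef (shift_coef c)) k.
Proof.
rewrite /=; case: k => [|[|[|[|k]]]]; rewrite /= /pseries_diffs !mehler_coefE.
- by rewrite !(hermite0, hermite1); field.
- by rewrite !(hermiteSS, hermite0, hermite1) ?factS ?fact0 ?natrM; field.
- by rewrite !(hermiteSS, hermite0, hermite1) ?factS ?fact0 ?natrM; field.
- by rewrite !(hermiteSS, hermite0, hermite1) ?factS ?fact0 ?natrM; field.
rewrite !hermiteSS; set x := hermite k t; set x' := hermite k.+1 t.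
set y := hermite k s; set y' := hermite k.+1 s.
rewrite !factS !natrM.
have f0 : k`!%:R != 0 :> R by rewrite pnatr_eq0 -lt0n fact_gt0.
move: (k`!%:R : R) f0 => f f0.
field.
by rewrite f0 nat1r -!(natrD _ _ k) !pnatr_eq0.
Qed.

Lemma mehler_ode (R : realType) (t s r : R) : `|r| < 1 ->
  let F x := limn (pseries (mehler_coef t s) x) in
  is_derive r (1 : R) F
    ((r * (1 - r ^+ 2) + t * s * (1 + r ^+ 2) - r * (t ^+ 2 + s ^+ 2))
      / (1 - r ^+ 2) ^+ 2 * F r).
Proof.
move=> r1 F; set c := mehler_coef t s.
have cs : disc_summable c by exact: mehler_disc_summable.
apply: is_derive_eq (disc_summable_derive cs r1) _.
set d := pseries_diffs c.
have Fc : pseries c r @ \oo --> F r by exact: disc_summable_cvg.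
have Dc : pseries d r @ \oo --> limn (pseries d r).
  by apply: disc_summable_cvg => //; exact: disc_summable_diffs.
set D := limn _ in Dc *.
have H1 : pseries d r n - 2 * pseries (shift_coef (shift_coef d)) r n
    + pseries (shift_coef (shift_coef (shift_coef (shift_coef d)))) r n @[n --> \oo] -->
    D - 2 * (r * (r * D)) + r * (r * (r * (r * D))).
  apply: cvgD; last by do 4 apply: cvg_pseries_shift.
  apply: cvgB => //; apply: cvgM; first exact: cvg_cst.
  by do 2 apply: cvg_pseries_shift.
have H2 : t * s * pseries c r n + (1 - t ^+ 2 - s ^+ 2) * pseries (shift_coef c) r n
    + t * s * pseries (shift_coef (shift_coef c)) r n
    - pseries (shift_coef (shift_coef (shift_coef c))) r n @[n --> \oo] -->
    t * s * F r + (1 - t ^+ 2 - s ^+ 2) * (r * F r) + t * s * (r * (r * F r))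
    - r * (r * (r * F r)).
  apply: cvgB; last by do 3 apply: cvg_pseries_shift.
  apply: cvgD; last by apply: cvgM; [exact: cvg_cst|do 2 apply: cvg_pseries_shift].
  apply: cvgD; apply: cvgM; try exact: cvg_cst; first by [].
  exact: cvg_pseries_shift.
have E : (fun n => pseries d r n - 2 * pseries (shift_coef (shift_coef d)) r n
    + pseries (shift_coef (shift_coef (shift_coef (shift_coef d)))) r n) =
    (fun n => t * s * pseries c r n + (1 - t ^+ 2 - s ^+ 2) * pseries (shift_coef c) r n
    + t * s * pseries (shift_coef (shift_coef c)) r n
    - pseries (shift_coef (shift_coef (shift_coef c))) r n).
  apply/funext => n; rewrite /pseries /series /= !mulr_sumr -!sumrB -!big_split /= -sumrB.
  apply: eq_bigr => k _; have := mehler_recurrence t s k; rewrite /= -/c -/d => Hk.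
  have := congr1 (fun z => z * r ^+ k) Hk.
  by move=> H; apply: etrans (etrans _ H) _; ring.
rewrite E in H1.
have h1 := cvg_lim (@Rhausdorff R) H1; have h2 := cvg_lim (@Rhausdorff R) H2.
have := etrans (esym (h1 _)) (h2 _).
have r2 : 1 - r ^+ 2 != 0.
  by rewrite gt_eqF// subr_gt0 -real_normK ?num_real// exprn_ilt1.
move=> H; rewrite mulrAC; apply: (canRL (mulfK _)); first by rewrite expf_neq0.
rewrite [LHS](_ : _ = D - 2 * (r * (r * D)) + r * (r * (r * (r * D)))); last by ring.
by rewrite H; ring.
Qed.

Lemma binormal_pdfE (R : realType) (t s r : R) : `|r| < 1 ->
  binormal_pdf t s r = gauss_density t * gauss_density s /
   (Num.sqrt (1 - r ^+ 2) *
    expR ((r ^+ 2 * (t ^+ 2 + s ^+ 2) - 2 * r * t * s) / (2 * (1 - r ^+ 2)))).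
Proof.
move=> r1; have r2 : 1 - r ^+ 2 != 0.
  by rewrite gt_eqF// subr_gt0 -real_normK ?num_real// exprn_ilt1.
have p0 : 0 < 2 * pi :> R by rewrite mulr_gt0// pi_gt0.
have r0 : 0 < Num.sqrt (1 - r ^+ 2).
  by rewrite sqrtr_gt0 subr_gt0 -real_normK ?num_real// exprn_ilt1.
rewrite /binormal_pdf /gauss_density; set X := (_ ^+ 2 * _ - _) / (2 * (1 - r ^+ 2)).
rewrite (_ : expR (- _) = expR (- (2^-1 * t ^+ 2)) * expR (- (2^-1 * s ^+ 2)) * (expR X)^-1).
  rewrite -{1}(sqr_sqrtr (ltW p0)); have A0 : 0 < Num.sqrt (2 * pi) :> R by rewrite sqrtr_gt0.
  move: (Num.sqrt (2 * pi)) (Num.sqrt (1 - r ^+ 2)) (expR X) A0 r0 (expR_gt0 X).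
  by move=> A q x A0 q0 x0; field; rewrite !gt_eqF.
by rewrite -expRN -!expRD; congr expR; rewrite /X; field; rewrite r2.
Qed.

(** The function E is, up to a constant, the inverse of the closed form, and
    solves the equation of mehler_ode with the opposite sign.  Hence F * E has
    derivative zero on ]-1, 1[, and keeps the value that it has at 0. *)
Lemma mehler_formula (R : realType) (t s r : R) : `|r| < 1 ->
  pseries (mehler_coef t s) r @ \oo --> binormal_pdf t s r.
Proof.
move=> r1.
pose F (x : R) := limn (pseries (mehler_coef t s) x).
pose E (x : R) := Num.sqrt (1 - x ^+ 2) *
    expR ((x ^+ 2 * (t ^+ 2 + s ^+ 2) - 2 * x * t * s) / (2 * (1 - x ^+ 2))).
have c0 (x : R) : `|x| < 1 -> 0 < 1 - x ^+ 2.
  by move=> x1; rewrite subr_gt0 -real_normK ?num_real// exprn_ilt1.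
have dE (x : R) : `|x| < 1 -> is_derive x (1 : R) E
   (- ((x * (1 - x ^+ 2) + t * s * (1 + x ^+ 2) - x * (t ^+ 2 + s ^+ 2))
      / (1 - x ^+ 2) ^+ 2) * E x).
  move=> x1; have x2 := c0 x x1.
  have x2' : 1 - x ^+ 2 != 0 by rewrite gt_eqF.
  have x3 : 2 * (1 - x ^+ 2) != 0 by rewrite mulf_neq0.
  have d1 : is_derive x (1 : R) (fun x : R => 1 - x ^+ 2) (- (2 * x)).
    by apply: trigger_derive; rewrite /GRing.scale /=; ring.
  have d2 : is_derive x (1 : R) (fun x => Num.sqrt (1 - x ^+ 2))
     ((2 * Num.sqrt (1 - x ^+ 2))^-1 * (- (2 * x))).
    by apply: (@is_derive1_comp _ Num.sqrt (fun x => 1 - x ^+ 2)); exact: is_derive1_sqrt.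
  have d3 : is_derive x (1 : R) (fun x => x ^+ 2 * (t ^+ 2 + s ^+ 2) - 2 * x * t * s)
     (2 * x * (t ^+ 2 + s ^+ 2) - 2 * t * s).
    by apply: trigger_derive; rewrite /GRing.scale /=; ring.
  have d4 : is_derive x (1 : R) (fun x => (2 * (1 - x ^+ 2))^-1)
     (- (2 * (1 - x ^+ 2)) ^- 2 * (2 * - (2 * x))).
    by apply: is_deriveV => //; apply: is_deriveZ.
  have d5 := is_deriveM d3 d4.
  have d6 := @is_derive1_comp _ expR _ _ _ _ (is_derive_expR _) d5.
  have d7 := is_deriveM d2 d6.
  apply: is_derive_eq d7 _.
  rewrite /E /GRing.scale /= !fctE.
  have q0 : 0 < Num.sqrt (1 - x ^+ 2) by rewrite sqrtr_gt0.
  have -> : (2 * Num.sqrt (1 - x ^+ 2))^-1 = Num.sqrt (1 - x ^+ 2) / (2 * (1 - x ^+ 2)).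
    rewrite -{3}(sqr_sqrtr (ltW x2)); move: q0; set q := Num.sqrt _ => q0.
    by field; rewrite gt_eqF.
  move: (Num.sqrt (1 - x ^+ 2)) (expR _) => q e.
  by field; rewrite x2'.
have dFE (x : R) : `|x| < 1 -> is_derive x (1 : R) (F \* E) 0.
  move=> x1; apply: is_derive_eq (is_deriveM (mehler_ode t s x1) (dE x x1)) _.
  by rewrite /GRing.scale /=; ring.
have FE (a b : R) : a <= b -> (forall x, x \in `[a, b] -> `|x| < 1) -> F a * E a = F b * E b.
  move=> ab H.
  have dH x : x \in `]a, b[ -> is_derive x (1 : R) (F \* E) 0.
    by move=> /subset_itv_oo_cc xab; apply: dFE; exact: H.
  have [|c _ Hc] := MVT_segment ab dH.
    apply: continuous_in_subspaceT => x; rewrite inE /= => xab.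
    have d := dFE x (H x xab).
    exact/differentiable_continuous/derivable1_diffP.
  by apply/eqP; rewrite eq_sym -subr_eq0; apply/eqP; move: Hc; rewrite mul0r.
have EF : F r * E r = F 0 * E 0.
  have [r0|r0] := leP 0 r.
    symmetry; apply: FE => // x; rewrite in_itv /= => /andP[x0 xr].
    by rewrite ger0_norm// (le_lt_trans xr)// -(ger0_norm r0).
  apply: FE; first exact: ltW.
  move=> x; rewrite in_itv /= => /andP[x0 xr].
  by rewrite ler0_norm//; move: r1; rewrite ltr0_norm//; lra.
have F0 : F 0 = gauss_density t * gauss_density s.
  have : pseries (mehler_coef t s) 0 @ \oo --> gauss_density t * gauss_density s.
    rewrite -cvg_shiftS /=.
    have -> : (fun n => pseries (mehler_coef t s) 0 n.+1) =
       (fun=> gauss_density t * gauss_density s).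
      apply/funext => n; rewrite /pseries /series /= big_nat_recl// big1 ?addr0.
        by rewrite mehler_coefE !hermite0 fact0 expr0 divr1 !mulr1.
      by move=> i _; rewrite expr0n /= mulr0.
    exact: cvg_cst.
  by move/cvg_lim; apply.
have E0 : E 0 = 1.
  by rewrite /E expr0n /= subr0 sqrtr1 mulr0 !mul0r subr0 mul0r expR0 mulr1.
have Er : E r != 0 by rewrite mulf_neq0 ?gt_eqF ?expR_gt0// sqrtr_gt0 c0.
have -> : binormal_pdf t s r = F r.
  rewrite binormal_pdfE// -/(E r) -F0 -[F 0]mulr1 -E0 -EF mulfK//.
by apply: disc_summable_cvg => //; exact: mehler_disc_summable.
Qed.

(** * The normal law under affine maps and rotations *)

(** The pushforward, packaged as a measure. *)
Definition image_measure d d' (T1 : measurableType d) (T2 : measurableType d')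
    (R : realType) (m : {measure set T1 -> \bar R}) (f : T1 -> T2)
    (mf : measurable_fun setT f) : {measure set T2 -> \bar R} :=
  measure_function_pushforward__canonical__measure_function_Measure m mf.

Lemma measurable_affine (R : realType) (m b : R) :
  measurable_fun [set: R] (fun y : R => m + b * y).
Proof. by apply: measurable_funD => //; exact: measurable_funM. Qed.

(** By uniqueness of the Lebesgue measure on half-open intervals; a negative
    factor b exchanges the open and the closed end. *)
Lemma lebesgue_measure_affine (R : realType) (m b : R) (A : set R) :
  b != 0 -> measurable A ->
  ((`|b|)%:E * lebesgue_measure ((fun y : R => (m + b * y)%R) @^-1` A))%E = lebesgue_measure A.
Proof.
move=> b0 mA.
have mphi : measurable_fun [set: R] ((fun y => m + b * y) : R -> measurableTypeR R).
  exact: measurable_affine.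
pose mu' := mscale (NngNum (normr_ge0 b)) (image_measure lebesgue_measure mphi).
apply/esym; apply: (@lebesgue_measure_unique R mu') => //= _ [[x y]] _ <- /=.
rewrite /mu' /mscale /= /pushforward /=.
have [b1|b1] := ltP 0 b.
  rewrite (_ : _ @^-1` _ = `](x - m) / b, (y - m) / b]%classic); last first.
    apply/seteqP; split => z /=; rewrite !in_itv /= ltr_pdivrMr// ler_pdivlMr//;
      by move=> /andP[h1 h2]; apply/andP; split; lra.
  rewrite !lebesgue_measure_itv /= !lte_fin ltr_pM2r ?invr_gt0// ltrD2r.
  case: ifPn => _; last by rewrite mule0.
  by rewrite -!EFinB -EFinM (gtr0_norm b1); congr _%:E; field; rewrite b0.
have {}b1 : b < 0 by rewrite lt_neqAle b0.
rewrite (_ : _ @^-1` _ = `[(y - m) / b, (x - m) / b[%classic); last first.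
  apply/seteqP; split => z /=; rewrite !in_itv /= ltr_ndivlMr// ler_ndivrMr//;
    by move=> /andP[h1 h2]; apply/andP; split; lra.
rewrite !lebesgue_measure_itv /= !lte_fin ltr_nM2r ?invr_lt0// ltrD2r.
case: ifPn => _; last by rewrite mule0.
by rewrite -!EFinB -EFinM (ltr0_norm b1); congr _%:E; field; rewrite b0.
Qed.

Lemma ge0_integral_affine (R : realType) (m b : R) (f : R -> \bar R) :
  b != 0 -> measurable_fun setT f -> (forall x, (0 <= f x)%E) ->
  (`|b|%:E * \int[lebesgue_measure]_y f (m + b * y)%R = \int[lebesgue_measure]_y f y)%E.
Proof.
move=> b0 mf f0.
have mphi : measurable_fun [set: R] ((fun y => m + b * y) : R -> measurableTypeR R).
  exact: measurable_affine.
transitivity (\int[mscale (NngNum (normr_ge0 b)) (image_measure lebesgue_measure mphi)]_y f y)%E.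
  rewrite ge0_integral_mscale//; congr (_ * _)%E.
  by rewrite ge0_integral_pushforward.
by apply: eq_measure_integral => A mA _; exact: lebesgue_measure_affine.
Qed.

Lemma normal_pdf_affine (R : realType) (m b x : R) : b != 0 ->
  normal_pdf m b x = `|b|^-1 * normal_pdf 0 1 ((x - m) / b).
Proof.
move=> b0; rewrite !normal_pdfE ?oner_eq0// /normal_peak /normal_fun.
rewrite mulrA; congr (_ * expR _).
  rewrite expr1n mul1r -[b ^+ 2 * pi *+ 2]mulrnAr sqrtrM ?sqr_ge0// sqrtr_sqr.
  by rewrite invfM.
by rewrite subr0 expr1n; field; rewrite b0.
Qed.

Lemma normal_prob_affine (R : realType) (m b : R) (A : set R) : b != 0 -> measurable A ->
  normal_prob 0 1 ((fun y : R => m + b * y) @^-1` A) = normal_prob m b A.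
Proof.
move=> b0 mA; rewrite /normal_prob integral_mkcond [RHS]integral_mkcond.
pose f (z : R) : \bar R := ((fun z => (normal_pdf 0 1 ((z - m) / b))%:E) \_ A) z.
have f0 z : (0 <= f z)%E.
  by rewrite /f patchE; case: ifP => // _; rewrite lee_fin normal_pdf_ge0.
have mf : measurable_fun setT f.
  apply/(measurable_restrictT _ _).1 => //; apply/measurable_EFinP.
  apply: measurable_funTS; apply: measurableT_comp; first exact: measurable_normal_pdf.
  by apply: measurable_funM => //; exact: measurable_funB.
transitivity (\int[lebesgue_measure]_y f (m + b * y)%R)%E.
  apply: eq_integral => y _; rewrite /f !patchE.
  rewrite -[y \in _ @^-1` _]/((m + b * y) \in A).
  by rewrite (_ : (m + b * y - m) / b = y)//; field.
transitivity ((`|b|^-1)%:E * \int[lebesgue_measure]_y f y)%E.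
  rewrite -(ge0_integral_affine m b0 mf f0) muleA -EFinM mulVf ?normr_eq0// mul1e//.
rewrite -ge0_integralZl ?lee_fin ?invr_ge0//.
apply: eq_integral => y _; rewrite /f !patchE; case: ifP => _; last by rewrite mule0.
by rewrite -EFinM -normal_pdf_affine.
Qed.

(** The density is a Radon-Nikodym derivative, which is unique almost everywhere. *)
Lemma integral_normal_prob (R : realType) (m s : R) (f : R -> \bar R) :
  (normal_prob m s).-integrable setT f ->
  (\int[normal_prob m s]_x f x =
   \int[lebesgue_measure]_x (f x * (normal_pdf m s x)%:E))%E.
Proof.
move=> intf; have mf := measurable_int _ intf.
have dom := normal_prob_dominates m s.
rewrite -(Radon_Nikodym_change_of_variables dom)//=.
apply: ae_eq_integral => //.
- apply: emeasurable_funM => //; apply: (measurable_int lebesgue_measure).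
- have mp : measurable_fun setT (fun x => (normal_pdf m s x)%:E).
    by apply/measurable_EFinP; exact: measurable_normal_pdf.
  exact: emeasurable_funM mf mp.
- apply: ae_eqe_mul2l => /=; rewrite Radon_NikodymE//=.
  case: cid => /= h [h1 h2 h3]; apply: integral_ae_eq => //=.
  + by apply/measurable_EFinP; exact: measurable_normal_pdf.
  + by move=> E _ mE; rewrite -h3.
Qed.

(** Two factorisations of the joint density of X and a X + b Y, for independent
    standard normal X and Y. *)
Lemma normal_pdf_rotation (R : realType) (a b x z : R) : a ^+ 2 + b ^+ 2 = 1 -> b != 0 ->
  normal_pdf (a * x) b z * normal_pdf 0 1 x = normal_pdf 0 1 z * normal_pdf (a * z) b x.
Proof.
move=> ab b0; rewrite !normal_pdfE ?oner_eq0// /normal_fun.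
rewrite mulrACA [RHS]mulrACA [normal_peak 1 * _]mulrC; congr (_ * _).
rewrite -!expRD; congr expR.
have bE : b ^+ 2 = 1 - a ^+ 2 by lra.
have h : 1 - a ^+ 2 != 0 by rewrite -bE expf_neq0.
rewrite bE.
by rewrite !subr0 expr1n; field; rewrite h.
Qed.

(** Given the first coordinate x, the combination is normal with mean a x; the
    factorisation normal_pdf_rotation then allows x to be integrated out. *)
Lemma normal_prob_rotation (R : realType) (a b : R) (A : set R) :
  a ^+ 2 + b ^+ 2 = 1 -> b != 0 -> measurable A ->
  ((normal_prob 0 1 \x normal_prob 0 1) [set p : R * R | A (a * p.1 + b * p.2)%R]
   = normal_prob 0 1 A)%E.
Proof.
move=> ab b0 mA; set E := [set p | _].
have mE : measurable E.
  rewrite -[E]setTI; apply: (_ : measurable_fun setT (fun p : R * R => a * p.1 + b * p.2)) => //.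
  apply: measurable_funD; apply: measurable_funM => //.
rewrite /product_measure1.
have secE x : normal_prob 0 1 (xsection E x) = normal_prob (a * x) b A.
  have -> : xsection E x = (fun y => a * x + b * y) @^-1` A.
    by apply/seteqP; split => y /=; rewrite /xsection /= inE.
  exact: normal_prob_affine.
have mN : measurable_fun [set: R] (fun x => normal_prob 0 1 (xsection E x)).
  exact: measurable_fun_xsection.
have iN : (normal_prob 0 1).-integrable [set: R] (fun x => normal_prob 0 1 (xsection E x)).
  apply/integrableP; split => //; apply: (@le_lt_trans _ _ (\int[normal_prob 0 1]_x (cst 1 x))%E).
    apply: ge0_le_integral => //; first exact: measurableT_comp.
    by move=> x _; rewrite gee0_abs// probability_le1//; exact: measurable_xsection.
  by rewrite integral_cst// mul1e (le_lt_trans (probability_le1 _ measurableT))// ltry.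
rewrite (integral_normal_prob iN).
pose f (p : measurableTypeR R * measurableTypeR R) : \bar R :=
  (\1_A p.2 * (normal_pdf 0 1 p.2 * normal_pdf (a * p.2) b p.1))%:E.
have f0 p : (0 <= f p)%E by rewrite lee_fin !mulr_ge0 ?normal_pdf_ge0.
have mf : measurable_fun setT f.
  have mpdf (m s : R) : measurable_fun [set: measurableTypeR R] (normal_pdf m s).
    exact: measurable_normal_pdf.
  apply/measurable_EFinP; apply: measurable_funM.
    by apply: (measurableT_comp (f := \1_A : measurableTypeR R -> R)).
  apply: measurable_funM.
    exact: (measurableT_comp (mpdf _ _) measurable_snd).
  have -> : (fun p : measurableTypeR R * measurableTypeR R => normal_pdf (a * p.2) b p.1) =
      normal_pdf 0 b \o (fun p => p.1 - a * p.2).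
    by apply/funext => p /=; rewrite !normal_pdfE// normal_fun_center.
  apply: (measurableT_comp (mpdf _ _)); apply: measurable_funB => //.
  exact: measurable_funM.
transitivity (\int[lebesgue_measure]_x \int[lebesgue_measure]_z f (x, z))%E.
  apply: eq_integral => x _; rewrite /= secE /normal_prob integral_mkcond muleC.
  rewrite -ge0_integralZl ?lee_fin ?normal_pdf_ge0//.
  - apply: eq_integral => z _; rewrite patchE /f /= indicE; case: ifP => zA.
      by rewrite mul1r -normal_pdf_rotation// -EFinM mulrC.
    by rewrite mul0r mule0.
  - apply/(measurable_restrictT _ _).1 => //; apply/measurable_EFinP.
    by apply: measurable_funTS; exact: measurable_normal_pdf.
  - by move=> z _; rewrite patchE; case: ifP => // _; rewrite lee_fin normal_pdf_ge0.
rewrite fubini_tonelli//.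
transitivity (\int[lebesgue_measure]_z (\1_A z * normal_pdf 0 1 z)%:E)%E.
  apply: eq_integral => z _; rewrite /f /=.
  under eq_integral do rewrite mulrA EFinM.
  rewrite ge0_integralZl//.
  - by rewrite integral_normal_pdf mule1.
  - by apply/measurable_EFinP; exact: measurable_normal_pdf.
  - by move=> x _; rewrite lee_fin normal_pdf_ge0.
  - by rewrite lee_fin mulr_ge0// normal_pdf_ge0.
rewrite /normal_prob [RHS]integral_mkcond; apply: eq_integral => z _.
by rewrite patchE indicE; case: ifPn => _; rewrite ?mul1r ?mul0r.
Qed.

(** * Combinations of independent standard normal variables *)

(** The property iid_std_normal for plain functions, with the joint law written
    out: reindexing, rotating and changing signs produce functions that are not
    bundled random variables. *)
Definition std_normal_seq d (T : measurableType d) (R : realType)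
    (P : probability T R) (z : nat -> T -> R) : Prop :=
  (forall k, measurable_fun setT (z k)) /\
  forall (s : seq nat) (A : nat -> set R), uniq s -> (forall k, measurable (A k)) ->
    P (\big[setI/setT]_(k <- s) (z k @^-1` A k)) =
    (\prod_(k <- s) normal_prob 0 1 (A k))%E.

Lemma std_normal_seq_iid d (T : measurableType d) (R : realType)
    (P : probability T R) (zeta : nat -> {RV P >-> R}) :
  iid_std_normal zeta -> std_normal_seq P zeta.
Proof.
move=> [ind law]; split => [k|s A us mA]; first exact: measurable_funPT.
by rewrite ind//; apply: eq_bigr => k _; exact: law.
Qed.

Lemma std_normal_seq_sub d (T : measurableType d) (R : realType)
    (P : probability T R) (z : nat -> T -> R) (f g : nat -> nat) :
  cancel f g -> std_normal_seq P z -> std_normal_seq P (z \o f).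
Proof.
move=> fK [mz H]; split => [k|s A us mA]; first exact: mz.
have := H (map f s) (A \o g); rewrite !big_map map_inj_uniq; last exact: can_inj fK.
move=> /(_ us (fun k => mA _)) /=.
under eq_bigr do rewrite fK.
by under [X in _ = X -> _]eq_bigr do rewrite fK.
Qed.

Definition rotate_seq (T : Type) (R : realType) (a b : R) (z : nat -> T -> R)
    (k : nat) : T -> R :=
  if k is k'.+1 then z k'.+2 else (fun x => a * z 0%N x + b * z 1%N x).

(** Restricted to an event D that concerns the other terms, the law of
    (z 0, z 1) is a multiple of the product of two standard normal laws, which
    is rotation invariant. *)
Lemma std_normal_pair d (T : measurableType d) (R : realType)
    (P : probability T R) (z : nat -> T -> R) (s : seq nat) (B : nat -> set R) (a b : R) (A : set R) :
  std_normal_seq P z -> uniq s -> (forall k, k \in s -> (2 <= k)%N) ->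
  (forall k, measurable (B k)) -> measurable A -> a ^+ 2 + b ^+ 2 = 1 -> b != 0 ->
  P ((fun x => a * z 0%N x + b * z 1%N x) @^-1` A `&` \big[setI/setT]_(k <- s) (z k @^-1` B k))
  = (normal_prob 0 1 A * \prod_(k <- s) normal_prob 0 1 (B k))%E.
Proof.
move=> [mz Hz] us s2 mB mA ab b0.
set D := \big[_/_]_(_ <- _) _; set c := (\prod_(k <- s) _)%E.
have mD : measurable D.
  by apply: bigsetI_measurable => k _; rewrite -[X in measurable X]setTI; exact: mz.
have c0 : (0 <= c)%E by apply: prode_ge0.
have cfin : c \is a fin_num by rewrite /c -(Hz s B us mB) fin_num_measure.
have mpair : measurable_fun setT
    ((fun x => (z 0%N x, z 1%N x)) : T -> measurableTypeR R * measurableTypeR R).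
  exact: measurable_fun_pair (mz 0%N) (mz 1%N).
pose m' := image_measure (mrestr P mD) mpair.
pose m2 := mscale (NngNum (fine_ge0 c0)) (normal_prob (0 : R) 1).
pose E := [set p : measurableTypeR R * measurableTypeR R | A (a * p.1 + b * p.2)].
have mE : measurable E.
  rewrite -[E]setTI; apply: (_ : measurable_fun setT
    (fun p : measurableTypeR R * measurableTypeR R => a * p.1 + b * p.2 : R)) => //.
  by apply: measurable_funD; apply: measurable_funM => //.
have Hm' (U V : set (measurableTypeR R)) : measurable U -> measurable V ->
    m' (U `*` V) = (normal_prob 0 1 U * m2 V)%E.
  move=> mU mV; rewrite /m' /m2 /mscale /= /pushforward /mrestr fineK//.
  have := Hz [:: 0, 1 & s]%N
    (fun k => if k == 0%N then U else if k == 1%N then V else B k).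
  rewrite !big_cons /= => H.
  rewrite (_ : _ `&` D = z 0%N @^-1` U `&` (z 1%N @^-1` V `&` D)); last first.
    by rewrite setIA; congr (_ `&` _); apply/seteqP; split => x /=.
  rewrite (_ : D = \big[setI/setT]_(k <- s) (z k @^-1`
     (if k == 0%N then U else if k == 1%N then V else B k))); last first.
    by apply: eq_big_seq => k /s2; case: k => [|[|k]].
  rewrite H.
  - rewrite [X in (_ * (_ * X))%E](_ : _ = c); first by rewrite [(_ * c)%E]muleC.
    by apply: eq_big_seq => k /s2; case: k => [|[|k]].
  - rewrite us andbT in_cons /=; apply/andP; split; apply/negP => /s2 //.
  - by move=> [|[|k]]; [exact: mU|exact: mV|exact: mB].
have := @product_measure_unique _ _ _ _ R (normal_prob 0 1) m2 m' Hm' E mE.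
move=> HE; transitivity (m' E); first by [].
rewrite -HE -(normal_prob_rotation ab b0 mA) /product_measure1.
transitivity (\int[normal_prob 0 1]_x (c * normal_prob 0 1 (xsection E x)))%E.
  apply: eq_integral => x _.
  by rewrite -[(m2 \o _) x]/((fine c)%:E * normal_prob 0 1 (xsection E x))%E fineK.
rewrite [RHS]muleC ge0_integralZl//; first exact: measurable_fun_xsection.
Qed.

Lemma std_normal_seq_rotate d (T : measurableType d) (R : realType)
    (P : probability T R) (z : nat -> T -> R) (a b : R) :
  a ^+ 2 + b ^+ 2 = 1 -> b != 0 -> std_normal_seq P z ->
  std_normal_seq P (rotate_seq a b z).
Proof.
move=> ab b0 Hz; have [mz Pz] := Hz; split.
  case=> [|k]; last exact: mz.
  by apply: measurable_funD; apply: measurable_funM => //; exact: mz.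
have tail s A : uniq s -> 0%N \notin s ->
    \big[setI/setT]_(k <- s) (rotate_seq a b z k @^-1` A k) =
    \big[setI/setT]_(k <- map succn s) (z k @^-1` A k.-1).
  move=> us s0; rewrite big_map; apply: eq_big_seq => -[|k] //.
  by move=> k0; rewrite k0 in s0.
have tail2 s (A : nat -> set R) : (\prod_(k <- s) normal_prob 0 1 (A k) =
    \prod_(k <- map succn s) normal_prob 0 1 (A k.-1))%E by rewrite big_map.
move=> s A us mA; have [s0|s0] := boolP (0%N \in s); last first.
  rewrite tail// Pz; first by rewrite [RHS]tail2.
    by rewrite map_inj_uniq//; exact: succn_inj.
  by move=> k; exact: mA.
rewrite (perm_big _ (perm_to_rem s0)) [RHS](perm_big _ (perm_to_rem s0)) /= !big_cons.
have us' : uniq (rem 0%N s) by rewrite rem_uniq.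
have s0' : 0%N \notin rem 0%N s by rewrite mem_rem_uniqF.
rewrite tail// [in RHS]tail2; apply: (std_normal_pair Hz) => //.
- by rewrite map_inj_uniq//; exact: succn_inj.
- by move=> _ /mapP[[|k] ks ->] //; rewrite ks in s0'.
Qed.

(** Rotations merge the terms two by two until a single one is left, whose
    coefficient s has the square sum of the c k ^ 2.  The law is written as an
    image of the standard normal law so as to allow s = 0. *)
Lemma std_normal_sum d (T : measurableType d) (R : realType)
    (P : probability T R) (n : nat) (z : nat -> T -> R) (c : nat -> R) :
  std_normal_seq P z -> exists2 s : R, s ^+ 2 = \sum_(k < n) c k ^+ 2 &
    forall A, measurable A -> P ((fun x => \sum_(k < n) c k * z k x) @^-1` A) =
      normal_prob 0 1 ((fun y => s * y) @^-1` A).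
Proof.
elim: n z c => [|[|n] IH] z c Hz.
- exists 0; first by rewrite expr0n big_ord0.
  move=> A mA; have [A0|A0] := pselect (A 0).
    rewrite (_ : _ @^-1` A = setT); last by apply/seteqP; split => x //= _; rewrite big_ord0.
    rewrite (_ : _ @^-1` A = setT); last by apply/seteqP; split => x //= _; rewrite mul0r.
    by rewrite !probability_setT.
  rewrite (_ : _ @^-1` A = set0); last by apply/seteqP; split => x //=; rewrite big_ord0.
  rewrite (_ : _ @^-1` A = set0); last by apply/seteqP; split => x //=; rewrite mul0r.
  by rewrite !measure0.
- exists (c 0%N); first by rewrite big_ord1.
  move=> A mA; have [mz Pz] := Hz.
  have mA' : measurable ((fun y => c 0%N * y) @^-1` A).
    by rewrite -[X in measurable X]setTI; apply: measurable_funM.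
  have := Pz [:: 0%N] (fun=> (fun y => c 0%N * y) @^-1` A) erefl (fun=> mA').
  rewrite !big_seq1 => <-; congr (P _).
  by apply/seteqP; split => x /=; rewrite big_ord1.
(* The rotation needs a non-zero second coefficient: a zero one is dropped. *)
have [c1|c1] := eqVneq (c 1%N) 0.
  pose f k := (if k is k'.+1 then k'.+2 else 0)%N.
  have fK : cancel f predn by case.
  have [s sE H] := IH _ (c \o f) (std_normal_seq_sub fK Hz).
  exists s.
    by rewrite sE big_ord_recl [RHS]big_ord_recl big_ord_recl /= c1 expr0n add0r.
  move=> A mA; rewrite -H//; congr (P (_ @^-1` A)); apply/funext => x /=.
  by rewrite big_ord_recl [RHS]big_ord_recl big_ord_recl /= c1 mul0r add0r.
have r0 : 0 < c 0%N ^+ 2 + c 1%N ^+ 2.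
  by rewrite ltr_wpDl ?sqr_ge0// lt_neqAle sqr_ge0 eq_sym sqrf_eq0 c1.
pose r := Num.sqrt (c 0%N ^+ 2 + c 1%N ^+ 2).
have r1 : 0 < r by rewrite sqrtr_gt0.
have rE : r ^+ 2 = c 0%N ^+ 2 + c 1%N ^+ 2 by rewrite sqr_sqrtr// ltW.
have ab : (c 0%N / r) ^+ 2 + (c 1%N / r) ^+ 2 = 1.
  by rewrite !expr_div_n -mulrDl -rE divff// expf_neq0// gt_eqF.
have b0 : c 1%N / r != 0 by rewrite mulf_neq0// invr_neq0// gt_eqF.
have [s sE H] := IH _ (fun k => if k is k'.+1 then c k'.+2 else r) (std_normal_seq_rotate ab b0 Hz).
exists s.
  by rewrite sE big_ord_recl [RHS]big_ord_recl big_ord_recl /= rE addrA.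
move=> A mA; rewrite -H//; congr (P (_ @^-1` A)); apply/funext => x /=.
rewrite big_ord_recl [RHS]big_ord_recl [X in _ + X = _]big_ord_recl /= addrA; congr (_ + _).
by field; rewrite gt_eqF.
Qed.

(** * Integrals and laws of almost sure limits *)

Lemma bounded_integrable d (T : measurableType d) (R : realType)
    (P : probability T R) (f : T -> R) (M : R) :
  measurable_fun setT f -> (forall x, `|f x| <= M) -> P.-integrable setT (EFin \o f).
Proof.
move=> mf fM; apply: (le_integrable measurableT _ _ (_ : P.-integrable setT (EFin \o cst M))).
- exact/measurable_EFinP.
- by move=> x _ /=; rewrite lee_fin (le_trans (fM x))// ler_norm.
- exact: finite_measure_integrable_cst.
Qed.

Lemma integral_law d1 d2 d3 (T : measurableType d1) (T' : measurableType d2)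
    (U : measurableType d3) (R : realType) (P : probability T R) (P' : probability T' R)
    (X : T -> U) (X' : T' -> U) (f : U -> \bar R) :
  measurable_fun setT X -> measurable_fun setT X' -> measurable_fun setT f ->
  P.-integrable setT (f \o X) -> P'.-integrable setT (f \o X') ->
  (forall A, measurable A -> P (X @^-1` A) = P' (X' @^-1` A)) ->
  (\int[P]_x f (X x) = \int[P']_x f (X' x))%E.
Proof.
move=> mX mX' mf iX iX' H.
transitivity (\int[image_measure P mX]_u f u)%E; first by rewrite integral_pushforward.
transitivity (\int[image_measure P' mX']_u f u)%E; last by rewrite integral_pushforward.
by apply: eq_measure_integral => A mA _; exact: H.
Qed.

Lemma ge0_integral_law d1 d2 d3 (T : measurableType d1) (T' : measurableType d2)
    (U : measurableType d3) (R : realType) (P : probability T R) (P' : probability T' R)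
    (X : T -> U) (X' : T' -> U) (f : U -> \bar R) :
  measurable_fun setT X -> measurable_fun setT X' -> measurable_fun setT f ->
  (forall u, 0 <= f u)%E ->
  (forall A, measurable A -> P (X @^-1` A) = P' (X' @^-1` A)) ->
  (\int[P]_x f (X x) = \int[P']_x f (X' x))%E.
Proof.
move=> mX mX' mf f0 H.
transitivity (\int[image_measure P mX]_u f u)%E; first by rewrite ge0_integral_pushforward.
transitivity (\int[image_measure P' mX']_u f u)%E; last by rewrite ge0_integral_pushforward.
by apply: eq_measure_integral => A mA _; exact: H.
Qed.

Lemma bounded_integral_law d1 d2 d3 (T : measurableType d1) (T' : measurableType d2)
    (U : measurableType d3) (R : realType) (P : probability T R) (P' : probability T' R)
    (X : T -> U) (X' : T' -> U) (f : U -> R) (M : R) :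
  measurable_fun setT X -> measurable_fun setT X' -> measurable_fun setT f ->
  (forall u, `|f u| <= M) ->
  (forall A, measurable A -> P (X @^-1` A) = P' (X' @^-1` A)) ->
  (\int[P]_x (f (X x))%:E = \int[P']_x (f (X' x))%:E)%E.
Proof.
move=> mX mX' mf fM law.
apply: (@integral_law _ _ _ _ _ _ _ _ _ X X' (EFin \o f)) => //.
- exact/measurable_EFinP.
- by apply: (@bounded_integrable _ _ _ _ _ M) => //; exact: measurableT_comp.
- by apply: (@bounded_integrable _ _ _ _ _ M) => //; exact: measurableT_comp.
Qed.

Lemma bounded_convergence d (T : measurableType d) (R : realType)
    (P : probability T R) (g : nat -> T -> R) (h : T -> R) (M : R) :
  (forall n, measurable_fun setT (g n)) -> measurable_fun setT h ->
  (forall n x, `|g n x| <= M) ->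
  {ae P, forall x, g n x @[n --> \oo] --> h x} ->
  (\int[P]_x (g n x)%:E)%E @[n --> \oo] --> (\int[P]_x (h x)%:E)%E.
Proof.
move=> mg mh gM gh.
have mg' n : measurable_fun setT (EFin \o g n) by exact/measurable_EFinP.
have mh' : measurable_fun setT (EFin \o h) by exact/measurable_EFinP.
have cvgE : {ae P, forall x, setT x -> (EFin \o g n) x @[n --> \oo] --> (EFin \o h) x}.
  by apply: filterS gh => x gx _; apply: cvg_comp gx _.
have iM : P.-integrable setT (cst M%:E) by exact: finite_measure_integrable_cst.
have domE : {ae P, forall x n, setT x -> (`|(EFin \o g n) x| <= cst M%:E x)%E}.
  by apply: aeW => x n _ /=; rewrite lee_fin.
by have [_ _] := dominated_convergence measurableT mg' mh' cvgE iM domE.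
Qed.

(** Continuous functions that decrease to the indicator of ]-oo, r]. *)
Definition ramp (R : realType) (r : R) (n : nat) (x : R) : R :=
  Num.max 0 (Num.min 1 (1 - n%:R * (x - r))).

Lemma ramp_bound (R : realType) (r : R) n x : `|ramp r n x| <= 1.
Proof.
rewrite /ramp ger0_norm ?le_max ?lexx// ge_max ler01 /=.
by rewrite ge_min lexx.
Qed.

Lemma continuous_ramp (R : realType) (r : R) n : continuous (ramp r n).
Proof.
have lin : continuous (fun x : R => 1 - n%:R * (x - r)).
  move=> x; apply: cvgB; first exact: cvg_cst.
  by apply: cvgM; [exact: cvg_cst|apply: cvgB; [exact: cvg_id|exact: cvg_cst]].
have -> : ramp r n = (cst 0 : R -> R^o) \max (cst 1 \min (fun x : R => 1 - n%:R * (x - r))) by [].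
move=> x; apply: continuous_max; first exact: cvg_cst.
by apply: continuous_min; [exact: cvg_cst|exact: lin].
Qed.

Lemma ramp_cvg (R : realType) (r x : R) :
  ramp r n x @[n --> \oo] --> (\1_(`]-oo, r]%classic) x : R).
Proof.
rewrite indicE; have [xr|xr] := leP x r.
  rewrite mem_set ?in_itv//=; apply: cvg_near_cst; near=> n.
  rewrite /ramp min_l ?max_r// lerBrDr -lerBrDl subrr.
  by rewrite mulr_ge0_le0// subr_le0.
rewrite memNset; last by rewrite /= in_itv /= leNgt xr.
apply: cvg_near_cst; near=> n.
have nx : 1 / (x - r) <= n%:R by near: n; exact: nbhs_infty_ger.
rewrite /ramp max_l// ge_min subr_le0; apply/orP; right.
by move: nx; rewrite ler_pdivrMr ?subr_gt0.
Unshelve. all: by end_near. Qed.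

(** Bounded continuous functions have the same mean under both limits; the ramps
    extend this to the indicators of rays, which determine a law. *)
Lemma law_of_limit d1 d2 (T : measurableType d1) (T' : measurableType d2) (R : realType)
    (P : probability T R) (P' : probability T' R)
    (X : nat -> T -> R) (X' : nat -> T' -> R) (Y : T -> R) (Y' : T' -> R) :
  (forall n, measurable_fun setT (X n)) -> (forall n, measurable_fun setT (X' n)) ->
  measurable_fun setT Y -> measurable_fun setT Y' ->
  (forall n A, measurable A -> P (X n @^-1` A) = P' (X' n @^-1` A)) ->
  {ae P, forall x, X n x @[n --> \oo] --> Y x} ->
  {ae P', forall x, X' n x @[n --> \oo] --> Y' x} ->
  forall A, measurable A -> P (Y @^-1` A) = P' (Y' @^-1` A).
Proof.
move=> mX mX' mY mY' law XY XY'.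
have mr r k : measurable_fun [set: R] (ramp r k).
  by apply: continuous_measurable_fun; exact: continuous_ramp.
have main (r : R) k : (\int[P]_x (ramp r k (Y x))%:E = \int[P']_x (ramp r k (Y' x))%:E)%E.
  have c1 : (\int[P]_x (ramp r k (X n x))%:E)%E @[n --> \oo] --> (\int[P]_x (ramp r k (Y x))%:E)%E.
    apply: (@bounded_convergence _ _ _ _ (fun n x => ramp r k (X n x)) _ 1).
    - by move=> n; exact: measurableT_comp.
    - exact: measurableT_comp.
    - by move=> n x; exact: ramp_bound.
    - by apply: filterS XY => x; apply: continuous_cvg; exact: continuous_ramp.
  have c2 : (\int[P']_x (ramp r k (X' n x))%:E)%E @[n --> \oo] --> (\int[P']_x (ramp r k (Y' x))%:E)%E.
    apply: (@bounded_convergence _ _ _ _ (fun n x => ramp r k (X' n x)) _ 1).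
    - by move=> n; exact: measurableT_comp.
    - exact: measurableT_comp.
    - by move=> n x; exact: ramp_bound.
    - by apply: filterS XY' => x; apply: continuous_cvg; exact: continuous_ramp.
  have E : (fun n => \int[P]_x (ramp r k (X n x))%:E)%E = (fun n => \int[P']_x (ramp r k (X' n x))%:E)%E.
    apply/funext => n; apply: (@bounded_integral_law _ _ _ _ _ _ _ _ _ _ _ _ 1) => //.
      by move=> u; exact: ramp_bound.
    exact: law.
  by rewrite E in c1; exact: cvg_unique c1 c2.
have ray (r : R) : P (Y @^-1` `]-oo, r]) = P' (Y' @^-1` `]-oo, r]).
  have c1 : (\int[P]_x (ramp r k (Y x))%:E)%E @[k --> \oo] --> (\int[P]_x (\1_(`]-oo, r]%classic) (Y x))%:E)%E.
    apply: (@bounded_convergence _ _ _ _ (fun k x => ramp r k (Y x)) _ 1).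
    - by move=> n; exact: measurableT_comp.
    - by apply: measurableT_comp.
    - by move=> n x; exact: ramp_bound.
    - by apply: aeW => x; exact: ramp_cvg.
  have c2 : (\int[P']_x (ramp r k (Y' x))%:E)%E @[k --> \oo] --> (\int[P']_x (\1_(`]-oo, r]%classic) (Y' x))%:E)%E.
    apply: (@bounded_convergence _ _ _ _ (fun k x => ramp r k (Y' x)) _ 1).
    - by move=> n; exact: measurableT_comp.
    - by apply: measurableT_comp.
    - by move=> n x; exact: ramp_bound.
    - by apply: aeW => x; exact: ramp_cvg.
  have E : (fun k => \int[P]_x (ramp r k (Y x))%:E)%E = (fun k => \int[P']_x (ramp r k (Y' x))%:E)%E.
    by apply/funext => k; exact: main.
  rewrite E in c1; have := cvg_unique _ c1 c2.
  have mpre (d : measure_display) (U : measurableType d) (Z : U -> R) : measurable_fun setT Z ->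
     measurable (Z @^-1` `]-oo, r]).
    by move=> mZ; rewrite -[X in measurable X]setTI; exact: mZ.
  have iE (d : measure_display) (U : measurableType d) (Q : probability U R) (Z : U -> R) :
     measurable_fun setT Z -> (\int[Q]_x (\1_(`]-oo, r]%classic) (Z x))%:E)%E = Q (Z @^-1` `]-oo, r]).
    move=> mZ; rewrite -[in RHS](setIT (Z @^-1` _)) -integral_indic//.
    exact: mpre.
  by rewrite !iE// => ->//; exact: ereal_hausdorff.
have mYR : measurable_fun setT (Y : T -> measurableTypeR R) by exact: mY.
have mYR' : measurable_fun setT (Y' : T' -> measurableTypeR R) by exact: mY'.
move=> A mA.
change (image_measure P mYR A = image_measure P' mYR' A).
apply: (@measure_unique _ R (measurableTypeR R) (@RGenOInfty.G R)
   (fun n => `]- n%:R, +oo[%classic) (@RGenOInfty.measurableE R)) => //.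
- move=> _ _ [x ->] [y ->]; exists (Num.max x y).
  by apply/seteqP; split => z /=; rewrite !in_itv /= !andbT gt_max => /andP.
- by move=> n; exists (- n%:R).
- apply/seteqP; split => // x _; exists (Num.truncn `|x|).+1 => //=.
  rewrite in_itv /= andbT ltrNl (le_lt_trans (ler_norm _))// normrN.
  exact: truncnS_gt.
- move=> _ [x ->] /=; rewrite /pushforward.
  have -> : Y @^-1` `]x, +oo[ = ~` (Y @^-1` `]-oo, x]).
    by apply/seteqP; split => z /=; rewrite !in_itv /= andbT ltNge => /negP.
  have -> : Y' @^-1` `]x, +oo[ = ~` (Y' @^-1` `]-oo, x]).
    by apply/seteqP; split => z /=; rewrite !in_itv /= andbT ltNge => /negP.
  rewrite !probability_setC ?ray//.
  + by rewrite -[X in measurable X]setTI; exact: mY'.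
  + by rewrite -[X in measurable X]setTI; exact: mY.
- by move=> k; rewrite /= (le_lt_trans (probability_le1 _ _)) ?ltry//;
    rewrite -[X in measurable X]setTI; exact: mY.
Qed.

(** * Moments and almost sure limits of normal variables *)

Lemma normal_probN (R : realType) (A : set R) : measurable A ->
  normal_prob 0 1 (-%R @^-1` A) = normal_prob (0 : R) 1 A.
Proof.
move=> mA.
have -> : -%R @^-1` A = (fun y : R => 0 + (-1) * y) @^-1` A.
  by congr (_ @^-1` A); apply/funext => y; rewrite add0r mulN1r.
rewrite normal_prob_affine ?oppr_eq0 ?oner_eq0// /normal_prob.
apply: eq_integral => y _; rewrite !normal_pdfE ?oppr_eq0 ?oner_eq0//.
by rewrite /normal_peak /normal_fun sqrrN.
Qed.

Lemma normal_prob_scale_norm (R : realType) (s : R) (A : set R) : measurable A ->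
  normal_prob 0 1 ((fun y : R => `|s| * y) @^-1` A) = normal_prob 0 1 ((fun y => s * y) @^-1` A).
Proof.
move=> mA; have [s0|s0] := ler0P s; last by [].
rewrite -[RHS]normal_probN.
  by congr normal_prob; apply/seteqP; split => y /=; rewrite mulrN mulNr.
by rewrite -[X in measurable X]setTI; apply: measurable_funM.
Qed.

Lemma normal_prob_set1 (R : realType) (a : R) : normal_prob (0 : R) 1 [set a] = 0%E.
Proof.
by rewrite /normal_prob integral_set1.
Qed.

(** The law is symmetric. *)
Lemma normal_mean (R : realType) :
  (normal_prob (0 : R) 1).-integrable setT EFin ->
  (\int[normal_prob (0 : R) 1]_y y%:E = 0)%E.
Proof.
move=> iy.
have mN : measurable_fun setT (-%R : measurableTypeR R -> measurableTypeR R).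
  exact: oppr_measurable.
have E : (\int[normal_prob (0 : R) 1]_y y%:E = \int[normal_prob (0 : R) 1]_y (- y)%:E)%E.
  transitivity (\int[image_measure (normal_prob (0 : R) 1) mN]_y y%:E)%E.
    by apply: eq_measure_integral => A mA _; rewrite /= /pushforward normal_probN.
  rewrite integral_pushforward//.
  by apply: eq_integrable (integrableN iy) => // y _ /=; rewrite EFinN.
have fin : (\int[normal_prob (0 : R) 1]_y y%:E)%E \is a fin_num by exact: integrable_fin_num.
move: E; under [X in _ = X -> _]eq_integral do rewrite EFinN.
rewrite integralN//; last exact: integrable_add_def.
case: (\int[_]_y _)%E fin => //= r _ [] /eqP; rewrite -subr_eq0 opprK -mulr2n mulrn_eq0 /=.
by move=> /eqP ->.
Qed.

(** The function - y pdf(y) is an antiderivative of (y^2 - 1) pdf(y). *)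
Lemma normal_second_moment_seg (R : realType) (n : nat) : (0 < n)%N ->
  (\int[normal_prob (0 : R) 1]_(y in `[(- n%:R)%R, n%:R%R]) (y ^+ 2)%:E =
   normal_prob 0 1 `[(- n%:R)%R, n%:R%R] - (2 * n%:R * normal_pdf 0 1 n%:R)%:E)%E.
Proof.
move=> n0; set I := `[- n%:R, n%:R]%classic.
have mI : measurable (I : set (measurableTypeR R)) by exact: measurable_itv.
have phiE : normal_pdf (0 : R) 1 = fun y => (Num.sqrt (pi *+ 2))^-1 * expR (- (2^-1 * y ^+ 2)).
  rewrite normal_pdfE// /normal_peak /normal_fun; apply/funext => y.
  by rewrite expr1n mul1r subr0; congr (_ * expR _); field.
have cphi := @continuous_normal_pdf R 0 1 (oner_neq0 _).
have csq : continuous (fun y : R => y ^+ 2) by move=> y; exact: exprn_continuous.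
have cD : continuous (fun y : R => y ^+ 2 * normal_pdf 0 1 y - normal_pdf 0 1 y).
  by move=> y; apply: cvgB; [apply: cvgM; [exact: csq|exact: cphi]|exact: cphi].
have cP : continuous (fun y : R => y ^+ 2 * normal_pdf 0 1 y).
  by move=> y; apply: cvgM; [exact: csq|exact: cphi].
have cF : continuous (fun y : R => - (y * normal_pdf 0 1 y)).
  by move=> y; apply: cvgN; apply: cvgM; [exact: cvg_id|exact: cphi].
have dF (y : R) : is_derive y (1 : R) (fun y => - (y * normal_pdf 0 1 y))
    (y ^+ 2 * normal_pdf 0 1 y - normal_pdf 0 1 y).
  rewrite phiE; set c := (_)^-1.
  have d1 : is_derive y (1 : R) (fun y => - (2^-1 * y ^+ 2)) (- y).
    by apply: trigger_derive; rewrite /GRing.scale /=; field.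
  have d2 : is_derive y (1 : R) (fun y => expR (- (2^-1 * y ^+ 2))) (- y * expR (- (2^-1 * y ^+ 2))).
    apply: (is_derive_eq (@is_derive1_comp _ expR (fun y => - (2^-1 * y ^+ 2)) _ _ _ _ d1)).
    by rewrite mulrC.
  apply: trigger_derive; rewrite /GRing.scale /=; ring.
have nn : - n%:R < n%:R :> R by rewrite gtrN// ltr0n.
have := @continuous_FTC2 R _ (fun y => - (y * normal_pdf 0 1 y)) _ _ nn (continuous_subspaceT cD).
have -> : normal_pdf 0 1 (- n%:R) = normal_pdf 0 1 n%:R :> R by rewrite phiE sqrrN.
move=> FTC.
have {}FTC : (\int[lebesgue_measure]_(y in I) (y ^+ 2 * normal_pdf 0 1 y - normal_pdf 0 1 y)%:E =
   (- (2 * n%:R * normal_pdf 0 1 n%:R))%:E)%E.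
  rewrite FTC.
  - by rewrite -EFinB; congr _%:E; ring.
  - split => [y _||].
    + exact: ex_derive.
    + by apply: cvg_at_right_filter; exact: cF.
    + by apply: cvg_at_left_filter; exact: cF.
  - by move=> y _; rewrite derive1E; exact: derive_val.
have i1 : lebesgue_measure.-integrable I (EFin \o (fun y : R => y ^+ 2 * normal_pdf 0 1 y)).
  by apply: continuous_compact_integrable; [exact: segment_compact|exact: continuous_subspaceT].
have i2 : lebesgue_measure.-integrable I (EFin \o (normal_pdf (0 : R) 1)).
  by apply: continuous_compact_integrable; [exact: segment_compact|exact: continuous_subspaceT].
have E : (\int[normal_prob (0 : R) 1]_(y in I) (y ^+ 2)%:E =
    \int[lebesgue_measure]_(y in I) (y ^+ 2 * normal_pdf 0 1 y)%:E)%E.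
  rewrite integral_mkcond integral_normal_prob.
    rewrite [RHS]integral_mkcond; apply: eq_integral => y _.
    by rewrite !patchE; case: ifP => _; rewrite ?mul0e// EFinM.
  apply/(integrable_mkcond _ _).1; first exact: measurable_itv.
  apply: (@le_integrable _ (measurableTypeR R) R (normal_prob 0 1) I mI (fun x => (x ^+ 2)%:E) (cst (n%:R ^+ 2)%:E)).
  - by apply/measurable_EFinP; apply: measurable_funTS; exact: exprn_measurable.
  - move=> y; rewrite /I /= in_itv /= => /andP[h1 h2].
    by rewrite lee_fin !ger0_norm ?sqr_ge0// -[leLHS]real_normK ?num_real// lerXn2r ?nnegrE// ler_norml h1.
  - exact: finite_measure_integrable_cst.
rewrite E; move: FTC; under eq_integral do rewrite EFinB.
rewrite (integralB mI i1 i2) => H.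
rewrite -[normal_prob 0 1 I]/(\int[lebesgue_measure]_(x in I) (normal_pdf 0 1 x)%:E)%E.
move: H (integrable_fin_num mI i1) (integrable_fin_num mI i2); rewrite /comp.
case: (\int[_]_(_ in _) _)%E => //= a; case: (\int[_]_(_ in _) _)%E => //= b.
by rewrite -!EFinB => -[h] _ _; congr _%:E; lra.
Qed.

Lemma normal_second_moment (R : realType) :
  (\int[normal_prob (0 : R) 1]_y (y ^+ 2)%:E = 1)%E.
Proof.
pose F n := `[- n%:R, n%:R : R]%classic.
have mF n : measurable (F n : set (measurableTypeR R)) by exact: measurable_itv.
have UF : \bigcup_n F n = setT.
  apply/seteqP; split => // x _; exists (Num.truncn `|x|).+1 => //=.
  by rewrite /F /= in_itv /= -ler_norml ltW// truncnS_gt.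
have ndF : nondecreasing_seq F.
  move=> a b ab; apply/subsetPset => x; rewrite /F /= !in_itv /= -!ler_norml => /le_trans; apply.
  by rewrite ler_nat.
have c1 : (\int[normal_prob (0 : R) 1]_(y in F n) (y ^+ 2)%:E)%E @[n --> \oo] -->
    (\int[normal_prob (0 : R) 1]_y (y ^+ 2)%:E)%E.
  rewrite -UF; apply: ge0_nondecreasing_set_cvg_integral => //.
  - by move=> n; apply/measurable_EFinP; apply: measurable_funTS; exact: exprn_measurable.
  - by move=> n x _; rewrite lee_fin sqr_ge0.
have c2 : (normal_prob (0 : R) 1 (F n)) @[n --> \oo] --> 1%E.
  rewrite -(probability_setT (normal_prob (0 : R) 1)) -UF.
  apply: nondecreasing_cvg_mu => //; exact: bigcup_measurable.
have c3 : ((2 * n%:R * normal_pdf 0 1 n%:R : R)%:E) @[n --> \oo] --> 0%E.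
  apply: cvg_EFin; first exact: nearW.
  apply: (@squeeze_cvgr _ _ _ _ (fun=> 0) (fun n : nat => 4 * normal_peak 1 * n%:R^-1)).
  - near=> n; have n0 : (0 < n%:R :> R) by rewrite ltr0n; near: n; exact: nbhs_infty_gt.
    rewrite !mulr_ge0 ?normal_pdf_ge0 ?ler0n//= normal_pdfE// /normal_fun subr0 expr1n mulNr expRN.
    have h := expR_ge1Dx (n%:R ^+ 2 / 2 : R).
    rewrite [leLHS]mulrA ler_pdivrMr ?expR_gt0// [leRHS]mulrAC ler_pdivlMr//.
    have k0 := @normal_peak_ge0 R 1; rewrite -subr_ge0.
    rewrite [X in 0 <= X](_ : _ = normal_peak 1 * (4 * expR (n%:R ^+ 2 / 2) - 2 * n%:R ^+ 2)); last by ring.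
    by rewrite mulr_ge0// subr_ge0; lra.
  - exact: cvg_cst.
  - rewrite -[0 in X in _ --> X](mulr0 (4 * normal_peak 1 : R)); apply: cvgM; [exact: cvg_cst|exact: cvg_inv_nat].
have : ((normal_prob (0 : R) 1 (F n)) - (2 * n%:R * normal_pdf 0 1 n%:R : R)%:E)%E @[n --> \oo] --> (1 - 0)%E.
  by apply: cvgeB.
rewrite sube0 => c4; apply: cvg_unique c1 _; first exact: ereal_hausdorff.
apply: cvg_trans c4; apply: near_eq_cvg; near=> n.
rewrite -normal_second_moment_seg//; near: n; exact: nbhs_infty_gt.
Unshelve. all: by end_near. Qed.

Lemma measurable_series_coef d (T : measurableType d) (R : realType)
    (z : nat -> T -> R) (c : nat -> R) n :
  (forall k, measurable_fun setT (z k)) ->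
  measurable_fun setT (fun x => \sum_(k < n) c k * z k x).
Proof.
move=> mz; apply: measurable_sum => k.
by apply: measurable_funM => //; exact: mz.
Qed.

(** If the variances of the partial sums stay bounded, their square roots converge,
    and law_of_limit applies.  Otherwise the partial sums divided by their
    standard deviations tend to 0 almost surely while remaining standard normal,
    so that the standard normal law would be the Dirac mass at 0. *)
Lemma gaussian_limit d (T : measurableType d) (R : realType) (P : probability T R)
    (z : nat -> T -> R) (c : nat -> R) (S : T -> R) :
  std_normal_seq P z -> measurable_fun setT S ->
  {ae P, forall x, \sum_(k < n) c k * z k x @[n --> \oo] --> S x} ->
  exists2 s : R, \sum_(k < n) c k ^+ 2 @[n --> \oo] --> s ^+ 2 &
    forall A, measurable A ->
      P (S @^-1` A) = normal_prob 0 1 ((fun y => s * y) @^-1` A).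
Proof.
move=> Hz mS zS; have [mz _] := Hz.
pose q n : R := \sum_(k < n) c k ^+ 2.
have q0 n : 0 <= q n by apply: sumr_ge0 => k _; exact: sqr_ge0.
have ndq : nondecreasing_seq q.
  by apply/nondecreasing_seqP => n; rewrite /q big_ord_recr /= lerDl sqr_ge0.
have law n A : measurable A -> P ((fun x => \sum_(k < n) c k * z k x) @^-1` A) =
    normal_prob 0 1 ((fun y => Num.sqrt (q n) * y) @^-1` A).
  move=> mA; have [s sE ->//] := std_normal_sum n c Hz.
  by rewrite -normal_prob_scale_norm// /q -sE sqrtr_sqr.
have mSn n : measurable_fun setT (fun x => \sum_(k < n) c k * z k x).
  exact: measurable_series_coef.
have [[M qM]|unb] := pselect (exists M, forall n, q n <= M).
  have cq : cvgn q.
    by apply: nondecreasing_is_cvgn => //; exists M => _ [n _ <-].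
  have l0 : 0 <= limn q by apply: limr_ge => //; exact: nearW.
  exists (Num.sqrt (limn q)); first by rewrite sqr_sqrtr.
  apply: (law_of_limit mSn _ mS _ law zS).
  - by move=> n; exact: measurable_funM.
  - exact: measurable_funM.
  - apply: aeW => y; apply: cvgM; last exact: cvg_cst.
    by apply: continuous_cvg; [exact: sqrt_continuous|exact: cq].
exfalso.
have [N qN] : exists N, 0 < q N.
  apply: contrapT => H; apply: unb; exists 0 => n; rewrite leNgt; apply/negP => h.
  by apply: H; exists n.
have qNn n : 0 < q (n + N)%N by rewrite (lt_le_trans qN)// ndq// leq_addl.
pose r n := (Num.sqrt (q (n + N)%N))^-1.
have r0 : r n @[n --> \oo] --> (0 : R).
  apply/cvgrPdist_lt => e e0; have [n0 qn0] : exists n0, e ^- 2 < q n0.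
    apply: contrapT => H; apply: unb; exists (e ^- 2) => n; rewrite leNgt; apply/negP => h.
    by apply: H; exists n.
  near=> n; rewrite sub0r normrN ger0_norm ?invr_ge0// invf_plt ?posrE ?sqrtr_gt0//.
  have -> : e^-1 = Num.sqrt (e ^- 2) by rewrite -exprVn sqrtr_sqr ger0_norm// invr_ge0 ltW.
  rewrite ltr_sqrt//; apply: (lt_le_trans qn0); apply: ndq.
  by rewrite (@leq_trans n) ?leq_addr//; near: n; exact: nbhs_infty_ge.
have : forall A : set R, measurable A -> P ((fun=> 0) @^-1` A) = normal_prob 0 1 (id @^-1` A).
  apply: (@law_of_limit _ _ _ (measurableTypeR R) _ P (normal_prob 0 1)
    (fun n x => r n * \sum_(k < n + N) c k * z k x) (fun=> id)) => //.
  - by move=> n; apply: measurable_funM => //; exact: mSn.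
  - move=> n A mA.
    have mA' : measurable ((fun y => r n * y) @^-1` A).
      by rewrite -[X in measurable X]setTI; apply: measurable_funM.
    transitivity (P ((fun x => \sum_(k < n + N) c k * z k x) @^-1` ((fun y => r n * y) @^-1` A))) => //.
    rewrite law//; congr normal_prob; apply/seteqP.
    have rs y : r n * (Num.sqrt (q (n + N)%N) * y) = y.
      by rewrite mulrA mulVf ?mul1r// sqrtr_eq0 -ltNge.
    by split => y /=; rewrite rs.
  - apply: filterS zS => x zSx; rewrite -[X in _ --> X](mul0r (S x)).
    apply: cvgM => //.
    by rewrite (cvg_shiftn N (fun n => \sum_(k < n) c k * z k x : R)).
  - by apply: aeW => x; exact: cvg_cst.
move=> /(_ [set 0] (measurable_set1 _)).
rewrite (_ : _ @^-1` _ = setT) ?probability_setT; last first.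
  by apply/seteqP; split.
have -> : normal_prob 0 1 (id @^-1` [set (0 : R)]) = 0%E := normal_prob_set1 0.
by move=> /eqP; rewrite onee_eq0.
Unshelve. all: by end_near. Qed.

Lemma integrable_of_sqr d (T : measurableType d) (R : realType) (P : probability T R)
    (S : T -> R) : measurable_fun setT S ->
  (\int[P]_x (S x ^+ 2)%:E < +oo)%E ->
  P.-integrable setT (fun x => (S x ^+ 2)%:E) /\ P.-integrable setT (EFin \o S).
Proof.
move=> mS foo.
have mS2 : measurable_fun setT (fun x => (S x ^+ 2)%:E).
  by apply/measurable_EFinP; exact: measurable_funX.
have i2 : P.-integrable setT (fun x => (S x ^+ 2)%:E).
  apply/integrableP; split => //.
  by under eq_integral do rewrite gee0_abs ?lee_fin ?sqr_ge0//.
split => //.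
have i3 : P.-integrable setT ((cst 1%:E) \+ (fun x => (S x ^+ 2)%:E))%E.
  by apply: integrableD => //; exact: finite_measure_integrable_cst.
apply: (le_integrable measurableT _ _ i3); first exact/measurable_EFinP.
move=> x _; change (`|S x|%:E <= `|1 + S x ^+ 2|%:E)%E; rewrite lee_fin [leRHS]ger0_norm; last first.
  by rewrite addr_ge0// sqr_ge0.
have := sqr_ge0 (`|S x| - 2^-1); rewrite -[S x ^+ 2]real_normK ?num_real//; nra.
Qed.

Lemma gaussian_moments d (T : measurableType d) (R : realType) (P : probability T R)
    (S : T -> R) (s : R) : measurable_fun setT S ->
  (forall A, measurable A ->
      P (S @^-1` A) = normal_prob 0 1 ((fun y => s * y) @^-1` A)) ->
  [/\ P.-integrable setT (fun x => (S x ^+ 2)%:E), P.-integrable setT (EFin \o S),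
     (\int[P]_x (S x ^+ 2)%:E = (s ^+ 2)%:E)%E & (\int[P]_x (S x)%:E = 0)%E].
Proof.
move=> mS law.
have ms : measurable_fun setT ((fun y => s * y) : measurableTypeR R -> R).
  exact: measurable_funM.
have [iy2 iy] : (normal_prob (0 : R) 1).-integrable setT (fun x => (x ^+ 2)%:E) /\
    (normal_prob (0 : R) 1).-integrable setT EFin.
  apply: (@integrable_of_sqr _ (measurableTypeR R) R (normal_prob 0 1) id) => //.
  by rewrite normal_second_moment ltry.
have E2 : (\int[P]_x (S x ^+ 2)%:E = (s ^+ 2)%:E)%E.
  rewrite (@ge0_integral_law _ _ _ _ _ _ _ P (normal_prob 0 1) S (fun y => s * y)
     (fun y => (y ^+ 2)%:E))//.
  - under eq_integral do rewrite exprMn EFinM.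
    rewrite ge0_integralZl ?lee_fin ?sqr_ge0// ?normal_second_moment ?mule1//.
    + by apply/measurable_EFinP; exact: exprn_measurable.
    + by move=> y _; rewrite lee_fin sqr_ge0.
  - by apply/measurable_EFinP; exact: exprn_measurable.
  - by move=> y; rewrite lee_fin sqr_ge0.
have [i2 i1] : P.-integrable setT (fun x => (S x ^+ 2)%:E) /\ P.-integrable setT (EFin \o S).
  by apply: integrable_of_sqr => //; rewrite E2 ltry.
split => //.
rewrite (@integral_law _ _ _ _ _ _ _ P (normal_prob 0 1) S (fun y => s * y) EFin)//.
  under eq_integral do rewrite EFinM.
  by rewrite integralZl// normal_mean// mule0.
have := integrableZl measurableT s iy.
by apply: eq_integrable => // y _ /=; rewrite EFinM.
Qed.

(** By polarisation: gaussian_limit applies to X + Y and to X - Y. *)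
Lemma gaussian_covariance d (T : measurableType d) (R : realType) (P : probability T R)
    (z : nat -> T -> R) (a b : nat -> R) (X Y : T -> R) :
  std_normal_seq P z -> measurable_fun setT X -> measurable_fun setT Y ->
  {ae P, forall x, \sum_(k < n) a k * z k x @[n --> \oo] --> X x} ->
  {ae P, forall x, \sum_(k < n) b k * z k x @[n --> \oo] --> Y x} ->
  exists2 l : R, \sum_(k < n) a k * b k @[n --> \oo] --> l & covariance P X Y = l%:E.
Proof.
move=> Hz mX mY zX zY.
have [u uc Pu] := gaussian_limit Hz mX zX.
have [v vc Pv] := gaussian_limit Hz mY zY.
have [_ _ _ EX] := gaussian_moments mX Pu.
have [_ _ _ EY] := gaussian_moments mY Pv.
have mD : measurable_fun setT (fun x => X x + Y x) by exact: measurable_funD.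
have mB : measurable_fun setT (fun x => X x - Y x) by exact: measurable_funB.
have zD : {ae P, forall x, \sum_(k < n) (a k + b k) * z k x @[n --> \oo] --> X x + Y x}.
  apply: filterS2 zX zY => x h1 h2.
  apply: cvg_trans (cvgD h1 h2); apply: near_eq_cvg; apply: nearW => n /=.
  by rewrite -[LHS]big_split; apply: eq_bigr => k _; rewrite mulrDl.
have zB : {ae P, forall x, \sum_(k < n) (a k - b k) * z k x @[n --> \oo] --> X x - Y x}.
  apply: filterS2 zX zY => x h1 h2.
  apply: cvg_trans (cvgB h1 h2); apply: near_eq_cvg; apply: nearW => n /=.
  by rewrite -[LHS]sumrB; apply: eq_bigr => k _; rewrite mulrBl.
have [s sc Ps] := gaussian_limit (c := fun k => a k + b k) Hz mD zD.
have [t tc Pt] := gaussian_limit (c := fun k => a k - b k) Hz mB zB.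
have [iD _ ED _] := gaussian_moments mD Ps.
have [iB _ EB _] := gaussian_moments mB Pt.
exists (4^-1 * (s ^+ 2 - t ^+ 2)).
  have -> : (fun n => \sum_(k < n) a k * b k) =
    (fun n : nat => 4^-1 * (\sum_(k < n) (a k + b k) ^+ 2 - \sum_(k < n) (a k - b k) ^+ 2)).
    apply/funext => n; rewrite -sumrB mulr_sumr; by apply: eq_bigr => k _; field.
  by apply: cvgM; [exact: cvg_cst|exact: cvgB].
rewrite covariance.unlock !expectation.unlock EX EY /=.
transitivity (\int[P]_x (4^-1%:E * (((X x + Y x) ^+ 2)%:E - ((X x - Y x) ^+ 2)%:E)))%E.
  by apply: eq_integral => x _; rewrite -EFinB -EFinM; congr _%:E; change ((X x - 0) * (Y x - 0) = 4^-1 * ((X x + Y x) ^+ 2 - (X x - Y x) ^+ 2)); field.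
rewrite integralZl//; last exact: integrableB.
by rewrite integralB// ED EB.
Qed.

(** * Functionals of normal sequences on different probability spaces *)

Lemma cvg_row (R : realType) (m : nat) (u : nat -> 'I_m -> R) (v : 'I_m -> R) :
  (forall i, u n i @[n --> \oo] --> v i) ->
  (\row_i u n i)%R @[n --> \oo] --> (\row_i v i : 'rV[R]_m).
Proof.
move=> uv; apply/cvg_ballP => e e0.
have : \forall n \near \oo, forall i, ball (v i) e (u n i).
  apply: filter_forall => i; exact: (cvg_ball (uv i)).
apply: filterS => n H; split => // i j; rewrite !mxE; exact: H.
Qed.

(** After rounding the entries down to multiples of 1 / (n + 1), the vector takes
    countably many values; it converges to the given vector as n grows. *)
Lemma measurable_continuous_row d (T : measurableType d) (R : realType) (m : nat)
    (X : 'I_m -> T -> R) (phi : 'rV[R]_m -> R) :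
  (forall i, measurable_fun setT (X i)) -> continuous phi ->
  measurable_fun setT (fun x => phi (\row_i X i x)).
Proof.
move=> mX cphi.
pose rnd (n : nat) (r : R) : R := (Num.floor (n.+1%:R * r))%:~R / n.+1%:R.
have rnd_cvg r : rnd n r @[n --> \oo] --> r.
  apply/cvgrPdist_lt => e e0; near=> n.
  rewrite /rnd; set q := n.+1%:R * r.
  have n1 : 0 < n.+1%:R :> R by [].
  have -> : r - (Num.floor q)%:~R / n.+1%:R = (q - (Num.floor q)%:~R) / n.+1%:R.
    by rewrite /q mulrBl mulrAC mulfV ?mul1r// gt_eqF.
  have /andP[h1 h2] := floor_itv q.
  rewrite ger0_norm ?divr_ge0 ?subr_ge0// ltr_pdivrMr//.
  have : e^-1 < n.+1%:R.
    rewrite (@lt_le_trans _ _ n%:R) ?ler_nat//; near: n; exact: nbhs_infty_gtr.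
  rewrite invf_plt ?posrE// => h3; rewrite (@lt_le_trans _ _ 1)//.
    by rewrite ltrBlDr addrC -intrD1.
  by rewrite -ler_pdivrMr// div1r ltW.
have step n : measurable_fun setT (fun x => phi (\row_i rnd n (X i x))).
  move=> _ A mA; rewrite setTI.
  pose F (v : 'rV[int]_m) := if pselect (A (phi (\row_i ((v 0 i)%:~R / n.+1%:R)))) then
    \bigcap_(i in [set: 'I_m]) ((fun x => n.+1%:R * X i x) @^-1` `[(v 0 i)%:~R, (v 0 i + 1)%:~R[) else set0.
  rewrite (_ : _ @^-1` A = \bigcup_v F v); last first.
    apply/seteqP; split => x /=.
      move=> Ax; exists (\row_i Num.floor (n.+1%:R * X i x)) => //; rewrite /F; case: pselect => [a /=|].
        by move=> i _ /=; rewrite mxE in_itv /=; exact: floor_itv.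
      by case; rewrite [X in phi X](_ : _ = \row_i rnd n (X i x))//; apply/rowP => i; rewrite !mxE.
    move=> [v _]; rewrite /F; case: pselect => //= Av H.
    rewrite [X in phi X](_ : _ = (\row_i ((v 0 i)%:~R / n.+1%:R)))//; apply/rowP => i; rewrite !mxE /rnd.
    congr (_%:~R / _); apply/floor_def; have := H i Logic.I; by rewrite /= in_itv.
  apply: countable_bigcupT_measurable; first exact: countableP.
  move=> v; rewrite /F; case: pselect => [a|a] //=; apply: fin_bigcap_measurable => // i _.
  rewrite -[X in measurable X]setTI; apply: (measurable_funM (measurable_cst _) (mX i)) => //.
apply: (measurable_fun_cvg (h := fun n x => phi (\row_i rnd n (X i x)))) => // x _.
by apply: continuous_cvg; [exact: cphi|apply: cvg_row => i; exact: rnd_cvg].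
Unshelve. all: by end_near. Qed.

(** As only finitely many coordinates are constrained, std_normal_seq gives the
    mass of a cylinder. *)
Definition cylinder (R : realType) : set (set (nat -> R)) :=
  [set C | exists n (B : nat -> set R),
    [/\ forall k, measurable (B k), forall k, (n <= k)%N -> B k = setT &
        C = [set u | forall k, B k (u k)]]].

(** Real sequences with the product sigma-algebra. *)
Definition path_space (R : realType) := g_sigma_algebraType (@cylinder R).

Lemma cylinder_setI (R : realType) : setI_closed (@cylinder R).
Proof.
move=> _ _ [n [B [mB BT ->]]] [n' [B' [mB' BT' ->]]].
exists (maxn n n'), (fun k => B k `&` B' k); split.
- by move=> k; exact: measurableI.
- by move=> k; rewrite geq_max => /andP[nk n'k]; rewrite BT// BT'// setIT.
- by apply/seteqP; split => u /= => [[h h'] k|h]; [split|split => k; have [] := h k].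
Qed.

Lemma measurable_path d (T : measurableType d) (R : realType) (z : nat -> T -> R) :
  (forall k, measurable_fun setT (z k)) ->
  measurable_fun setT ((fun x => z^~ x) : T -> path_space R).
Proof.
move=> mz; apply: (@measurability _ _ T (path_space R) setT _ (@cylinder R) erefl).
move=> _ [_ [n [B [mB _ ->]]] <-]; rewrite setTI.
rewrite (_ : _ @^-1` _ = \bigcap_k (z k @^-1` B k)); last first.
  by apply/seteqP; split => x /= h k; [move=> _|]; exact: h.
by apply: bigcapT_measurable => k; rewrite -[X in measurable X]setTI; exact: mz.
Qed.

Lemma measurable_coord (R : realType) (k : nat) :
  measurable_fun setT (fun u : path_space R => u k).
Proof.
move=> _ A mA; rewrite setTI; apply: sub_sigma_algebra.
exists k.+1, (fun j => if j == k then A else setT); split.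
- by move=> j; case: ifP.
- by move=> j kj; rewrite gtn_eqF.
- apply/seteqP; split => u /= => [Au j|/(_ k)]; last by rewrite eqxx.
  by case: eqP => // ->.
Qed.

Lemma std_normal_seq_law d d' (T : measurableType d) (T' : measurableType d') (R : realType)
    (P : probability T R) (P' : probability T' R) (z : nat -> T -> R) (z' : nat -> T' -> R) :
  std_normal_seq P z -> std_normal_seq P' z' ->
  forall A : set (path_space R), measurable A ->
    P ((fun x => z^~ x) @^-1` A) = P' ((fun x => z'^~ x) @^-1` A).
Proof.
move=> [mz Hz] [mz' Hz'] A mA.
change (image_measure P (measurable_path mz) A = image_measure P' (measurable_path mz') A).
apply: (@measure_unique _ R (path_space R) (@cylinder R) (fun=> setT)) => //.
- exact: cylinder_setI.
- by move=> _; exists 0%N, (fun=> setT); split => //; apply/seteqP; split.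
- by apply/seteqP; split => // x _; exists 0%N.
- move=> _ [n [B [mB BT ->]]]; rewrite /= /pushforward.
  have E (d0 : measure_display) (T0 : measurableType d0) (z0 : nat -> T0 -> R) :
      (fun x => z0^~ x) @^-1` [set u | forall k, B k (u k)] =
      \big[setI/setT]_(k <- iota 0 n) (z0 k @^-1` B k).
    rewrite -bigcap_seq; apply/seteqP; split => x /= h k.
      by move=> _; exact: h.
    have [kn|nk] := ltnP k n; last by rewrite BT.
    by apply: h; rewrite /= mem_iota.
  by rewrite !E Hz ?Hz' ?iota_uniq.
- by move=> k; rewrite /= /pushforward preimage_setT probability_setT ltry.
Qed.

(** This lets the fields, which live on different probability spaces, be compared
    with kappa on the space of the latter. *)
Lemma std_normal_seq_transfer d d' (T : measurableType d) (T' : measurableType d')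
    (R : realType) (P : probability T R) (P' : probability T' R)
    (z : nat -> T -> R) (z' : nat -> T' -> R) (m n : nat) (c : 'I_m -> nat -> R)
    (phi : 'rV[R]_m -> R) (M : R) :
  std_normal_seq P z -> std_normal_seq P' z' ->
  continuous phi -> (forall u, `|phi u| <= M) ->
  (\int[P]_x (phi (\row_i \sum_(k < n) c i k * z k x))%:E =
   \int[P']_x (phi (\row_i \sum_(k < n) c i k * z' k x))%:E)%E.
Proof.
move=> Hz Hz' cphi phiM; have [mz _] := Hz; have [mz' _] := Hz'.
apply: (@bounded_integral_law _ _ _ _ _ (path_space R) _ P P' (fun x => z^~ x) (fun x => z'^~ x)
  (fun u => phi (\row_i \sum_(k < n) c i k * u k)) M).
- exact: measurable_path.
- exact: measurable_path.
- apply: measurable_continuous_row => // i.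
  by apply: (measurable_series_coef (T := path_space R) (z := fun k u => u k)) => k; exact: measurable_coord.
- by [].
- exact: std_normal_seq_law.
Qed.

(** * Moments of the product of points *)

Lemma moment_integral d (T : measurableType d) (R : realType) (P : probability T R)
    (Y : {RV P >-> R}) k : {ae P, forall x, `|Y x| <= 1} ->
  P.-integrable setT (fun x => (Y x ^+ k)%:E) /\
  (moment Y k)%:E = (\int[P]_x (Y x ^+ k)%:E)%E.
Proof.
move=> Y1.
have mYk : measurable_fun setT (fun x => (Y x ^+ k)%:E).
  by apply/measurable_EFinP; apply: measurable_funX; exact: measurable_funPT.
have i1 : P.-integrable setT (fun x => (Y x ^+ k)%:E).
  apply/integrableP; split => //.
  apply: (@le_lt_trans _ _ (\int[P]_x (cst 1 x))%E); last first.
    by rewrite integral_cst// mul1e (le_lt_trans (probability_le1 _ measurableT))// ltry.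
  apply: ae_ge0_le_integral => //; first exact: measurableT_comp.
  by apply: filterS Y1 => x h _; rewrite lee_fin normrX exprn_ile1.
split => //; rewrite /moment expectation.unlock fineK//.
exact: integrable_fin_num.
Qed.

Lemma point_product_norm_le1 d (T : measurableType d) (R : realType) (P : probability T R)
    (Xi : point_process T R) (Z : T -> R) :
  is_point_product P Xi id Z -> {ae P, forall x, `|Z x| <= 1}.
Proof.
apply: filterS => x /cvg_norm/(_ _) h.
have {}h : `|\prod_(j < n | active Xi j x) location Xi j x| @[n --> \oo] --> `|Z x| by exact: h.
rewrite -(cvg_lim (@Rhausdorff R) h); apply: limr_le; first by apply/cvg_ex; exists `|Z x|.
apply: nearW => n; rewrite normr_prod prodr_ile1// => j aj.
by rewrite normr_ge0 /= ler_norml (location_bound aj).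
Qed.

Lemma point_product_exp d (T : measurableType d) (R : realType) (P : probability T R)
    (Xi : point_process T R) (Z : T -> R) k :
  is_point_product P Xi id Z ->
  is_point_product P Xi (fun u => u ^+ k) (fun x => Z x ^+ k).
Proof.
apply: filterS => x h.
have -> : (fun n : nat => \prod_(j < n | active Xi j x) location Xi j x ^+ k) =
   (fun n : nat => (\prod_(j < n | active Xi j x) location Xi j x) ^+ k).
  by apply/funext => n; rewrite prodrXl.
by apply: (@continuous_cvg _ _ _ _ _ _ (fun u : R => u ^+ k)); [exact: exprn_continuous|exact: h].
Qed.

(** The k-th power of the product of points is the product of the k-th powers, so
    its mean is the generating functional at u |-> u ^+ k. *)
Lemma product_of_points_moment d (T : measurableType d) (R : realType) (P : probability T R)
    (Y : {RV P >-> R}) (G : (R -> R) -> R) :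
  distributed_as_product_of_points Y G ->
  {ae P, forall x, `|Y x| <= 1} /\ forall k, moment Y k = G (fun u => u ^+ k).
Proof.
move=> [d' [T' [P' [Xi [Z [hG hZ law]]]]]].
have mY : measurable_fun setT Y by exact: measurable_funPT.
have mZ : measurable_fun setT Z by exact: measurable_funPT.
have Z1 := point_product_norm_le1 hZ.
pose A := [set u : R | 1 < `|u|].
have mA : measurable A.
  rewrite (_ : A = Num.norm @^-1` `]1, +oo[); last first.
    by apply/seteqP; split => u; rewrite /A /= in_itv /= andbT.
  by rewrite -[X in measurable X]setTI; apply: normr_measurable.
have Y1 : {ae P, forall x, `|Y x| <= 1}.
  have mYA : measurable (Y @^-1` A) by rewrite -[X in measurable X]setTI; exact: mY.
  have mZA : measurable (Z @^-1` A) by rewrite -[X in measurable X]setTI; exact: mZ.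
  have AE (d0 : measure_display) (T0 : measurableType d0) (V : T0 -> R) :
      ~` [set x | `|V x| <= 1] = V @^-1` A.
    by apply/seteqP; split => x /=; rewrite /A /= ltNge => /negP.
  have ZA : P' (Z @^-1` A) = 0%E.
    by apply: measure_negligible => //; rewrite -AE.
  exists (Y @^-1` A); split => //; first by have := law A mA; rewrite /distribution /pushforward ZA.
  by rewrite -AE.
split => // k.
have mZk : measurable_fun setT (fun x => Z x ^+ k) by exact: measurable_funX.
pose Zk : {RV P' >-> R} := mfun_Sub (mem_set mZk : (fun x => Z x ^+ k) \in mfun).
have pk : is_point_product P' Xi (fun u => u ^+ k) Zk by exact: point_product_exp.
have := hG (fun u => u ^+ k) Zk (exprn_measurable _) _ pk.
rewrite expectation.unlock => EG.
have [iY EY] := moment_integral k Y1.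
have [iZ EZ] := moment_integral k Z1.
apply: EFin_inj; rewrite EY -EG.
  by apply: (@integral_law _ _ _ _ _ _ _ P P' Y Z (fun u => (u ^+ k)%:E)) => //;
    apply/measurable_EFinP; exact: exprn_measurable.
move=> u u1; rewrite -ler_norml normrX exprn_ile1// ler_norml//.
Qed.

Lemma pgfl_ge0 (R : realType) (nu : {measure set R -> \bar R}) (f : R -> R) :
  (forall u, -1 <= u <= 1 -> f u <= 1) -> 0 <= pgfl nu f.
Proof.
move=> f1; rewrite /pgfl.
have : (0 <= \int[nu]_(xi in `[(-1)%R, 1%R]) (1 - f xi)%:E)%E.
  by apply: integral_ge0 => u; rewrite /= in_itv /= => /f1; rewrite lee_fin subr_ge0.
case: (\int[_]_(_ in _) _)%E => // r; rewrite lee_fin => r0.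
by rewrite invr_ge0 addr_ge0.
Qed.

(** Both moments are values of generating functionals at u |-> u ^+ k, one the
    square root of the other; the latter is non-negative, so taking the square
    root loses nothing. *)
Lemma sqr_moment_half (R : realType) (nu : {measure set R -> \bar R})
    (dY dH : measure_display) (TY : measurableType dY) (TH : measurableType dH)
    (PY : probability TY R) (PH : probability TH R) (Y : {RV PY >-> R}) (Yh : {RV PH >-> R}) k :
  distributed_as_product_of_points Y (pgfl nu) ->
  distributed_as_product_of_points Yh (pgfl_half nu) ->
  moment Yh k ^+ 2 = moment Y k.
Proof.
move=> /product_of_points_moment[_ ->] /product_of_points_moment[_ ->].
rewrite /pgfl_half; have G0 : 0 <= pgfl nu (fun u => u ^+ k).
  apply: pgfl_ge0 => u; rewrite -ler_norml => u1.
  by rewrite (le_trans (ler_norm _))// normrX exprn_ile1.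
by rewrite powR12_sqrt// sqr_sqrtr.
Qed.

Lemma moment0 d (T : measurableType d) (R : realType) (P : probability T R)
    (Y : {RV P >-> R}) : moment Y 0 = 1.
Proof.
rewrite /moment (_ : (fun x => _) = cst 1) ?expectation_cst//.
Qed.

(** * Consequences of the convergence of the series at the origin *)

(** The functions u / (u^2 + 1 / (n + 1)) are continuous and tend to u^-1, also at
    0, where the inverse is 0 by convention. *)
Lemma measurable_inv (R : realType) : measurable_fun [set: R] (fun u : R => u^-1).
Proof.
pose h (n : nat) (u : R) := u * (u ^+ 2 + n.+1%:R^-1)^-1.
have pos n u : 0 < u ^+ 2 + n.+1%:R^-1 :> R by rewrite ltr_wpDl ?sqr_ge0// invr_gt0.
apply: (measurable_fun_cvg (h := h)) => [n|u _].
  apply: continuous_measurable_fun => u; apply: cvgM; first exact: cvg_id.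
  apply: cvgV; first by rewrite gt_eqF.
  by apply: cvgD; [exact: exprn_continuous|exact: cvg_cst].
rewrite /h; have [->|u0] := eqVneq u 0.
  by under eq_fun do rewrite mul0r; rewrite invr0; exact: cvg_cst.
have -> : u^-1 = u * (u ^+ 2 + 0)^-1 by field.
apply: cvgM; first exact: cvg_cst.
apply: cvgV; first by rewrite addr0 expf_neq0.
by apply: cvgD; [exact: cvg_cst|exact: cvg_harmonic].
Qed.

Lemma measurable_sqrt (R : realType) : measurable_fun [set: R] (Num.sqrt : R -> R).
Proof. by apply: continuous_measurable_fun; exact: sqrt_continuous. Qed.

Lemma moment_sum d (T : measurableType d) (R : realType) (P : probability T R)
    (Y : {RV P >-> R}) (c : nat -> R) (s : seq nat) : {ae P, forall x, `|Y x| <= 1} ->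
  P.-integrable setT (fun x => (\sum_(k <- s) c k * Y x ^+ k)%:E) /\
  (\int[P]_x (\sum_(k <- s) c k * Y x ^+ k)%:E = (\sum_(k <- s) c k * moment Y k)%:E)%E.
Proof.
move=> Y1; have int1 k := moment_integral k Y1.
have i1 k : P.-integrable setT (fun x => (c k)%:E * (Y x ^+ k)%:E)%E.
  by apply: integrableZl => //; have [] := int1 k.
elim: s => [|k s [iS Es]].
  under eq_fun do rewrite big_nil; split; first exact: integrable0.
  by rewrite integral0 big_nil.
split.
  by apply: eq_integrable (integrableD measurableT (i1 k) iS) => // x _; rewrite big_cons EFinD EFinM.
under eq_integral do rewrite big_cons EFinD EFinM.
rewrite integralD// Es integralZl//; last by have [] := int1 k.
by have [_ <-] := int1 k; rewrite -EFinM -EFinD big_cons.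
Qed.

(** At t = s = 0 the terms are non-negative, since the odd Hermite polynomials
    vanish there.  Hence the series W of the a k * Y ^+ k has the finite mean l,
    and is finite almost surely.  By Mehler's formula, W is at least a positive
    multiple of 1 / sqrt (1 - r^2 Y^2) for every r < 1, which bounds |Y| away
    from 1 and makes 1 / sqrt (1 - Y^2) integrable. *)
Lemma moment_summable_weight d (T : measurableType d) (R : realType) (P : probability T R)
    (Y : {RV P >-> R}) (l : R) : {ae P, forall x, `|Y x| <= 1} ->
  \sum_(k < n) moment Y k * mehler_coef 0 0 k @[n --> \oo] --> l ->
  {ae P, forall x, `|Y x| < 1} /\
  P.-integrable setT (fun x => ((Num.sqrt (1 - Y x ^+ 2))^-1)%:E).
Proof.
move=> Y1 mul.
pose a k : R := mehler_coef 0 0 k.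
have a0 k : 0 <= a k by rewrite /a /mehler_coef -expr2 sqr_ge0.
have aodd k : odd k -> a k = 0.
  by move=> ok; rewrite /a /mehler_coef /hermite_coef hermite_odd0// !mulr0.
have t0 x k : 0 <= a k * Y x ^+ k.
  have [ok|ek] := boolP (odd k); first by rewrite aodd// mul0r.
  by rewrite mulr_ge0// exprn_even_ge0.
have mY : measurable_fun setT Y by exact: measurable_funPT.
pose f k x := (a k * Y x ^+ k)%:E.
have mf k : measurable_fun setT (f k).
  by apply/measurable_EFinP; apply: measurable_funM => //; exact: measurable_funX.
pose W x := (\sum_(k <oo) f k x)%E.
have W0 x : (0 <= W x)%E by apply: nneseries_ge0 => k _ _; rewrite lee_fin.
have mW : measurable_fun setT W.
  by apply: ge0_emeasurable_sum => // k x _ _; rewrite lee_fin.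
have iW : (\int[P]_x W x = l%:E)%E.
  rewrite integral_nneseries//; last by move=> k x _; rewrite lee_fin.
  apply/cvg_lim => //.
  have -> : (fun n => \sum_(0 <= k < n) \int[P]_x f k x)%E = (fun n : nat => (\sum_(k < n) moment Y k * a k)%:E).
    apply/funext => n; rewrite -sumEFin big_mkord; apply: eq_bigr => k _.
    have [_] := moment_sum a [:: val k] Y1.
    rewrite big_seq1 mulrC => <-; apply: eq_integral => x _; rewrite big_seq1 //.
  exact: cvg_comp mul _.
have Wfin : {ae P, forall x, (W x < +oo)%E}.
  have : P.-integrable setT W.
    apply/integrableP; split => //; under eq_integral do rewrite gee0_abs//.
    by rewrite iW ltry.
  move=> /(integrable_ae measurableT); apply: filterS => x /(_ Logic.I).
  by rewrite ge0_fin_numE.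
(* This covers r < 1 when |Y x| = 1, and r = 1 when |Y x| < 1. *)
have key x r : 0 <= r -> r <= 1 -> `|r * Y x| < 1 -> ((binormal_pdf 0 0 (r * Y x))%:E <= W x)%E.
  move=> r0 r1 ry.
  have mf1 := @mehler_formula R 0 0 _ ry.
  have : (pseries (mehler_coef 0 0) (r * Y x) n)%:E @[n --> \oo] --> (binormal_pdf 0 0 (r * Y x))%:E.
    exact: cvg_comp mf1 _.
  move=> c1; rewrite -(cvg_lim (@ereal_hausdorff _) c1); apply: lee_lim.
  - by apply/cvg_ex; eexists; exact: c1.
  - by apply: is_cvg_nneseries => k _ _; rewrite lee_fin.
  - apply: nearW => n; rewrite /pseries /series /= sumEFin lee_fin; apply: ler_sum => k _.
    rewrite exprMn; have := t0 x k; rewrite -/(a k) => h.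
    by rewrite mulrCA ler_piMl// exprn_ile1.
have bE (u : R) : `|u| < 1 -> binormal_pdf 0 0 u = (2 * pi)^-1 * (Num.sqrt (1 - u ^+ 2))^-1.
  by move=> u1; rewrite /binormal_pdf !mulr0 !expr0n /= subr0 addr0 mul0r oppr0 expR0 mulr1 invfM.
have Ylt : {ae P, forall x, `|Y x| < 1}.
  apply: filterS2 Y1 Wfin => x y1 Wx; rewrite lt_neqAle y1 andbT; apply/negP => /eqP yE.
  case: (W x) (W0 x) Wx (key x) => // w; rewrite lee_fin => w0 _ {}key.
  pose C := 2 * pi * w; have C0 : 0 <= C by rewrite !mulr_ge0// pi_ge0.
  (* With r = sqrt (1 - q^2) the bound would give q^-1 <= C, but q^-1 = C + 2. *)
  pose q := (C + 2)^-1; have q0 : 0 < q by rewrite invr_gt0; lra.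
  have q1 : q < 1 by rewrite invf_lt1; lra.
  have q2 : 0 < 1 - q ^+ 2 by rewrite subr_gt0 exprn_ilt1// ltW.
  have r1 : Num.sqrt (1 - q ^+ 2) < 1.
    by rewrite -[ltRHS]sqrtr1 ltr_sqrt// gtrBl exprn_gt0.
  have ry : `|Num.sqrt (1 - q ^+ 2) * Y x| < 1 by rewrite normrM yE mulr1 ger0_norm// sqrtr_ge0.
  have := key _ (sqrtr_ge0 _) (ltW r1) ry; rewrite lee_fin bE//.
  rewrite exprMn -[Y x ^+ 2]real_normK ?num_real// yE expr1n mulr1 sqr_sqrtr; last exact: ltW.
  rewrite opprB addrC subrK sqrtr_sqr gtr0_norm// invrK -ler_pdivlMl ?invr_gt0 ?mulr_gt0 ?pi_gt0//.
  by rewrite invrK -/C; lra.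
split => //.
have mD : measurable_fun setT (fun x => ((Num.sqrt (1 - Y x ^+ 2))^-1)%:E).
  apply/measurable_EFinP; apply: (measurableT_comp (@measurable_inv R)).
  apply: (measurableT_comp (@measurable_sqrt R)).
  by apply: measurable_funB => //; exact: measurable_funX.
apply/integrableP; split => //.
apply: (@le_lt_trans _ _ (\int[P]_x ((2 * pi)%:E * W x))%E); last first.
  by rewrite ge0_integralZl// ?iW -?EFinM ?ltry// lee_fin mulr_ge0// pi_ge0.
apply: ae_ge0_le_integral => //.
- exact: measurableT_comp.
- by move=> x _; rewrite mule_ge0// lee_fin mulr_ge0// pi_ge0.
- by apply: measurable_funeM.
apply: filterS Ylt => x y1 _ /=.
have := key x 1 ler01 (lexx _); rewrite !mul1r => /(_ y1); rewrite bE//.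
have p0 : 0 < 2 * pi :> R by rewrite mulr_gt0// pi_gt0.
move=> h; apply: (@le_trans _ _ ((2 * pi)%:E * ((2 * pi)^-1 * (Num.sqrt (1 - Y x ^+ 2))^-1)%:E)%E).
  by rewrite -EFinM lee_fin mulrA mulfV ?gt_eqF// mul1r ger0_norm// invr_ge0 sqrtr_ge0.
by rewrite lee_wpmul2l// lee_fin ltW.
Qed.

(** * Mean of Mehler's formula and uniform tails *)

(** Mehler's formula integrated over r = Y, by dominated convergence; the dominating
    function is provided by mehler_coef_bound. *)
Lemma mehler_mean d (T : measurableType d) (R : realType) (P : probability T R)
    (Y : {RV P >-> R}) (t s : R) :
  {ae P, forall x, `|Y x| < 1} ->
  P.-integrable setT (fun x => ((Num.sqrt (1 - Y x ^+ 2))^-1)%:E) ->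
  (\sum_(k < n) moment Y k * mehler_coef t s k)%:E @[n --> \oo] -->
    'E_P[fun x => binormal_pdf t s (Y x)]%E /\
  ('E_P[fun x => binormal_pdf t s (Y x)] \is a fin_num)%E.
Proof.
move=> Y1 iD.
have mY : measurable_fun setT Y by exact: measurable_funPT.
have Yle : {ae P, forall x, `|Y x| <= 1} by apply: filterS Y1 => x /ltW.
pose f n x := (\sum_(0 <= k < n) mehler_coef t s k * Y x ^+ k)%:E.
have ms := moment_sum (mehler_coef t s) _ Yle.
have mf n : measurable_fun setT (f n).
  by have [/measurable_int] := ms (index_iota 0 n).
have mb : measurable_fun setT (fun x => (binormal_pdf t s (Y x))%:E).
  apply/measurable_EFinP.
  have mq : measurable_fun setT (fun x => 1 - Y x ^+ 2).
    by apply: measurable_funB => //; exact: measurable_funX.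
  apply: measurable_funM.
    apply: (measurableT_comp (@measurable_inv R)); apply: measurable_funM => //.
    exact: measurableT_comp (@measurable_sqrt R) mq.
  apply: measurableT_comp => //; apply: measurableT_comp => //; apply: measurable_funM.
    apply: measurable_funD => //; apply: measurable_funB => //.
    by do 2! apply: measurable_funM => //; apply: measurable_funM.
  by apply: (measurableT_comp (@measurable_inv R)); apply: measurable_funM.
have fb : {ae P, forall x, setT x -> f n x @[n --> \oo] --> (binormal_pdf t s (Y x))%:E}.
  apply: filterS Y1 => x y1 _; exact: cvg_comp (@mehler_formula R t s _ y1) _.
have dom : {ae P, forall x n, setT x -> (`|f n x| <= ((Num.sqrt (1 - Y x ^+ 2))^-1)%:E)%E}.
  apply: filterS Y1 => x y1 n _; rewrite /f /= lee_fin.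
  apply: le_trans (ler_norm_sum _ _ _) _.
  under eq_bigr do rewrite normrM normrX.
  apply: le_trans (mehler_coef_bound t s n (normr_ge0 _) y1) _.
  rewrite real_normK ?num_real// invfM ler_piMl ?invr_ge0 ?sqrtr_ge0// invf_le1//.
  by rewrite ler1n.
have [ib _ cb] := dominated_convergence measurableT mf mb fb iD dom.
split; last by rewrite expectation.unlock; exact: integrable_fin_num.
rewrite expectation.unlock; apply: cvg_trans cb; apply: near_eq_cvg; apply: nearW => n.
transitivity (\int[P]_x (\sum_(0 <= k < n) mehler_coef t s k * Y x ^+ k)%:E)%E => //.
have [_ ->] := ms (index_iota 0 n).
by congr _%:E; rewrite big_mkord; apply: eq_bigr => k _; rewrite mulrC.
Qed.

(** With r = sqrt |Y|, one has |Y|^k <= r^K r^k for k >= K, so that the tail from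
    the rank K on is at most the mean of r^K / (2 sqrt (1 - r^2)).  This tends
    to 0 by dominated convergence, and it is the same for all sequences c that
    satisfy the bound, hence for all N. *)
Lemma moment_tail d (T : measurableType d) (R : realType) (P : probability T R)
    (Y : {RV P >-> R}) :
  {ae P, forall x, `|Y x| < 1} ->
  P.-integrable setT (fun x => ((Num.sqrt (1 - Y x ^+ 2))^-1)%:E) ->
  exists2 tau : nat -> R, tau K @[K --> \oo] --> 0 &
    forall c : nat -> R, (forall k, 0 <= c k) ->
      (forall r n, 0 <= r -> r < 1 ->
         \sum_(k < n) r ^+ k * c k <= (2 * Num.sqrt (1 - r ^+ 2))^-1) ->
      forall K n, \sum_(K <= k < n) moment Y k * c k <= tau K.
Proof.
move=> Y1 iD.
have mY : measurable_fun setT Y by exact: measurable_funPT.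
have Yle : {ae P, forall x, `|Y x| <= 1} by apply: filterS Y1 => x /ltW.
pose w K x := Num.sqrt `|Y x| ^+ K * (2 * Num.sqrt (1 - `|Y x|))^-1.
have w0 K x : 0 <= w K x by rewrite mulr_ge0 ?exprn_ge0 ?sqrtr_ge0// invr_ge0 mulr_ge0 ?sqrtr_ge0.
have mw K : measurable_fun setT (fun x => (w K x)%:E).
  have mn : measurable_fun setT (fun x => `|Y x|) by exact: measurableT_comp.
  apply/measurable_EFinP; apply: measurable_funM.
    by apply: measurable_funX; exact: measurableT_comp (@measurable_sqrt R) mn.
  apply: (measurableT_comp (@measurable_inv R)); apply: measurable_funM => //.
  by apply: measurableT_comp (@measurable_sqrt R) _; exact: measurable_funB.
have sqrt1 x : `|Y x| < 1 -> Num.sqrt `|Y x| < 1.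
  by move=> y1; rewrite -[ltRHS]sqrtr1 ltr_sqrt.
have wcvg : {ae P, forall x, setT x -> (w K x)%:E @[K --> \oo] --> (cst 0%E : T -> \bar R) x}.
  apply: filterS Y1 => x y1 _; apply: cvg_EFin; first exact: nearW.
  rewrite -[0 in X in _ --> X](mul0r ((2 * Num.sqrt (1 - `|Y x|))^-1)).
  apply: cvgM; last exact: cvg_cst.
  by apply: cvg_expr; rewrite ger0_norm ?sqrtr_ge0// sqrt1.
have wD K x : w K x <= (Num.sqrt (1 - Y x ^+ 2))^-1.
  have [y1|y1] := ltP `|Y x| 1; last first.
    by rewrite /w [Num.sqrt (1 - `|_|)]ler0_sqrtr ?subr_le0// mulr0 invr0 mulr0 invr_ge0 sqrtr_ge0.
  have h0 : 0 < 1 - `|Y x| by rewrite subr_gt0.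
  have h2 : 0 < 1 - Y x ^+ 2 by rewrite -real_normK ?num_real// subr_gt0 exprn_ilt1.
  apply: (@le_trans _ _ (2 * Num.sqrt (1 - `|Y x|))^-1).
    by rewrite /w ler_piMl ?invr_ge0 ?mulr_ge0 ?sqrtr_ge0// exprn_ile1 ?sqrtr_ge0// ltW// sqrt1.
  rewrite lef_pV2 ?posrE ?mulr_gt0 ?sqrtr_gt0//.
  have -> : 2 = Num.sqrt (2 ^+ 2) :> R by rewrite sqrtr_sqr ger0_norm.
  rewrite -sqrtrM ?sqr_ge0//; apply: ler_wsqrtr.
  have -> : Y x ^+ 2 = `|Y x| ^+ 2 by rewrite real_normK ?num_real.
  by have := normr_ge0 (Y x); nra.
have dom : {ae P, forall x K, setT x -> (`|(w K x)%:E| <= ((Num.sqrt (1 - Y x ^+ 2))^-1)%:E)%E}.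
  by apply: aeW => x K _; rewrite /= lee_fin ger0_norm.
have m0 : measurable_fun setT (cst 0%E : T -> \bar R) by exact: measurable_cst.
have iw K : P.-integrable setT (fun x => (w K x)%:E).
  apply: (le_integrable measurableT (mw K) _ iD) => x _.
  by rewrite /= lee_fin ger0_norm// ger0_norm// invr_ge0 sqrtr_ge0.
have [_ _ cw] := dominated_convergence measurableT mw m0 wcvg iD dom.
exists (fun K => fine (\int[P]_x (w K x)%:E)%E).
  move: cw; rewrite integral0 => cw.
  by apply: fine_cvg; exact: cw.
move=> c c0 cb K n.
rewrite -lee_fin fineK; last exact: integrable_fin_num.
have [iS ES] := moment_sum c (index_iota K n) Yle.
under eq_bigr do rewrite mulrC.
rewrite -ES; apply: le_trans (lee_abs _) _.
apply: le_trans (le_abse_integral _ measurableT (measurable_int _ iS)) _.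
apply: ae_ge0_le_integral => //.
- by apply: measurableT_comp => //; exact: measurable_int iS.
- by move=> x _; rewrite lee_fin.
apply: filterS Y1 => x y1 _; rewrite /= lee_fin.
apply: le_trans (ler_norm_sum _ _ _) _.
set r := Num.sqrt `|Y x|; have r0 : 0 <= r by exact: sqrtr_ge0.
have rE : r ^+ 2 = `|Y x| by rewrite sqr_sqrtr.
have r1 : r < 1 by exact: sqrt1.
apply: (@le_trans _ _ (r ^+ K * \sum_(K <= k < n) r ^+ k * c k)).
  rewrite mulr_sumr; apply: ler_sum_nat => k /andP[Kk _].
  rewrite normrM normrX (ger0_norm (c0 k)) -rE -exprM mulnC mulnS muln1 exprD.
  rewrite mulrC mulrA ler_wpM2r// ler_wpM2r ?exprn_ge0//.
  by apply: ler_wiXn2l => //; exact: ltW.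
rewrite /w ler_wpM2l ?exprn_ge0// -rE; apply: le_trans _ (cb r n r0 r1).
rewrite -(big_mkord xpredT (fun k => r ^+ k * c k)).
have t0 k : 0 <= r ^+ k * c k by rewrite mulr_ge0// exprn_ge0.
have [Kn|/ltnW nK] := leqP K n.
  by rewrite [leRHS](big_cat_nat (leq0n K))//= lerDr sumr_ge0.
by rewrite (big_geq nK); apply: sumr_ge0 => k _; exact: t0.
Qed.

(** The terms of rank below K converge, and the other ones contribute at most
    4 * tau K. *)
Lemma cvg_weighted_l2 (R : realType) (w : nat -> R) (a : nat -> nat -> R) (b tau : nat -> R) :
  (forall k, 0 <= w k) -> tau K @[K --> \oo] --> 0 ->
  (forall k, a N k @[N --> \oo] --> b k) ->
  (\forall N \near \oo, forall K n, \sum_(K <= k < n) w k * a N k ^+ 2 <= tau K) ->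
  (forall K n, \sum_(K <= k < n) w k * b k ^+ 2 <= tau K) ->
  forall e, 0 < e -> \forall N \near \oo, forall n,
    \sum_(k < n) w k * (a N k - b k) ^+ 2 <= e.
Proof.
move=> w0 tau0 ab ta tb e e0.
have [K tK] : exists K, tau K <= e / 8.
  have e8 : 0 < e / 8 by rewrite divr_gt0.
  have /cvgr_le/(_ _ e8) [K _ /(_ K (leqnn K)) /= HK] := tau0.
  by exists K.
have c0 : \sum_(k < K) w k * (a N k - b k) ^+ 2 @[N --> \oo] --> (0 : R).
  elim: K {tK} => [|K IH].
    by rewrite (_ : (fun N => _) = cst 0); [exact: cvg_cst|apply/funext => N; rewrite big_ord0].
  have c1 : w K * (a N K - b K) ^+ 2 @[N --> \oo] --> w K * (b K - b K) ^+ 2.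
    apply: cvgM; first exact: cvg_cst.
    apply: (@continuous_cvg _ _ _ _ _ _ (fun u : R => u ^+ 2)); first exact: exprn_continuous.
    by apply: cvgB => //; exact: cvg_cst.
  rewrite subrr expr0n /= mulr0 in c1.
  rewrite (_ : (fun N => _) = (fun N : nat => \sum_(k < K) w k * (a N k - b k) ^+ 2 +
      w K * (a N K - b K) ^+ 2)); last by apply/funext => N; rewrite big_ord_recr.
  by have := cvgD IH c1; rewrite addr0 => h; exact: h.
have e2 : 0 < e / 2 by rewrite divr_gt0.
have h1 : \forall N \near \oo, \sum_(k < K) w k * (a N k - b k) ^+ 2 <= e / 2.
  by move/cvgr_le: c0 => /(_ _ e2).
apply: filterS2 h1 ta => N hN taN n.
apply: (@le_trans _ _ (\sum_(0 <= k < maxn K n) w k * (a N k - b k) ^+ 2)).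
  rewrite -(big_mkord xpredT (fun k => w k * (a N k - b k) ^+ 2)).
  rewrite [leRHS](big_cat_nat (leq0n n)) ?leq_maxr//= lerDl.
  by apply: sumr_ge0 => k _; rewrite mulr_ge0// sqr_ge0.
rewrite (big_cat_nat (leq0n K)) ?leq_maxl//= big_mkord.
have : \sum_(K <= k < maxn K n) w k * (a N k - b k) ^+ 2 <=
   2 * (\sum_(K <= k < maxn K n) w k * a N k ^+ 2 + \sum_(K <= k < maxn K n) w k * b k ^+ 2).
  rewrite -big_split mulr_sumr; apply: ler_sum => k _ /=.
  have := sqr_ge0 (a N k + b k); have := w0 k; nra.
have := taN K (maxn K n); have := tb K (maxn K n); move: hN tK => /=; lra.
Qed.

(** * Convergence of finite-dimensional distributions *)

Lemma std_normal_seq_sign d (T : measurableType d) (R : realType) (P : probability T R)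
    (z : nat -> T -> R) :
  std_normal_seq P z -> std_normal_seq P (fun k x => (-1) ^+ k * z k x).
Proof.
move=> [mz Hz]; split => [k|s A us mA]; first by apply: measurable_funM => //; exact: mz.
pose B k := (fun y : R => (-1) ^+ k * y) @^-1` A k.
have mB k : measurable (B k).
  by rewrite -[X in measurable X]setTI; apply: measurable_funM.
transitivity (P (\big[setI/setT]_(k <- s) (z k @^-1` B k))) => //.
rewrite Hz//; apply: eq_bigr => k _; rewrite /B -signr_odd; case: (odd k).
  rewrite -[RHS]normal_probN//; congr normal_prob.
  by apply/seteqP; split => y /=; rewrite expr1 mulN1r.
by congr normal_prob; apply/seteqP; split => y /=; rewrite expr0 mul1r.
Qed.

(** The series of the squares has a finite mean, so it converges almost surely. *)
Lemma ae_cvg0_of_sqr d (T : measurableType d) (R : realType) (P : probability T R)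
    (D : nat -> T -> R) :
  (forall j, measurable_fun setT (D j)) ->
  (forall j, (\int[P]_x (D j x ^+ 2)%:E <= ((2^-1) ^+ j)%:E)%E) ->
  {ae P, forall x, D j x @[j --> \oo] --> 0}.
Proof.
move=> mD ID.
have mf j : measurable_fun setT (fun x => (D j x ^+ 2)%:E).
  by apply/measurable_EFinP; exact: measurable_funX.
pose W x := (\sum_(j <oo) (D j x ^+ 2)%:E)%E.
have W0 x : (0 <= W x)%E by apply: nneseries_ge0 => k _ _; rewrite lee_fin sqr_ge0.
have mW : measurable_fun setT W.
  by apply: ge0_emeasurable_sum => // k x _ _; rewrite lee_fin sqr_ge0.
have iW : (\int[P]_x W x <= 2%:E)%E.
  rewrite integral_nneseries//; last by move=> k x _; rewrite lee_fin sqr_ge0.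
  apply: lime_le.
    by apply: is_cvg_nneseries => k _ _; apply: integral_ge0 => x _; rewrite lee_fin sqr_ge0.
  apply: nearW => n; apply: (@le_trans _ _ (\sum_(0 <= j < n) ((2^-1) ^+ j)%:E)%E).
    by apply: lee_sum => j _; exact: ID.
  rewrite sumEFin lee_fin.
  have -> : \sum_(0 <= j < n) (2^-1) ^+ j = 2 - 2 * (2^-1) ^+ n :> R.
    elim: n => [|n IH]; first by rewrite big_geq// expr0; ring.
    by rewrite big_nat_recr//= IH exprS; field.
  by rewrite gerBl mulr_ge0// exprn_ge0// invr_ge0.
have : P.-integrable setT W.
  apply/integrableP; split => //; under eq_integral do rewrite gee0_abs//.
  by rewrite (le_lt_trans iW)// ltry.
move=> /(integrable_ae measurableT); apply: filterS => x /(_ Logic.I).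
rewrite ge0_fin_numE// => Wx.
have cs : cvgn (series (fun j => D j x ^+ 2)).
  apply: nondecreasing_is_cvgn.
    by apply/nondecreasing_seqP => n; rewrite /series /= big_nat_recr//= lerDl sqr_ge0.
  exists (fine (W x)) => _ [n _ <-]; rewrite -lee_fin fineK ?ge0_fin_numE//.
  rewrite /series /= -sumEFin; apply: nneseries_lim_ge => k _ _.
  by rewrite lee_fin sqr_ge0.
have := cvg_series_cvg_0 cs => c0.
apply: norm_cvg0.
have -> : (fun j => `|D j x|) = (fun j => Num.sqrt (D j x ^+ 2)).
  by apply/funext => j; rewrite sqrtr_sqr.
by rewrite -(@sqrtr0 R); apply: continuous_cvg; [exact: sqrt_continuous|exact: c0].
Qed.

(** Indices where r stays away from v could be selected, with Q j at the j-th one,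
    if r did not converge.  Thus convergence along indices chosen as sparsely as
    desired is enough. *)
Lemma cvg_of_subseq (R : realType) (r : nat -> R) (v : R) (Q : nat -> nat -> Prop) :
  (forall j, \forall N \near \oo, Q j N) ->
  (forall N : nat -> nat, (forall j, Q j (N j)) -> r (N j) @[j --> \oo] --> v) ->
  r N @[N --> \oo] --> v.
Proof.
move=> nearQ sub; apply: contrapT => /cvgrPdist_lt H.
have [e e0 He] : exists2 e, 0 < e & ~ \forall N \near \oo, `|v - r N| < e.
  apply: contrapT => H'; apply: H => e e0; apply: contrapT => He.
  by apply: H'; exists e.
have pick j : exists N, Q j N /\ e <= `|v - r N|.
  apply: contrapT => H'; apply: He; apply: filterS (nearQ j) => N QN.
  by rewrite ltNge; apply/negP => h; apply: H'; exists N.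
have [N HN] := choice pick.
have /cvgrPdist_lt/(_ _ e0) [j0 _ /(_ j0 (leqnn j0)) /=] := sub N (fun j => (HN j).1).
by rewrite ltNge (HN j0).2.
Qed.

(** Realised on the space of X, the N-th field differs from X by normal variables
    whose variances, the sums of the (a N t k - b t k) ^+ 2, tend to 0.  Along
    indices where the variances are at most 2^-j, the differences tend to 0
    almost surely and bounded convergence applies; cvg_of_subseq extends the
    conclusion to the whole sequence. *)
Lemma gaussian_fdd_cvg (R : realType) (I : Type)
    (dN : nat -> measure_display) (TN : forall N, measurableType (dN N))
    (PN : forall N, probability (TN N) R) (XN : forall N, I -> TN N -> R)
    (zN : forall N, nat -> TN N -> R)
    (d : measure_display) (T : measurableType d) (P : probability T R)
    (X : I -> T -> R) (z : nat -> T -> R)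
    (a : nat -> I -> nat -> R) (b : I -> nat -> R) :
  (forall N, std_normal_seq (PN N) (zN N)) -> std_normal_seq P z ->
  (forall N t, measurable_fun setT (XN N t)) -> (forall t, measurable_fun setT (X t)) ->
  (forall N t, {ae PN N, forall x, XN N t x = \sum_(k < N.+1) a N t k * zN N k x}) ->
  (forall t, {ae P, forall x, \sum_(k < n) b t k * z k x @[n --> \oo] --> X t x}) ->
  (forall N t k, (N < k)%N -> a N t k = 0) ->
  (forall t e, 0 < e -> \forall N \near \oo, forall n, \sum_(k < n) (a N t k - b t k) ^+ 2 <= e) ->
  fdd_cvg PN XN P X.
Proof.
move=> HzN Hz mXN mX XNz Xz a0 l2 m t phi cphi [M phiM]; have [mz _] := Hz.
pose W N i x : R := \sum_(k < N.+1) a N (t i) k * z k x.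
have mW N i : measurable_fun setT (W N i) by exact: measurable_series_coef.
have mphi (d0 : measure_display) (T0 : measurableType d0) (V : 'I_m -> T0 -> R) :
    (forall i, measurable_fun setT (V i)) -> measurable_fun setT (fun x => phi (\row_i V i x)).
  by move=> mV; exact: measurable_continuous_row.
have EN N : ('E_(PN N)[fun x => phi (\row_i XN N (t i) x)] = \int[P]_x (phi (\row_i W N i x))%:E)%E.
  rewrite expectation.unlock /W.
  rewrite -(std_normal_seq_transfer N.+1 (fun i => a N (t i)) (HzN N) Hz cphi phiM).
  have [mzN _] := HzN N.
  apply: ae_eq_integral => //.
  - by apply/measurable_EFinP; exact: mphi.
  - by apply/measurable_EFinP; apply: mphi => i; exact: measurable_series_coef.
  have : {ae PN N, forall x i, XN N (t i) x = \sum_(k < N.+1) a N (t i) k * zN N k x}.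
    by apply: filter_forall => i; exact: XNz.
  by apply: filterS => x h _ /=; congr (phi _)%:E; apply/rowP => i; rewrite !mxE.
rewrite (_ : (fun N => _) = (fun N => \int[P]_x (phi (\row_i W N i x))%:E)%E); last exact/funext.
rewrite expectation.unlock.
have iW N : P.-integrable setT (fun x => (phi (\row_i W N i x))%:E).
  by apply: bounded_integrable (mphi _ _ _ _) (fun x => phiM _) => i; exact: mW.
have iX : P.-integrable setT (fun x => (phi (\row_i X (t i) x))%:E).
  by apply: bounded_integrable (mphi _ _ _ _) (fun x => phiM _) => i; exact: mX.
have iWf N : (\int[P]_x (phi (\row_i W N i x))%:E)%E \is a fin_num by exact: integrable_fin_num.
have iXf : (\int[P]_x (phi (\row_i X (t i) x))%:E)%E \is a fin_num by exact: integrable_fin_num.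
pose r N := fine (\int[P]_x (phi (\row_i W N i x))%:E)%E.
rewrite -(fineK iXf) (_ : (fun N => _) = EFin \o r); last first.
  by apply/funext => N; rewrite /= fineK.
apply: cvg_EFin; first exact: nearW.
apply: (@cvg_of_subseq _ r _ (fun j N => forall i n,
   \sum_(k < n) (a N (t i) k - b (t i) k) ^+ 2 <= (2^-1) ^+ j)).
  move=> j; apply: filter_forall => i; apply: l2.
  by rewrite exprn_gt0// invr_gt0.
move=> Nj HN.
have c i : {ae P, forall x, W (Nj j) i x - X (t i) x @[j --> \oo] --> 0}.
  have mD j : measurable_fun setT (fun x => W (Nj j) i x - X (t i) x).
    by apply: measurable_funB => //; exact: mW.
  apply: ae_cvg0_of_sqr => // j.
  have Dz : {ae P, forall x, \sum_(k < n) (a (Nj j) (t i) k - b (t i) k) * z k x @[n --> \oo] -->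
      W (Nj j) i x - X (t i) x}.
    apply: filterS (Xz (t i)) => x Xx.
    have c1 : \sum_(k < n) a (Nj j) (t i) k * z k x @[n --> \oo] --> W (Nj j) i x.
      apply: cvg_near_cst; near=> n.
      rewrite /W -(big_mkord xpredT (fun k => a (Nj j) (t i) k * z k x)).
      rewrite -(big_mkord xpredT (fun k => a (Nj j) (t i) k * z k x)).
      rewrite (@big_cat_nat _ _ _ (Nj j).+1)//=; last by near: n; exact: nbhs_infty_ge.
      rewrite [X in _ + X]big_nat [X in _ + X]big1 ?addr0// => k /andP[h _].
      by rewrite a0// mul0r.
    apply: cvg_trans (cvgB c1 Xx); apply: near_eq_cvg; apply: nearW => n /=.
    by rewrite -[LHS]sumrB; apply: eq_bigr => k _; rewrite mulrBl.
  have [s sc Ps] := gaussian_limit (c := fun k => a (Nj j) (t i) k - b (t i) k) Hz (mD j) Dz.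
  have [_ _ -> _] := gaussian_moments (mD j) Ps.
  rewrite lee_fin -(cvg_lim (@Rhausdorff R) sc); apply: limr_le; first by apply/cvg_ex; exists (s ^+ 2).
  by apply: nearW => n; exact: HN.
have c' : {ae P, forall x i, W (Nj j) i x - X (t i) x @[j --> \oo] --> 0} by exact: filter_forall.
have cI : (\int[P]_x (phi (\row_i W (Nj j) i x))%:E)%E @[j --> \oo] -->
    (fine (\int[P]_x (phi (\row_i X (t i) x))%:E)%E)%:E; last by have /(_ _) := fine_cvg cI; apply.
rewrite fineK//; apply: (bounded_convergence (M := M)).
- by move=> j; apply: mphi => i; exact: mW.
- by apply: mphi => i; exact: mX.
- by move=> n x; exact: phiM.
- apply: filterS c' => x h; apply: continuous_cvg; first exact: cphi.
  apply: (@cvg_row _ _ (fun j i => W (Nj j) i x)) => i.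
  by apply/subr_cvg0; exact: h.
Unshelve. all: by end_near. Qed.

(** * The limit process and the level set sums *)

(** A linear combination of values of X is again the sum of a series in z, and
    gaussian_limit gives its law. *)
Lemma centered_gaussian_of_series d (T : measurableType d) (R : realType) (P : probability T R)
    (z : nat -> T -> R) (X : R -> {RV P >-> R}) (b : R -> nat -> R) :
  std_normal_seq P z ->
  (forall t, {ae P, forall x, \sum_(k < n) b t k * z k x @[n --> \oo] --> X t x}) ->
  centered_gaussian_process X.
Proof.
move=> Hz Xz s c _.
have mS : measurable_fun setT (fun x => \sum_(i <- s) c i * X i x).
  by apply: measurable_sum => i; apply: measurable_funM => //; exact: measurable_funPT.
have Sz : {ae P, forall x, \sum_(k < n) (\sum_(i <- s) c i * b i k) * z k x @[n --> \oo] -->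
    \sum_(i <- s) c i * X i x}.
  elim: s {mS} => [|i s IH].
    apply: aeW => x; rewrite big_nil (_ : (fun n => _) = cst 0); first exact: cvg_cst.
    by apply/funext => n; rewrite big1// => k _; rewrite big_nil mul0r.
  apply: filterS2 (Xz i) IH => x h1 h2.
  rewrite big_cons; apply: cvg_trans (cvgD (cvgM (cvg_cst (c i)) h1) h2).
  apply: near_eq_cvg; apply: nearW => n /=.
  rewrite -[LHS]/(c i * _ + _) mulr_sumr -big_split; apply: eq_bigr => k _ /=.
  by rewrite big_cons mulrDl mulrA.
have [sg _ Ps] := gaussian_limit (c := fun k => \sum_(i <- s) c i * b i k) Hz mS Sz.
have [sg0|sg0] := eqVneq sg 0; [left|right; exists sg] => // A mA; rewrite /pushforward Ps//.
  rewrite sg0 diracE; have [/set_mem A0|/negP A0] := boolP (0 \in A).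
    rewrite (_ : _ @^-1` A = setT) ?probability_setT//.
    by apply/seteqP; split => y //= _; rewrite mul0r.
  rewrite (_ : _ @^-1` A = set0) ?measure0//.
  by apply/seteqP; split => y //=; rewrite mul0r => /mem_set.
rewrite -(normal_prob_affine 0 sg0 mA); congr normal_prob.
by apply/seteqP; split => y /=; rewrite add0r.
Qed.

(** The signs attached to the variables z k are those that cvg_level_coef requires
    on the coefficients. *)
Lemma scaled_level_sum_series (T : Type) (R : realType) (N : nat)
    (g : N.-tuple bool -> T -> R) (m : nat -> R) (z : nat -> T -> R) (t : R) (x : T) :
  m 0%N = 1 ->
  level_set_sum g (level_index t N) x =
    'C(N, level_index t N)%:R * (Num.sqrt (2 ^+ N))^-1 *
      (z 0%N x + \sum_(1 <= k < N.+1)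
         m k * Num.sqrt 'C(N, k)%:R * krawtchouk R N k (level_index t N) * z k x) ->
  scaled_level_sum g t x =
  \sum_(k < N.+1) m k * ((-1) ^+ k * level_coef R N (level_index t N) k) * ((-1) ^+ k * z k x).
Proof.
move=> m0 E; rewrite /scaled_level_sum -/(level_index t N) E.
set v := level_index t N.
rewrite -(big_mkord xpredT (fun k => m k * ((-1) ^+ k * level_coef R N v k) * ((-1) ^+ k * z k x))).
rewrite big_ltn//= m0 !expr0 !mul1r.
have K0 : krawtchouk R N 0 v = 1.
  by rewrite /krawtchouk -/(kraw_coef R N 0 v) kraw_coef0 bin0 divr1.
rewrite {1}/level_coef bin0 sqrtr1 K0 !mulr1.
have sE : 2^-1 * Num.sqrt (N%:R / 2 ^+ N) * ('C(N, v)%:R / Num.sqrt (2 ^+ N)) =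
    Num.sqrt N%:R / 2 * ('C(N, v)%:R / 2 ^+ N) :> R.
  rewrite sqrtrM ?ler0n// sqrtrV ?exprn_ge0//.
  have s0 : Num.sqrt (2 ^+ N) != 0 :> R by rewrite sqrtr_eq0 -ltNge exprn_gt0.
  have s2 : 2 ^+ N = Num.sqrt (2 ^+ N) ^+ 2 :> R by rewrite sqr_sqrtr// exprn_ge0.
  rewrite [in RHS]s2; field; exact: s0.
rewrite mulrA sE mulrDr mulr_sumr; congr (_ + _).
apply: eq_bigr => k _; rewrite /level_coef.
have s1 : (-1) ^+ k * (-1) ^+ k = 1 :> R by rewrite -expr2 sqrr_sign.
set A := Num.sqrt N%:R / 2 * _; set B := Num.sqrt _; set K := krawtchouk _ _ _ _.
transitivity (((-1) ^+ k * (-1) ^+ k) * (A * (m k * B * K * z k x))); first by rewrite s1 mul1r.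
ring.
Qed.

Lemma measurable_scaled_level_sum d (T : measurableType d) (R : realType) (N : nat)
    (g : N.-tuple bool -> T -> R) (t : R) : (forall y, measurable_fun setT (g y)) ->
  measurable_fun setT (scaled_level_sum g t).
Proof.
move=> mg; apply: measurable_funM => //; rewrite /level_set_sum.
under eq_fun do rewrite big_mkcond.
by apply: measurable_sum => y; case: (count id y == _); [exact: mg|exact: measurable_cst].
Qed.

Lemma level_coef_gt (R : realType) (N v k : nat) : (N < k)%N -> level_coef R N v k = 0.
Proof. by move=> Nk; rewrite /level_coef (bin_small Nk) sqrtr0 mul0r mulr0. Qed.

Lemma cvg_level_coef_l2 d (T : measurableType d) (R : realType) (P : probability T R)
    (Y : {RV P >-> R}) (t : R) :
  {ae P, forall x, `|Y x| < 1} ->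
  P.-integrable setT (fun x => ((Num.sqrt (1 - Y x ^+ 2))^-1)%:E) ->
  (forall k, 0 <= moment Y k) ->
  forall e, 0 < e -> \forall N \near \oo, forall n,
    \sum_(k < n) moment Y k *
      ((-1) ^+ k * level_coef R N (level_index t N) k - hermite_coef t k) ^+ 2 <= e.
Proof.
move=> Y1 iD mu0.
have [tau tau0 tail] := moment_tail Y1 iD.
apply: (cvg_weighted_l2 (a := fun N k => (-1) ^+ k * level_coef R N (level_index t N) k) mu0 tau0).
- move=> k; have h := cvgM (cvg_cst ((-1 : R) ^+ k)) (@cvg_level_coef R (level_index t) t k (@cvg_level_index R t)).
  by rewrite mulrA -expr2 sqrr_sign mul1r in h; exact: h.
- apply: filterS (near_level_le (@cvg_level_index R t)) => N vN K n.
  under eq_bigr do rewrite exprMn sqrr_sign mul1r.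
  apply: (tail (fun k => level_coef R N (level_index t N) k ^+ 2)) => [k|r n' r0 r1]; first exact: sqr_ge0.
  apply: le_trans (level_coef_bound r0 r1 vN).
  pose f k := r ^+ k * level_coef R N (level_index t N) k ^+ 2.
  have f0 k : 0 <= f k by apply: mulr_ge0; [exact: exprn_ge0|exact: sqr_ge0].
  rewrite -(big_mkord xpredT f) -[leRHS](big_mkord xpredT f).
  have [nN|/ltnW Nn] := leqP n' N.+1.
    by rewrite [leRHS](big_cat_nat (leq0n n'))//= lerDl; apply: sumr_ge0 => k _; exact: f0.
  rewrite (big_cat_nat (leq0n N.+1))//= gerDl big_nat big1// => k /andP[Nk _].
  by rewrite /f level_coef_gt// expr0n mulr0.
- move=> K n; apply: (tail (fun k => hermite_coef t k ^+ 2)) => [k|r n' r0 r1].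
    exact: sqr_ge0.
  exact: hermite_coef_bound.
Qed.

Theorem proposition10 (R : realType)
  (* the fields g^(N) on {0,1}^N *)
  (dN : nat -> measure_display) (OmegaN : forall N, measurableType (dN N))
  (PN : forall N, probability (OmegaN N) R)
  (g : forall N, N.-tuple bool -> {RV (PN N) >-> R})
  (g_gaussian : forall N, centered_gaussian_process (g N))
  (* the measure on [-1,1] and the variables Y, Y_(1/2) *)
  (nu : {measure set R -> \bar R})
  (dY : measure_display) (OmegaY : measurableType dY)
  (PY : probability OmegaY R) (Y : {RV PY >-> R})
  (Y_law : distributed_as_product_of_points Y (pgfl nu))
  (dH : measure_display) (OmegaH : measurableType dH)
  (PH : probability OmegaH R) (Yhalf : {RV PH >-> R})
  (Yhalf_law : distributed_as_product_of_points Yhalf (pgfl_half nu))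
  (* the representation of the level set sums *)
  (zetaN : forall N, nat -> {RV (PN N) >-> R})
  (zetaN_iid : forall N, iid_std_normal (zetaN N))
  (representation : forall N v : nat,
    {ae PN N, forall x,
      level_set_sum (g N) v x =
      'C(N, v)%:R * (Num.sqrt (2 ^+ N))^-1 *
      (zetaN N 0%N x +
       \sum_(1 <= k < N.+1)
         moment Yhalf k * Num.sqrt 'C(N, k)%:R * krawtchouk R N k v *
         zetaN N k x)})
  (* the process kappa, defined by its almost surely convergent series *)
  (d : measure_display) (Omega : measurableType d) (P : probability Omega R)
  (zeta : nat -> {RV P >-> R}) (zeta_iid : iid_std_normal zeta)
  (kappa : R -> {RV P >-> R})
  (kappa_def : forall t : R,
    {ae P, forall x,
      (Num.sqrt (2 * pi))^-1 * expR (- (2^-1 * t ^+ 2)) *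
      (\sum_(0 <= k < n)
         moment Yhalf k * (Num.sqrt k`!%:R)^-1 * hermite k t * zeta k x)
      @[n --> \oo] --> kappa t x}) :
  [/\ centered_gaussian_process kappa,
      forall t s : R,
        let a := fun n : nat =>
          \sum_(1 <= k < n)
            moment Y k * (k`!%:R)^-1 * hermite k t * hermite k s in
        [/\ cvgn a,
            covariance P (kappa t) (kappa s) =
              ((2 * pi)^-1 * expR (- (2^-1 * (t ^+ 2 + s ^+ 2))) *
               (1 + limn a))%:E &
            covariance P (kappa t) (kappa s) =
              'E_PY[fun x => binormal_pdf t s (Y x)]%E] &
      fdd_cvg PN (fun N => scaled_level_sum (g N)) P kappa].
Proof.
have Hz := std_normal_seq_iid zeta_iid.
have muE k : moment Yhalf k ^+ 2 = moment Y k := sqr_moment_half k Y_law Yhalf_law.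
have mu0 k : 0 <= moment Y k by rewrite -muE sqr_ge0.
pose b t k := moment Yhalf k * hermite_coef t k.
have bz t : {ae P, forall x, \sum_(k < n) b t k * zeta k x @[n --> \oo] --> kappa t x}.
  apply: filterS (kappa_def t) => x; rewrite -/(gauss_density t).
  apply: cvg_trans; apply: near_eq_cvg; apply: nearW => n /=.
  rewrite big_mkord mulr_sumr; apply: eq_bigr => k _; rewrite /b /hermite_coef; ring.
have mk t : measurable_fun setT (kappa t) by exact: measurable_funPT.
have bb t s k : b t k * b s k = moment Y k * mehler_coef t s k.
  by rewrite -muE /b /mehler_coef; ring.
have [Yle _] := product_of_points_moment Y_law.
have cov t s : exists2 l : R, \sum_(k < n) moment Y k * mehler_coef t s k @[n --> \oo] --> l &
    covariance P (kappa t) (kappa s) = l%:E.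
  have [l lc ->] := gaussian_covariance Hz (mk t) (mk s) (bz t) (bz s).
  by exists l => //; under eq_fun do under eq_bigr do rewrite -bb.
have [l0 l0c _] := cov 0 0.
have [Y1 iD] := moment_summable_weight Yle l0c.
split.
- exact: centered_gaussian_of_series Hz bz.
- move=> t s a; have [l lc covE] := cov t s.
  pose G := gauss_density t * gauss_density s.
  have GE : G = (2 * pi)^-1 * expR (- (2^-1 * (t ^+ 2 + s ^+ 2))).
    rewrite /G /gauss_density mulrACA -expRD -invfM -expr2 sqr_sqrtr ?mulr_ge0 ?pi_ge0//.
    by congr (_ * expR _); ring.
  have G0 : G != 0 by rewrite GE mulf_neq0 ?invr_neq0 ?mulf_neq0 ?gt_eqF ?pi_gt0 ?expR_gt0.
  have al : a n @[n --> \oo] --> l / G - 1.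
    have h : (\sum_(k < n) moment Y k * mehler_coef t s k) / G - 1 @[n --> \oo] --> l / G - 1.
      by apply: cvgB; [apply: cvgM => //; exact: cvg_cst|exact: cvg_cst].
    apply: cvg_trans h; apply: near_eq_cvg; near=> n.
    have n0 : (0 < n)%N by near: n; exact: nbhs_infty_gt.
    rewrite -(big_mkord xpredT (fun k => moment Y k * mehler_coef t s k)).
    rewrite big_ltn// moment0 mehler_coefE -/G hermite0 hermite0 fact0 divr1 !mul1r mulr1.
    rewrite mulrDl mulfV// addrAC subrr add0r mulr_suml; apply: eq_bigr => k _.
    by rewrite mehler_coefE -/G; field; rewrite G0 /= pnatr_eq0 -lt0n fact_gt0.
  split.
  + by apply/cvg_ex; exists (l / G - 1).
  + rewrite covE (cvg_lim (@Rhausdorff R) al) -GE; congr _%:E; field; exact: G0.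
  + have [mc _] := mehler_mean t s Y1 iD.
    have lc' : (\sum_(k < n) moment Y k * mehler_coef t s k)%:E @[n --> \oo] --> l%:E.
      exact: cvg_comp lc _.
    by rewrite covE; exact: cvg_unique lc' mc.
- apply: (gaussian_fdd_cvg (zN := fun N k x => (-1) ^+ k * zetaN N k x)
     (a := fun N t k => moment Yhalf k * ((-1) ^+ k * level_coef R N (level_index t N) k))
     (b := b) _ Hz) => //.
  + by move=> N; apply: std_normal_seq_sign; exact: std_normal_seq_iid.
  + by move=> N t; apply: measurable_scaled_level_sum => y; exact: measurable_funPT.
  + move=> N t; apply: filterS (representation N (level_index t N)) => x.
    exact: (@scaled_level_sum_series _ R N (g N) (moment Yhalf) (zetaN N) t x (moment0 Yhalf)).
  + by move=> N t k Nk; rewrite level_coef_gt// !mulr0.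
  + move=> t e e0; have := cvg_level_coef_l2 t Y1 iD mu0 e0.
    apply: filterS => N h n; apply: le_trans (h n); apply: ler_sum => k _.
    by rewrite -muE /b -mulrBr exprMn.
Unshelve. all: by end_near. Qed.
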